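(* Let $G=(V,E)$ be a (finite or infinite) graph without isolated edge. Then there exists a function $\omega\colon E\to\{1,2,3\}$ such that for every edge $uv\in E$, either $s_\omega(u)\neq s_\omega(v)$, or $u$ and $v$ have the same infinite degree.
   Context: Graphs are simple and may be infinite (of arbitrary cardinality); an isolated edge is a connected component isomorphic to $K_2$. For an edge weighting $\omega\colon E\to\{1,2,3\}$, the weighted degree of a vertex $v$ is $s_\omega(v)=\sum_{w\in N(v)}\omega(vw)$, where $N(v)$ is the set of neighbours of $v$. If $v$ has finite degree this is a natural number; if $v$ has infinite degree $\kappa$, the sum of the positive integer weights is the cardinal $\kappa$, i.e. $s_\omega(v)$ equals the degree of $v$. *)

(* Defs.v *)
From Stdlib Require Import List.

Definition simple_graph {V : Type} (adj : V -> V -> Prop) : Prop :=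
  (forall u v, adj u v -> adj v u) /\ (forall v, ~ adj v v).

Definition equinumerous {A B : Type} (P : A -> Prop) (Q : B -> Prop) : Prop :=
  exists f : {x : A | P x} -> {y : B | Q y},
    (forall a b, f a = f b -> a = b) /\ (forall b, exists a, f a = b).

Definition finite_set {A : Type} (P : A -> Prop) : Prop :=
  exists l : list A, forall x, P x -> In x l.

Definition infinite_set {A : Type} (P : A -> Prop) : Prop := ~ finite_set P.

Definition isolated_edge {V : Type} (adj : V -> V -> Prop) (u v : V) : Prop :=
  adj u v /\ (forall w, adj u w -> w = v) /\ (forall w, adj v w -> w = u).

Definition weighting123 {V : Type} (adj : V -> V -> Prop) (w : V -> V -> nat) : Prop :=
  forall u v, adj u v -> w u v = w v u /\ 1 <= w u v <= 3.

(* The weighted degree s_w(v) as a cardinal: it is the cardinality of the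
   disjoint union over neighbours x of v of a set of size w(vx), i.e. the
   cardinal sum of the weights. *)
Definition wdeg_set {V : Type} (adj : V -> V -> Prop) (w : V -> V -> nat) (v : V)
  : V * nat -> Prop :=
  fun p => adj v (fst p) /\ snd p < w v (fst p).

Definition same_wdeg {V : Type} (adj : V -> V -> Prop) (w : V -> V -> nat) (u v : V) : Prop :=
  equinumerous (wdeg_set adj w u) (wdeg_set adj w v).

Definition same_infinite_degree {V : Type} (adj : V -> V -> Prop) (u v : V) : Prop :=
  infinite_set (adj u) /\ equinumerous (adj u) (adj v).

(* Main.v *)
(* Write the weights as 2 + x with x in {-1, 0, 1}, so that the weighted degree of
   v is 2 deg v + sum_u x(v, u).  For a finite connected graph on at least three
   vertices, split the vertices into [Ev], which will have even sums, and the rest,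
   which will have odd ones, and assign x first to the edges meeting [Ev].  The
   edges between odd vertices are assigned last: taking a maximum cut of the graph
   of odd vertices, adjacent odd vertices are separated, provided that the partial
   sum of each odd vertex v is congruent modulo 4 to a prescribed sign [al v].
   Such partial sums come from T-joins with adapted signs in a connected bipartite
   graph between an independent set E and its neighbourhood.  If an even number of
   vertices lie outside E this suffices; otherwise a leaf of E is made odd, or some
   edges between even vertices are accepted, and a case analysis around a maximal E
   missing some edge of the graph shows that their ends can be distinguished.

   Infinite graphs follow by compactness along an ultrafilter on finite lists of
   vertices: only edges between vertices of finite degree impose constraints, since
   an infinite degree d satisfies 3d = d. *)
Require Import Defs.
From mathcomp Require Import all_boot all_order all_algebra.
From mathcomp Require Import zify.
Set Implicit Arguments. Unset Strict Implicit. Unset Printing Implicit Defensive.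
Import Order.TTheory GRing.Theory Num.Theory.
Local Open Scope ring_scope.

(** * Flows, maximum cuts and the edges between odd vertices *)

(** Every edge counts in two sums, so the total of the sums of x is even and an even number of
    vertices have odd sums. This obstacle causes the case analysis: if the complement of [E] has odd
    size, no x makes exactly the vertices of [E] even, so some vertex must change its parity.

    The modulus 4 comes from the last stage. On one side of the cut, a vertex with k earlier
    neighbours can shift its sum by 4j - 2k with 0 <= j <= k: one value more than there are
    neighbours to avoid, all in one class modulo 4. The signs [al] are such that the final sums are
    1 modulo 4 on one side of the cut and -1 on the other. They depend only on the graph of odd
    vertices, hence are known before x.

    Corrections along a join depend only on residues of the values prescribed elsewhere. Edges
    between even vertices can therefore receive their final values once the join is known:
    prescribed values are exchanged for others with the same residues, and suitable signs separate
    the ends. *)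

Definition cutsize (V : finType) (m : rel V) (A : {set V}) : int :=
  \sum_x \sum_y [&& x \in A, y \notin A & m x y]%:R.

Lemma cutsize_submod (V : finType) (m : rel V) (A B : {set V}) :
  cutsize m (A :&: B) + cutsize m (A :|: B) <= cutsize m A + cutsize m B.
Proof.
rewrite /cutsize -!big_split /=; apply: ler_sum => x _.
rewrite -!big_split /=; apply: ler_sum => y _; rewrite !inE.
by case: (x \in A) (x \in B) (y \in A) (y \in B) (m x y) => [] [] [] [] [].
Qed.

Lemma sum_pred1 (V : finType) (a : V) (A : {set V}) (c : int) :
  \sum_(x in A) (x == a)%:R * c = (a \in A)%:R * c.
Proof.
have [aA|aA] := boolP (a \in A).
  rewrite (bigD1 a) //= eqxx big1 ?addr0 // => x /andP[_ /negbTE ->].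
  by rewrite mul0r.
rewrite big1 ?mul0r // => x xA; case: eqP => [xa|]; last by rewrite mul0r.
by rewrite -xa xA in aA.
Qed.

(* Removing one edge [ab] from a feasible instance: by submodularity the lower
   bounds on the flow along [ab] never exceed the upper bounds. *)
Lemma integral_flow (V : finType) (m : rel V) (D : V -> int) :
  symmetric m -> irreflexive m -> \sum_v D v = 0 ->
  (forall A : {set V}, \sum_(v in A) D v <= cutsize m A) ->
  exists f : V -> V -> int,
    [/\ forall x y, f x y = - f y x, forall x y, `|f x y| <= (m x y)%:R
      & forall v, \sum_u f v u = D v].
Proof.
move: {2}(#|[set z | m z.1 z.2]|) (leqnn #|[set z | m z.1 z.2]|) => n.
elim: n m D => [|n IH] m D.
  rewrite leqn0 cards_eq0 => /eqP m0 ms mi D0 Dle.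
  have mF x y : m x y = false.
    by apply/negP => mxy; have := in_set0 (x, y); rewrite -m0 inE mxy.
  have c0 A : cutsize m A = 0.
    by rewrite /cutsize big1 // => x _; rewrite big1 // => y _; rewrite mF !andbF.
  have D0v v : D v <= 0 by have := Dle [set v]; rewrite big_set1 c0.
  have D00 v : D v = 0.
    have := D0; rewrite (bigD1 v) //=.
    have : \sum_(u | u != v) D u <= 0 by apply: sumr_le0.
    by move: (D0v v); move: (\sum_(u | _) _) => s; lia.
  by exists (fun _ _ => 0); split=> // v; rewrite ?oppr0 ?normr0 // D00 big1.
move=> mn ms mi D0 Dle.
have [/existsP[[a b]] /= mab|] := boolP [exists z, m z.1 z.2]; last first.
  rewrite negb_exists => /forallP mF; apply: IH => //.
  by rewrite (_ : [set z | _] = set0) ?cards0 //; apply/setP=> z; rewrite !inE (negbTE (mF z)).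
have ab : a != b by apply: contraTneq mab => ->; rewrite mi.
pose m' := [rel x y | m x y && ~~ ((x == a) && (y == b) || (x == b) && (y == a))].
have m's : symmetric m'.
  by move=> x y /=; rewrite ms orbC [(y == a) && _]andbC [(y == b) && _]andbC.
have m'i : irreflexive m' by move=> x /=; rewrite mi.
have m'n : (#|[set z | m' z.1 z.2]| <= n)%N.
  rewrite -ltnS; apply: leq_trans mn; apply: proper_card; apply/properP; split.
    by apply/subsetP=> z; rewrite !inE => /andP[].
  by exists (a, b); rewrite !inE //= !eqxx /= andbF.
have cutE (A : {set V}) :
    cutsize m A = cutsize m' A + ((a \in A) (+) (b \in A))%:R.
  transitivity (cutsize m' A + \sum_x \sum_y
      ((x == a)%:R * ((y == b)%:R * ((a \in A) && (b \notin A))%:R) +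
       (x == b)%:R * ((y == a)%:R * ((b \in A) && (a \notin A))%:R)) : int).
    rewrite /cutsize -big_split; apply: eq_bigr => x _.
    rewrite -big_split; apply: eq_bigr => y _ /=.
    have xab : (x == a) ==> (x != b) by apply/implyP => /eqP->.
    have yab : (y == a) ==> (y != b) by apply/implyP => /eqP->.
    have mxy : (x == a) && (y == b) || (x == b) && (y == a) ==> m x y.
      by apply/implyP; case/orP=> /andP[/eqP-> /eqP->] //; rewrite ms.
    have xA : (x == a) ==> ((x \in A) == (a \in A)) by apply/implyP=> /eqP->.
    have xB : (x == b) ==> ((x \in A) == (b \in A)) by apply/implyP=> /eqP->.
    have yA : (y == a) ==> ((y \in A) == (a \in A)) by apply/implyP=> /eqP->.
    have yB : (y == b) ==> ((y \in A) == (b \in A)) by apply/implyP=> /eqP->.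
    move: (x == a) (x == b) (y == a) (y == b) (m x y) (x \in A) (y \in A)
      (a \in A) (b \in A) xab yab mxy xA xB yA yB.
    by do 9!case.
  congr (_ + _).
  have s1 (c : V) (t : int) : \sum_x (x == c)%:R * t = t.
    rewrite (bigD1 c) //= eqxx mul1r big1 ?addr0 // => x /negbTE ->.
    by rewrite mul0r.
  under eq_bigr => x _ do rewrite big_split -!mulr_sumr !s1.
  by rewrite big_split /= !s1; case: (a \in A) (b \in A) => [] [].
have sumD (A B : {set V}) : \sum_(v in A :&: B) D v + \sum_(v in A :|: B) D v =
    \sum_(v in A) D v + \sum_(v in B) D v.
  rewrite [X in X + _ = _]big_mkcond [X in _ + X = _]big_mkcond.
  rewrite [X in _ = X + _]big_mkcond [X in _ = _ + X]big_mkcond -!big_split.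
  apply: eq_bigr => v _ /=.
  by rewrite !inE; case: (v \in A) (v \in B) => [] [] /=; rewrite ?addr0 ?add0r.
(* [A :&: B] contains neither end of the edge and [A :|: B] contains both, so deleting the edge
   leaves their cuts unchanged. *)
have sub2 (A B : {set V}) : a \in A -> b \notin A -> a \notin B -> b \in B ->
    \sum_(v in A) D v + \sum_(v in B) D v <= cutsize m' A + cutsize m' B.
  move=> aA /negbTE bA /negbTE aB bB; rewrite -sumD.
  apply: le_trans (cutsize_submod _ _ _).
  have := Dle (A :&: B); have := Dle (A :|: B).
  rewrite !cutE !inE aA bA aB bB /= !addr0.
  by move=> h1 h2; apply: lerD.
(* [t] is the flow from [a] to [b]: sets containing only [a] bound it from below, sets containing
   only [b] from above, and [sub2] makes these bounds compatible. *)
have [t [t1 tA tB]] : exists t : int, [/\ `|t| <= 1,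
    forall A : {set V}, a \in A -> b \notin A -> \sum_(v in A) D v - t <= cutsize m' A &
    forall B : {set V}, a \notin B -> b \in B -> \sum_(v in B) D v + t <= cutsize m' B].
  (* [lo c] says that some set forces [c <= t]; then [t := c] respects every upper bound. *)
  pose lo c := [exists A : {set V}, [&& a \in A, b \notin A &
     cutsize m' A + c <= \sum_(v in A) D v]].
  have loP c : lo c -> forall B : {set V}, a \notin B -> b \in B ->
      \sum_(v in B) D v + c <= cutsize m' B.
    case/existsP=> A /and3P[aA bA cA] B aB bB.
    by have := sub2 A B aA bA aB bB; move: cA; lia.
  have loN c : ~~ lo c -> forall A : {set V}, a \in A -> b \notin A ->
      \sum_(v in A) D v < cutsize m' A + c.
    rewrite negb_exists => /forallP h A aA bA; have := h A.
    by rewrite aA bA /= -ltNge.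
  have [l1|/loN n1] := boolP (lo 1).
    exists 1; split=> [//|A aA bA|]; last exact: loP.
    by have := Dle A; rewrite cutE aA (negbTE bA) /=; lia.
  have [l0|/loN n0] := boolP (lo 0).
    exists 0; split=> [//|A aA bA|]; last exact: loP.
    by have := n1 A aA bA; lia.
  exists (-1); split=> [//|A aA bA|B aB bB].
    by have := n0 A aA bA; lia.
  by have := Dle B; rewrite cutE bB (negbTE aB) /=; lia.
pose D' v := D v - (v == a)%:R * t + (v == b)%:R * t.
have D'E (A : {set V}) : \sum_(v in A) D' v =
    \sum_(v in A) D v - (a \in A)%:R * t + (b \in A)%:R * t.
  by rewrite big_split sumrB /= !sum_pred1.
have D'T : \sum_v D' v = 0.
  have sT (F : V -> int) : \sum_(v in [set: V]) F v = \sum_v F v.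
    by apply: eq_bigl => v; rewrite inE.
  by rewrite -sT D'E sT D0 !inE; lia.
have [A|f [fa fm fD]] := IH m' D' m'n m's m'i D'T.
  have := Dle A; have := tA A; have := tB A; rewrite D'E cutE.
  case: (a \in A); case: (b \in A) => /= h1 h2 h3.
  - by lia.
  - by have := h2 isT isT; lia.
  - by have := h1 isT isT; lia.
  - by lia.
exists (fun x y => f x y + (x == a)%:R * ((y == b)%:R * t)
                 - (x == b)%:R * ((y == a)%:R * t)); split.
- move=> x y; rewrite (fa x y).
  by case: (x == a) (x == b) (y == a) (y == b) => [] [] [] []; lia.
- move=> x y; have := fm x y; rewrite /=.
  have [->|xa] := eqVneq x a; have [->|yb] := eqVneq y b => /=.
  + by rewrite (negbTE ab) mab /=; lia.
  + by rewrite (negbTE ab) /= andbT; lia.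
  + have [->|xb] := eqVneq x b; first by rewrite mi [b == a]eq_sym (negbTE ab) /=; lia.
    by rewrite /= andbT; lia.
  have [->|xb] := eqVneq x b; have [->|ya] := eqVneq y a => /=.
  + by rewrite ms mab /=; lia.
  + by rewrite andbT; lia.
  + by rewrite andbT; lia.
  + by rewrite andbT; lia.
move=> v; rewrite sumrB big_split /= fD -!mulr_sumr.
have s1 (c : V) : \sum_x (x == c)%:R * t = t.
  by rewrite (bigD1 c) //= eqxx mul1r big1 ?addr0 // => x /negbTE ->; rewrite mul0r.
by rewrite !s1 /D'; lia.
Qed.

Lemma antisym_sum (V : finType) (h : V -> V -> int) (A : {set V}) :
  (forall u v, h u v = - h v u) -> \sum_(u in A) \sum_(v in A) h u v = 0.
Proof.
move=> ha; have : \sum_(u in A) \sum_(v in A) h u v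
    = - \sum_(u in A) \sum_(v in A) h u v.
  rewrite {1}exchange_big /= -sumrN; apply: eq_bigr => u _.
  by rewrite -sumrN; apply: eq_bigr => v _; rewrite ha.
by move: (\sum_(_ in _) _) => s; lia.
Qed.

(** Inside [A] the values cancel in pairs, so only edges leaving [A] contribute. *)
Lemma antisym_net_le_cut (V : finType) (m : rel V) (h : V -> V -> int) (A : {set V}) :
  (forall u v, h u v = - h v u) -> (forall u v, `|h u v| <= (m u v)%:R) ->
  \sum_(u in A) \sum_v h u v <= cutsize m A.
Proof.
move=> ha hm; rewrite -[leLHS]subr0 -[X in _ - X](antisym_sum A ha) /cutsize -sumrB.
rewrite [X in X <= _]big_mkcond /=; apply: ler_sum => u _.
case: (u \in A); last by apply: sumr_ge0.
rewrite [X in _ - X]big_mkcond -sumrB; apply: ler_sum => v _.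
by have := hm u v; case: (v \in A) (m u v) => [] []; lia.
Qed.

Lemma cutsize_sym (V : finType) (m : rel V) (A : {set V}) : symmetric m ->
  cutsize m A + cutsize m A =
  \sum_x \sum_y ((m x y && ((x \in A) != (y \in A)))%:R : int).
Proof.
move=> ms; rewrite {2}/cutsize exchange_big /cutsize -big_split.
apply: eq_bigr => x _; rewrite -big_split; apply: eq_bigr => y _ /=.
by rewrite [m y x]ms; case: (x \in A) (y \in A) (m x y) => [] [] [].
Qed.

(** Moving the vertices of [A] across a cut exchanges, among the edges leaving [A], the cut ones
    with the uncut ones; at a maximum this cannot be a gain. Cuts are doubled by [cutsize_sym] so
    that the comparison can be made pair by pair. *)
Lemma max_cut (V : finType) (e : rel V) : symmetric e -> exists P : {set V},
  forall A : {set V},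
    cutsize [rel x y | e x y && ((x \in P) == (y \in P))] A <=
    cutsize [rel x y | e x y && ((x \in P) != (y \in P))] A.
Proof.
move=> es; pose P := [arg max_(Q > (set0 : {set V})) cutsize e Q]%O.
have Pmax Q : cutsize e Q <= cutsize e P.
  by rewrite /P; case: arg_maxP => // P0 _; apply.
exists P => A.
pose Q := [set x | (x \in P) (+) (x \in A)].
set I := cutsize _ A; set M := cutsize _ A.
suff : (cutsize e Q + cutsize e Q) + (M + M) = (cutsize e P + cutsize e P) + (I + I).
  by have := Pmax Q; lia.
rewrite !cutsize_sym //; last by move=> x y /=; rewrite es eq_sym.
  rewrite -!big_split; apply: eq_bigr => x _; rewrite -!big_split.
  apply: eq_bigr => y _ /=; rewrite !inE.
  by case: (x \in A) (y \in A) (x \in P) (y \in P) (e x y) => [] [] [] [] [].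
by move=> x y /=; rewrite es eq_sym.
Qed.

(** In order of increasing rank, [v] has one more value at its disposal than it has predecessors to
    avoid. *)
Lemma greedy_choice (V : finType) (rk : V -> nat) (B : V -> {set V}) (g : V -> nat -> int) :
  (forall v u, u \in B v -> rk u < rk v)%N -> (forall v, injective (g v)) ->
  exists i : V -> nat, (forall v, i v <= #|B v|)%N /\
    forall v u, u \in B v -> g u (i u) != g v (i v).
Proof.
move=> Brk ginj.
have pigeon (i : V -> nat) v : exists2 j, (j <= #|B v|)%N &
    forall u, u \in B v -> g u (i u) != g v j.
  pose t := [seq g u (i u) | u <- enum (B v)].
  have [/hasP[j]|/hasPn nt] := boolP (has (fun j => g v j \notin t) (iota 0 #|B v|.+1)).
    rewrite mem_iota /= add0n ltnS => jB jt; exists j => // u uB.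
    apply: contraNneq jt => <-; apply/mapP; exists u => //.
    by rewrite mem_enum.
  have := @uniq_leq_size _ (map (g v) (iota 0 #|B v|.+1)) t.
  rewrite map_inj_uniq ?iota_uniq // !size_map size_iota -cardE ltnn.
  by move=> /(_ isT) h; suff: false by []; apply: h => z /mapP[j jB ->]; have := nt j jB; rewrite negbK.
suff [i [iB gi]] : exists i : V -> nat, (forall v, i v <= #|B v|)%N /\
    forall v u, (rk v < (\max_v rk v).+1)%N -> u \in B v -> g u (i u) != g v (i v).
  by exists i; split=> // v u; apply: gi; rewrite ltnS leq_bigmax.
elim: _.+1 => [|n [i [iB gi]]]; first by exists (fun=> 0%N).
have [j jP] : exists j : V -> nat, forall v, (j v <= #|B v|)%N /\
    (forall u, u \in B v -> g u (i u) != g v (j v)).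
  apply: (@fin_all_exists _ (fun=> nat) (fun v j => (j <= #|B v|)%N /\
      forall u, u \in B v -> g u (i u) != g v j)) => v.
  by have [j jB jP] := pigeon i v; exists j.
exists (fun v => if rk v == n then j v else i v); split=> [v|v u].
  by case: ifP => // _; case: (jP v).
rewrite ltnS => vn uB; have := Brk _ _ uB => uv.
rewrite (_ : (rk u == n) = false); last by lia.
case: (rk v =P n) => [vE|vE] /=; first exact: (jP v).2.
by apply: gi => //; lia.
Qed.

Lemma sum_setb (V : finType) (A : {set V}) : \sum_u ((u \in A)%:R : int) = #|A|%:R.
Proof.
rewrite -sum1_card natr_sum [RHS]big_mkcond; apply: eq_bigr => u _.
by case: (u \in A).
Qed.

(* [P] is one side of a maximum cut. Earlier neighbours on the same side are
   avoided greedily, the edges to them shifting the sum in steps of 4; across the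
   cut, the residues mod 4 of the sums differ, and the edges of the cut carry the
   flow that undoes the effect of these shifts on the earlier neighbours. *)
Lemma network (V : finType) (e : rel V) : symmetric e -> irreflexive e ->
  exists al : V -> int, (forall v, al v = 1 \/ al v = -1) /\
  forall b : V -> int, (forall v u, e v u -> (4 %| b v - al v)%Z) ->
  exists y : V -> V -> int,
    [/\ forall u v, y u v = y v u, forall u v, `|y u v| <= (e u v)%:R,
        forall v, (2 %| \sum_u y v u)%Z
      & forall u v, e u v -> b u + \sum_w y u w != b v + \sum_w y v w].
Proof.
move=> es ei; have [P Pmax] := max_cut es.
pose rk (v : V) : nat := enum_rank v.
pose inn := [rel x y | e x y && ((x \in P) == (y \in P))].
pose cut := [rel x y | e x y && ((x \in P) != (y \in P))].
have inns : symmetric inn by move=> x y /=; rewrite es eq_sym.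
have cuts : symmetric cut by move=> x y /=; rewrite es eq_sym.
pose bk v := [set u | inn v u & (rk u < rk v)%N].
pose k v := #|bk v|.
(* The final sum at [v] is [b v + 4 i v - 2 k v]. With this sign it is 1 modulo 4 on [P] and -1 off
   [P]; the parity of [k v] compensates the term [2 k v]. *)
exists (fun v => if odd (k v) (+) (v \in P) then 1 else -1).
split=> [v|b bal]; first by case: ifP; [left|right].
pose val v (j : nat) : int := b v + 2 * (2 * j%:R - (k v)%:R).
have [||i [ik ineq]] := @greedy_choice _ rk bk val.
- by move=> v u; rewrite inE => /andP[].
- by move=> v j j'; rewrite /val; lia.
have [C [Ck Csub]] : exists C : V -> {set V}, (forall v, #|C v| = i v) /\
    forall v, C v \subset bk v.
  exists (fun v => [set u in take (i v) (enum (bk v))]); split=> v.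
    rewrite cardsE (card_uniqP _) ?take_uniq ?enum_uniq // size_takel // -cardE.
    exact: ik.
  by apply/subsetP => u; rewrite inE => /mem_take; rewrite mem_enum.
(* The value that [v] gives to the edge towards an earlier neighbour [u] on its side: 1 for [u] in
   [C v], -1 for the others. *)
pose o v u : int := (u \in C v)%:R + (u \in C v)%:R - (u \in bk v)%:R.
have oS v : \sum_u o v u = 2 * (i v)%:R - (k v)%:R.
  by rewrite sumrB big_split /= !sum_setb Ck /k; lia.
have CsubE v u : u \in C v -> u \in bk v by move=> uC; apply: (subsetP (Csub v)).
have oin v u : `|o v u + o u v| <= (inn v u)%:R /\ `|o v u - o u v| <= (inn v u)%:R.
  have := CsubE v u; have := CsubE u v; rewrite /o !inE [e u v]es eq_sym /=.
  case: (e v u) => /=; last by case: (u \in C v) (v \in C u) => [] [] //= h h'; try (by case: (h isT)); by case: (h' isT).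
  case: (_ == _) => /=; last by case: (u \in C v) (v \in C u) => [] [] //= h h'; try (by case: (h isT)); by case: (h' isT).
  have : (rk u < rk v)%N ==> ~~ (rk v < rk u)%N by apply/implyP; rewrite -leqNgt; apply: ltnW.
  case: (u \in C v) (v \in C u) (rk u < rk v)%N (rk v < rk u)%N => [] [] [] [] //= _ h h';
   by [|case: (h isT)|case: (h' isT)].
pose sg v : int := if v \in P then 1 else -1.
(* The flow has to add to [v] what [v] gives and remove what later vertices give to it, leaving
   twice the former. The factor [sg], which changes sign across the cut, converts between
   antisymmetric flows and symmetric edge values. *)
pose h v u : int := sg v * (o v u - o u v).
have ha u v : h u v = - h v u.
  have [_] := oin v u; rewrite /h /sg /=; move: (o v u) (o u v) => s t.
  by case: (e v u); case: (u \in P); case: (v \in P) => /=; lia.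
have hm u v : `|h u v| <= (inn u v)%:R.
  by have [_] := oin u v; rewrite /h /sg; case: (u \in P); lia.
have [||||f [fa fm fD]] := @integral_flow _ cut (fun v => \sum_u h v u).
- exact: cuts.
- by move=> x; rewrite /= ei.
- have := antisym_sum [set: V] ha; under eq_bigl => u do rewrite inE.
  by under eq_bigr => u _ do under eq_bigl => v do rewrite inE.
(* Feasibility: [h] lives on the uncut edges, and at most as many of these leave [A] as cut edges
   do. *)
- by move=> A; apply: le_trans (antisym_net_le_cut A ha hm) (Pmax A).
have f0 u v : ~~ cut u v -> f u v = 0.
  move=> /negbTE cF; have : `|f u v| <= (cut u v)%:R := fm u v.
  by rewrite cF; lia.
pose y v u : int := (o v u + o u v) + sg v * f v u.
have yS v : \sum_u y v u = 2 * (2 * (i v)%:R - (k v)%:R).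
  have hS : \sum_u h v u = sg v * (\sum_u o v u - \sum_u o u v).
    by rewrite -mulr_sumr -sumrB.
  have yS' : \sum_u y v u = (\sum_u o v u + \sum_u o u v) + sg v * \sum_u f v u.
    by rewrite mulr_sumr -!big_split.
  rewrite yS' fD hS -oS /sg; move: (\sum_u o v u) (\sum_u o u v) => s t.
  by case: ifP => _; lia.
exists y; split=> [u v|u v|v|u v euv].
- rewrite /y [o u v + _]addrC; congr (_ + _).
  have [|cF] := boolP (cut u v).
    by rewrite /= fa /sg; case: (u \in P) (v \in P) => [] []; rewrite ?andbF //=; lia.
  by rewrite (f0 _ _ cF) f0 ?mulr0 //; move: cF; rewrite /= es eq_sym.
- have := oin u v; have := fm u v; rewrite /y /sg /=.
  move: (o u v) (o v u) (f u v) => s t r.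
  by case: (e u v); case: (u \in P); case: (v \in P) => /= ? []; lia.
- by rewrite yS; apply/dvdzP; eexists; rewrite mulrC.
- rewrite !yS -!/(val _ _).
  have [uvP|uvP] := boolP ((u \in P) == (v \in P)).
    have [uv|vu|uv] := ltngtP (rk u) (rk v).
    + by apply: ineq; rewrite inE /= [e v u]es euv eq_sym uvP.
    + by rewrite eq_sym; apply: ineq; rewrite inE /= euv uvP.
    + by move: euv; rewrite (enum_rank_inj (val_inj uv)) ei.
  have := bal u v euv; have := bal v u; rewrite es => /(_ euv).
  rewrite /val; move: uvP; case: (u \in P); case: (v \in P) => //= _;
   rewrite ?addbT ?addbF; case: ifP; case: ifP; lia.
Qed.

(** * Weightings encoded by partial edge functions *)

Definition nbr_sum (V : finType) (adj : rel V) (w : V -> V -> nat) (v : V) : nat :=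
  (\sum_(u | adj v u) w v u)%N.

Definition degree (V : finType) (adj : rel V) (v : V) : nat := #|[set u | adj v u]|.

Definition proper_weighting (V : finType) (adj : rel V) (w : V -> V -> nat) : Prop :=
  [/\ forall u v, w u v = w v u, forall u v, (0 < w u v <= 3)%N
    & forall u v, adj u v -> nbr_sum adj w u != nbr_sum adj w v].

Definition edge_fun (V : finType) (adj : rel V) (x : V -> V -> int) : Prop :=
  (forall u v, x u v = x v u) /\ (forall u v, `|x u v| <= (adj u v)%:R).

(* [x] encodes the weights [2 + x] of the edges meeting [Ev]; it can be completed
   on the remaining edges by the network lemma, whatever the signs [al]. *)
Definition completion (V : finType) (adj : rel V) (Ev : {set V}) (al : V -> int)
    (x : V -> V -> int) : Prop :=
  [/\ edge_fun adj x,
      forall u v, u \notin Ev -> v \notin Ev -> x u v = 0,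
      forall u v, u \notin Ev -> v \notin Ev -> adj u v ->
        (4 %| \sum_w x u w - al u)%Z,
      forall u v, u \in Ev -> v \notin Ev -> adj u v ->
        ~~ (2 %| \sum_w x u w - \sum_w x v w)%Z \/
        (forall w, adj u w -> w = v) /\ (exists2 w, adj v w & w != u)
    & forall u v, u \in Ev -> v \in Ev -> adj u v ->
        2 * (degree adj u)%:R + \sum_w x u w != 2 * (degree adj v)%:R + \sum_w x v w].

(** The signs come before [x], because [network] fixes them from the odd vertices alone and only
    then accepts the partial sums. *)
Definition solvable (V : finType) (adj : rel V) (Ev : {set V}) : Prop :=
  forall al : V -> int, (forall v, al v = 1 \/ al v = -1) ->
  exists x, completion adj Ev al x.

Lemma solvable_weighting (V : finType) (adj : rel V) (Ev : {set V}) :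
  symmetric adj -> irreflexive adj -> solvable adj Ev ->
  exists w, proper_weighting adj w.
Proof.
move=> adjs adji sol.
pose e := [rel u v | [&& adj u v, u \notin Ev & v \notin Ev]].
have es : symmetric e by move=> u v /=; rewrite adjs; congr (_ && _); rewrite andbC.
have ei : irreflexive e by move=> u /=; rewrite adji.
have [al [al1 net]] := network es ei.
(* At an odd degree the base value [2 * degree] is 2 modulo 4, which turns one sign into the
   other. *)
have [|x [[xs x1] x0 xal xEO xEE]] := sol (fun v => if odd (degree adj v) then - al v else al v).
  by move=> v /=; case: (al1 v) => ->; case: ifP => _; rewrite ?opprK; tauto.
have [|y [ys y1 y2 yne]] := net (fun v => 2 * (degree adj v)%:R + \sum_u x v u).
  move=> v u /and3P[vu vE uE]; have := xal v u vE uE vu.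
  move: (degree adj v) (\sum_w _) => d s; case: (al1 v) => ->.
    by case: (boolP (odd d)) => dP h; lia.
  by case: (boolP (odd d)) => dP h; lia.
have y0 u v : ~~ e u v -> y u v = 0.
  by move=> eF; have := y1 u v; rewrite (_ : (e : rel V) u v = false); [lia|apply/negbTE].
(* [x] and [y] have disjoint supports, so the argument of [absz] lies between 1 and 3. *)
pose w u v : nat := absz (2 + (x u v + y u v)).
have xy1 u v : `|x u v + y u v| <= (adj u v)%:R.
  have := x1 u v; have := x0 u v; have := y1 u v; rewrite /=.
  move: (x u v) (y u v) => s t; case: (adj u v); case: (u \in Ev); case: (v \in Ev) => /=;
    try (by move=> + _; lia); by move=> + /(_ isT isT); lia.
have wE u v : (w u v)%:R = 2 + (x u v + y u v).
  by have := xy1 u v; rewrite /w; move: (x u v + y u v) => s; case: (adj u v); lia.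
have w13 u v : (0 < w u v <= 3)%N.
  by have := xy1 u v; have := wE u v; case: (adj u v); lia.
have wS v : (nbr_sum adj w v)%:R = 2 * (degree adj v)%:R + \sum_u x v u + \sum_u y v u.
  have supp (z : V -> V -> int) : (forall u v, `|z u v| <= (adj u v)%:R) ->
      \sum_u z v u = \sum_(u | adj v u) z v u.
    move=> z1; rewrite [RHS]big_mkcond; apply: eq_bigr => u _.
    by have := z1 v u; case: (adj v u); lia.
  rewrite -addrA -big_split /= (supp (fun v u => x v u + y v u)) // /nbr_sum natr_sum.
  under eq_bigr => u _ do rewrite wE.
  by rewrite big_split /= sumr_const /degree cardsE mulr_natr.
have yS0 v : v \in Ev -> \sum_u y v u = 0.
  by move=> vE; apply: big1 => u _; rewrite y0 //= vE andbF.
have ws u v : w u v = w v u by rewrite /w xs ys.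
exists w; split=> // u v uv.
have main u' v' : u' \in Ev -> v' \notin Ev -> adj u' v' ->
    nbr_sum adj w u' != nbr_sum adj w v'.
  move=> uE vE uv'; have := wS u'; have := wS v'; rewrite (yS0 u') //.
  have [par|[lf [z vz zu]]] := xEO u' v' uE vE uv'.
    have := y2 v'; move: par.
    move: (\sum_w x u' w) (\sum_w x v' w) (\sum_w y v' w) => s t r.
    by lia.
  (* The leaf [u'] has as its sum the weight of its only edge; [v'] has this weight and another
     positive one. *)
  move=> _ _; rewrite neq_ltn /nbr_sum (bigD1 v') //= [X in (_ + X < _)%N]big1; last first.
    by move=> i /andP[/lf -> /eqP].
  rewrite (bigD1 u') 1?adjs //= (bigD1 z) /=; last by rewrite vz zu.
  by have := w13 v' z; rewrite (ws v' u') addn0 => ?; apply/orP; left; lia.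
have [uE|uE] := boolP (u \in Ev); have [vE|vE] := boolP (v \in Ev).
- by rewrite -(eqr_nat int) !wS !yS0 // !addr0; apply: xEE.
- exact: main.
- by rewrite eq_sym; apply: main; rewrite // adjs.
by rewrite -(eqr_nat int) !wS; apply: yne; rewrite /= uv uE vE.
Qed.

(** * Parity corrections in connected bipartite graphs *)

(** Edges of a walk are added modulo 2, so repetitions cancel and only the ends keep an odd
    degree. *)
Lemma path_join (V : finType) (F : rel V) (a b : V) :
  symmetric F -> connect F a b -> exists U : rel V,
    [/\ symmetric U, subrel U F
      & forall v, \big[addb/false]_u U v u = (v == a) (+) (v == b)].
Proof.
move=> Fs /connectP[p]; elim: p a => [|c p IH] a /=.
  move=> _ ->; exists (fun _ _ => false); split=> // v.
  by rewrite big1 // addbb.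
case/andP=> Fac pP bE; have [U [Us UF Up]] := IH c pP bE.
pose ac := [rel u v | (u == a) && (v == c) (+) (u == c) && (v == a)].
exists [rel u v | U u v (+) ac u v]; split.
- move=> u v /=; rewrite Us; congr (_ (+) _); rewrite addbC.
  by rewrite [(v == c) && _]andbC [(v == a) && _]andbC.
- move=> u v /=; case: (boolP (U u v)) => [/UF //|_ /=].
  case: (boolP (_ && _)) => [/andP[/eqP-> /eqP->] //|_ /= /andP[/eqP-> /eqP->]].
  by rewrite Fs.
move=> v; rewrite big_split /= Up big_split /=.
have s1 (d : bool) (w : V) : \big[addb/false]_u (d && (u == w)) = d.
  rewrite (bigD1 w) //= eqxx andbT big1 ?addbF // => i /negbTE ->.
  exact: andbF.
by rewrite !s1; case: (v == a); case: (v == b); case: (v == c).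
Qed.

Lemma big_addb_odd (V : finType) (P : pred V) :
  \big[addb/false]_u P u = odd #|[set u | P u]|.
Proof.
have -> : #|[set u | P u]| = (\sum_u P u)%N.
  by rewrite -sum1_card big_mkcond; apply: eq_bigr => u _; rewrite inE; case: (P u).
by elim/big_rec2: _ => // u b n _ ->; rewrite oddD oddb.
Qed.

(** A T-join: the sum modulo 2 of paths from one vertex [r] of [p] to all vertices of [p]. As [p]
    has even size, the contributions at the common start [r] cancel. *)
Lemma parity_join (V : finType) (F : rel V) (C : {set V}) (p : pred V) :
  symmetric F -> {in C &, forall u v, connect F u v} ->
  (forall v, p v -> v \in C) -> ~~ odd #|[set v | p v]| ->
  exists U : rel V, [/\ symmetric U, subrel U F
    & forall v, odd #|[set u | U v u]| = p v].
Proof.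
move=> Fs conn pC pe; have [r /= pr|p0] := pickP p; last first.
  exists (fun _ _ => false); split=> // v; rewrite p0 eq_card0 // => u.
  by rewrite !inE.
have [W WP] : exists W : V -> V -> V -> bool, forall w, p w ->
    [/\ symmetric (W w), subrel (W w) F
      & forall v, \big[addb/false]_u W w v u = (v == r) (+) (v == w)].
  apply: (@fin_all_exists _ (fun=> V -> V -> bool) (fun w W => p w ->
    [/\ symmetric W, subrel W F
      & forall v, \big[addb/false]_u W v u = (v == r) (+) (v == w)])) => w.
  have [pw|] := boolP (p w); last by exists (fun _ _ => false).
  by have [U UP] := path_join Fs (conn r w (pC r pr) (pC w pw)); exists U.
exists (fun u v => \big[addb/false]_(w | p w) W w u v); split.
- by move=> u v; apply: eq_bigr => w pw; case: (WP w pw).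
- move=> u v; apply: contraTT => Fuv; rewrite big1 // => w pw.
  by case: (WP w pw) => _ WF _; apply: contraNF Fuv; apply: WF.
move=> v; rewrite -big_addb_odd exchange_big /=.
rewrite (eq_bigr (fun w => (v == r) (+) (v == w))); last first.
  by move=> w pw; case: (WP w pw) => _ _ ->.
rewrite big_split /=.
have -> : \big[addb/false]_(w | p w) (v == w) = p v.
  rewrite big_mkcond (bigD1 v) //= eqxx big1 ?addbF; first by case: (p v).
  by move=> w /negbTE wv; rewrite eq_sym wv; case: (p w).
have -> : \big[addb/false]_(w | p w) (v == r) = false; last by [].
case: (v == r); last by rewrite big1.
rewrite big_mkcond -[RHS](negbTE pe) -big_addb_odd; apply: eq_bigr => w _.
by case: (p w).
Qed.

Lemma sum_parity (V : finType) (s : V -> int) (N : {set V}) :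
  (forall u, `|s u| = (u \in N)%:R) -> (2 %| \sum_u s u - #|N|%:R)%Z.
Proof.
move=> sN; rewrite -sum_setb -sumrB; apply: rpred_sum => u _.
rewrite -[_ \in _]/((2 %| s u - (u \in N)%:R)%Z).
by have := sN u; case: (u \in N); move: (s u) => t; lia.
Qed.

(** Flipping one sign changes the sum by 2, so a nonempty [N] reaches both classes modulo 4 of its
    parity. *)
Lemma signs_mod4 (V : finType) (N : {set V}) (rho : int) :
  odd #|N| = ~~ (2 %| rho)%Z -> (N = set0 -> (4 %| rho)%Z) ->
  exists s : V -> int, (forall u, `|s u| = (u \in N)%:R) /\ (4 %| \sum_u s u - rho)%Z.
Proof.
move=> par N0; have [h4|h4] := boolP (4 %| (#|N|%:R : int) - rho)%Z.
  exists (fun u => (u \in N)%:R); split; first by move=> u; case: (u \in N).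
  by rewrite sum_setb.
have [NE|[a aN]] := set_0Vmem N.
  by have := N0 NE; move: h4; rewrite NE cards0; lia.
exists (fun u => (u \in N)%:R - (u == a)%:R * 2); split.
  by move=> u; case: eqP => [->|_]; rewrite ?aN; case: (u \in N).
have -> : \sum_u ((u \in N)%:R - (u == a)%:R * 2) = #|N|%:R - 2 :> int.
  rewrite sumrB sum_setb; congr (_ - _).
  rewrite (bigD1 a) //= eqxx big1 ?addr0 // => i /negbTE ->; by rewrite mul0r.
by move: par h4; move: #|N| => n; lia.
Qed.

Definition nbh (V : finType) (adj : rel V) (E : {set V}) : {set V} :=
  [set v | (v \in E) || [exists e in E, adj e v]].

Definition hrel (V : finType) (adj : rel V) (E : {set V}) : rel V :=
  [rel u v | adj u v && ((u \in E) != (v \in E))].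

(** Every edge of [F] has exactly one end outside [Ev]. The signs on a T-join can thus be chosen
    separately at each odd vertex to reach its residue modulo 4; even vertices see only the parity
    of their degree in the join. *)
Lemma core_solution (V : finType) (F : rel V) (Ev C : {set V}) (p : pred V)
    (rho : V -> int) :
  symmetric F -> (forall u v, F u v -> (u \in Ev) != (v \in Ev)) ->
  {in C &, forall u v, connect F u v} ->
  (forall v, p v -> v \in C) -> ~~ odd #|[set v | p v]| ->
  (forall v, v \notin Ev -> p v = ~~ (2 %| rho v)%Z /\ (~~ p v -> (4 %| rho v)%Z)) ->
  exists z : V -> V -> int,
    [/\ edge_fun F z, forall v, v \notin Ev -> (4 %| \sum_u z v u - rho v)%Z
      & forall v, (2 %| \sum_u z v u - (p v)%:R)%Z].
Proof.
move=> Fs FE conn pC pe rhoP.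
have [U [Us UF Up]] := parity_join Fs conn pC pe.
pose N v := [set u | U v u].
have [s sP] : exists s : V -> V -> int, forall v,
    (forall u, `|s v u| = (U v u)%:R) /\ (v \notin Ev -> (4 %| \sum_u s v u - rho v)%Z).
  apply: (@fin_all_exists _ (fun=> V -> int) (fun v s =>
    (forall u, `|s u| = (U v u)%:R) /\ (v \notin Ev -> (4 %| \sum_u s u - rho v)%Z))) => v.
  have NU u : (u \in N v) = U v u by rewrite inE.
  have [vE|vE] := boolP (v \in Ev).
    by exists (fun u => (U v u)%:R); split=> // u; case: (U v u).
  have [r1 r2] := rhoP v vE.
  have [||s [s1 s4]] := @signs_mod4 _ (N v) (rho v); first by rewrite Up.
    by move=> N0; apply: r2; rewrite -Up -/(N v) N0 cards0.
  by exists s; split=> // u; rewrite -NU.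
pose z u v := if u \notin Ev then s u v else s v u.
have zs u v : z u v = z v u.
  rewrite /z; have [uvE|uvE] := boolP ((u \in Ev) != (v \in Ev)).
    by move: uvE; case: (u \in Ev); case: (v \in Ev).
  have F0 : U u v = false by apply: contraNF uvE => /UF/FE.
  have := (sP u).1 v; have := (sP v).1 u; rewrite [U v u]Us F0.
  by case: ifP; case: ifP => _ _; lia.
have z1 u v : `|z u v| = (U u v)%:R.
  by rewrite /z; case: ifP => _; rewrite (sP _).1 // Us.
exists z; split=> [|v vE|v].
- by split=> // u v; rewrite z1; have := UF u v; case: (U u v) => // ->.
- have := (sP v).2 vE; rewrite /z vE.
  by [].
have := @sum_parity _ (z v) (N v); rewrite -(Up v) -/(N v).
move=> h; have := h _; move: (\sum_u _) => t.
have {}h : forall u, `|z v u| = (u \in N v)%:R by move=> u; rewrite inE z1.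
by move=> /(_ h); move: #|N v| => n; lia.
Qed.

(** * Independent sets with connected closed neighbourhood *)

Lemma hrel_sym (V : finType) (adj : rel V) (E : {set V}) :
  symmetric adj -> symmetric (hrel adj E).
Proof. by move=> adjs u v; rewrite /hrel /= adjs eq_sym. Qed.

Lemma hrelE (V : finType) (adj : rel V) (E : {set V}) u v :
  hrel adj E u v = adj u v && ((u \in E) != (v \in E)).
Proof. by []. Qed.

(* The independent sets [E] whose closed neighbourhood is connected by the edges with
   exactly one end in [E]; parities can then be corrected along these edges. *)
Definition conn_indep (V : finType) (adj : rel V) (E : {set V}) : bool :=
  [forall u in E, forall v in E, ~~ adj u v] &&
  [forall u in nbh adj E, forall v in nbh adj E, connect (hrel adj E) u v].

Lemma conn_indepP (V : finType) (adj : rel V) (E : {set V}) :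
  reflect ({in E &, forall u v, ~~ adj u v} /\
           {in nbh adj E &, forall u v, connect (hrel adj E) u v}) (conn_indep adj E).
Proof.
apply: (iffP andP) => [] [/= h1 h2]; split.
- by move=> u v uE vE; move/forall_inP: h1 => /(_ u uE) /forall_inP /(_ v vE).
- by move=> u v uE vE; move/forall_inP: h2 => /(_ u uE) /forall_inP /(_ v vE).
- by apply/forall_inP => u uE; apply/forall_inP => v vE; apply: h1.
- by apply/forall_inP => u uE; apply/forall_inP => v vE; apply: h2.
Qed.

Lemma nbhU (V : finType) (adj : rel V) (E Z : {set V}) :
  nbh adj (E :|: Z) = nbh adj E :|: nbh adj Z.
Proof.
apply/setP => v; rewrite !inE; apply/orP/orP => [[/orP[vE|vZ]|]|].
- by left; rewrite vE.
- by right; rewrite vZ.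
- case/exists_inP => e; rewrite inE => /orP[eE|eZ] ev.
    by left; apply/orP; right; apply/exists_inP; exists e.
  by right; apply/orP; right; apply/exists_inP; exists e.
- case=> /orP[->|/exists_inP[e eE ev]]; rewrite ?orbT; try by left.
    by right; apply/exists_inP; exists e => //; rewrite inE eE.
  by right; apply/exists_inP; exists e => //; rewrite inE eE orbT.
Qed.

Lemma nbh_mem (V : finType) (adj : rel V) (E : {set V}) u : u \in E -> u \in nbh adj E.
Proof. by move=> uE; rewrite inE uE. Qed.

Lemma nbh_adj (V : finType) (adj : rel V) (E : {set V}) u v :
  u \in E -> adj u v -> v \in nbh adj E.
Proof. by move=> uE uv; rewrite inE; apply/orP; right; apply/exists_inP; exists u. Qed.

Lemma nbh1 (V : finType) (adj : rel V) c u :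
  (u \in nbh adj [set c]) = (u == c) || adj c u.
Proof.
rewrite !inE; congr (_ || _); apply/exists_inP/idP => [[e /set1P->] //|cu].
by exists c => //; rewrite inE.
Qed.

(** No vertex of [Z] is adjacent to [E], so the edges of [hrel adj E] survive, and every new vertex
    is attached to the old part through some [z] and its neighbour [w]. *)
Lemma conn_indep_ext (V : finType) (adj : rel V) (E Z : {set V}) :
  symmetric adj -> conn_indep adj E -> {in Z &, forall u v, ~~ adj u v} ->
  (forall z, z \in Z -> z \notin nbh adj E) ->
  (forall z, z \in Z -> exists2 w, w \in nbh adj E & adj z w) ->
  conn_indep adj (E :|: Z).
Proof.
move=> adjs /conn_indepP[Ei Ec] Zi ZE Zw.
have EZ e z : e \in E -> z \in Z -> ~~ adj e z.
  by move=> eE zZ; apply: contra (ZE z zZ); apply: nbh_adj.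
have mono u v : connect (hrel adj E) u v -> connect (hrel adj (E :|: Z)) u v.
  apply: connect_sub => {u v}u v; rewrite hrelE => /andP[uv uvE]; apply: connect1.
  rewrite hrelE uv !inE; have ZF x y : x \in E -> adj x y -> y \in Z = false.
    by move=> xE xy; apply/negP => yZ; have := EZ x y xE yZ; rewrite xy.
  move: uvE; case: (boolP (u \in E)) => uE; case: (boolP (v \in E)) => vE //= _.
    by rewrite (ZF u).
  by rewrite (ZF v) // adjs.
have Hs := hrel_sym (E :|: Z) adjs.
have cs := sym_connect_sym Hs.
have Hz u z : z \in Z -> adj z u -> connect (hrel adj (E :|: Z)) u z.
  move=> zZ zu; apply: connect1; rewrite hrelE adjs zu !inE zZ orbT.
  rewrite (negbTE (_ : u \notin E)); last first.
    by apply/negP => uE; have := EZ u z uE zZ; rewrite adjs zu.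
  by rewrite (negbTE (_ : u \notin Z)) //; apply/negP => uZ; have := Zi z u zZ uZ; rewrite zu.
have toE u : u \in nbh adj (E :|: Z) ->
    exists2 w, w \in nbh adj E & connect (hrel adj (E :|: Z)) u w.
  rewrite nbhU inE => /orP[uE|]; first by exists u.
  have zE z : z \in Z -> exists2 w, w \in nbh adj E & connect (hrel adj (E :|: Z)) z w.
    by move=> zZ; have [w wE zw] := Zw z zZ; exists w; rewrite // cs; apply: Hz.
  rewrite inE => /orP[|/exists_inP[z zZ zu]]; first exact: zE.
  by have [w wE zw] := zE z zZ; exists w => //; apply: connect_trans zw; apply: Hz.
apply/conn_indepP; split=> [u v|].
  rewrite !inE => /orP[uE|uZ] /orP[vE|vZ]; first exact: Ei.
  - exact: EZ.
  - by rewrite adjs; apply: EZ.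
  exact: Zi.
move=> u v /toE[w wE uw] /toE[w' w'E vw']; apply: (connect_trans uw).
by rewrite cs; apply: (connect_trans vw'); apply: mono; apply: Ec.
Qed.

Lemma nbh0 (V : finType) (adj : rel V) : nbh adj set0 = set0.
Proof.
apply/setP => u; rewrite [RHS]inE; apply/negbTE; rewrite !inE /=.
by apply/exists_inPn => e; rewrite inE.
Qed.

Lemma conn_indep0 (V : finType) (adj : rel V) : conn_indep adj set0.
Proof. by apply/conn_indepP; rewrite nbh0; split=> u v; rewrite inE. Qed.

Lemma conn_indep1 (V : finType) (adj : rel V) c : symmetric adj -> irreflexive adj ->
  conn_indep adj [set c].
Proof.
move=> adjs adji; apply/conn_indepP; split=> [u v /set1P-> /set1P->|u v]; first by rewrite adji.
have cs := sym_connect_sym (hrel_sym [set c] adjs).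
have toc w : w \in nbh adj [set c] -> connect (hrel adj [set c]) w c.
  rewrite nbh1; case: eqVneq => [-> //|wc /= cw]; apply: connect1.
  by rewrite hrelE !inE adjs cw eqxx (negbTE wc).
by move=> /toc uc /toc vc; apply: (connect_trans uc); rewrite cs.
Qed.

(** While a vertex of [Y] is missed, some edge leaves [nbh adj E]; its outer end has no neighbour in
    [E] and can be added. *)
Lemma conn_indep_grow (V : finType) (adj : rel V) (E Y : {set V}) q :
  symmetric adj -> irreflexive adj -> conn_indep adj E -> q \in nbh adj E ->
  (forall u, u \in Y -> connect adj q u) ->
  exists E' : {set V}, [/\ E \subset E', conn_indep adj E' & Y \subset nbh adj E'].
Proof.
move=> adjs adji; move: {2}(#|~: nbh adj E|) (leqnn #|~: nbh adj E|) => n.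
elim: n E => [|n IH] E.
  rewrite leqn0 cards_eq0 => /eqP nE gE _ _; exists E; split=> //.
  by apply/subsetP => u _; have := in_set0 u; rewrite -nE inE => /negbT; rewrite negbK.
move=> nE gE qE qY; have [YE|/subsetPn[y yY yE]] := boolP (Y \subset nbh adj E).
  by exists E.
have [/existsP[w /existsP[c /and3P[wE wc cE]]]|] :=
    boolP [exists w, exists c, [&& w \in nbh adj E, adj w c & c \notin nbh adj E]]; last first.
  move/existsPn => h; have cl : closed adj (mem (nbh adj E)).
    apply: intro_closed; first exact: sym_connect_sym.
    move=> u v uv uE; have /existsPn /(_ v) := h u.
    by rewrite uE uv /= negbK.
  by have := closed_connect cl (qY y yY); rewrite qE (negbTE yE).
have gEc : conn_indep adj (E :|: [set c]).
  apply: conn_indep_ext => // [u v /set1P-> /set1P->|z /set1P-> //|z /set1P->].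
    by rewrite adji.
  by exists w; rewrite // adjs.
have [||E' [EE' gE' YE']] := IH _ _ gEc _ qY.
- rewrite -ltnS; apply: leq_trans nE; apply: proper_card; apply/properP; split.
    by apply/subsetP => u; rewrite nbhU !inE negb_or => /andP[].
  by exists c; rewrite inE // negbK; apply: nbh_mem; rewrite !inE eqxx orbT.
- by rewrite nbhU inE qE.
by exists E'; split=> //; apply: subset_trans EE'; apply: subsetUl.
Qed.

(** * Completing prescribed edge values *)

Lemma edge_fun_off (V : finType) (F : rel V) x u v : edge_fun F x -> ~~ F u v -> x u v = 0.
Proof. by case=> _ x1 Fuv; have := x1 u v; rewrite (negbTE Fuv); lia. Qed.

Lemma edge_fun_even (V : finType) (adj : rel V) (x : V -> V -> int) :
  irreflexive adj -> edge_fun adj x -> (2 %| \sum_u \sum_v x u v)%Z.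
Proof.
move=> adji xe; have [xs _] := xe; have xd u : x u u = 0.
  by apply: edge_fun_off xe _; rewrite adji.
have -> : \sum_u \sum_v x u v = 2 * (\sum_u \sum_(v | (enum_rank u < enum_rank v)%N) x u v).
  rewrite mulr2n mulrDl mul1r.
  have -> : \sum_u \sum_v x u v = \sum_u \sum_(v | (enum_rank u < enum_rank v)%N) x u v +
      \sum_u \sum_(v | (enum_rank v < enum_rank u)%N) x u v.
    rewrite -big_split; apply: eq_bigr => u _ /=.
    rewrite [X in _ = X + _]big_mkcond [X in _ = _ + X]big_mkcond -big_split.
    apply: eq_bigr => v _ /=.
    case: ltngtP => [||/val_inj/enum_rank_inj->]; rewrite ?addr0 ?add0r //.
  congr (_ + _); rewrite (exchange_big_dep xpredT) //=; apply: eq_bigr => u _.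
  by apply: eq_bigr => v _; rewrite xs.
by rewrite dvdz_mulr.
Qed.

Lemma odd_count (V : finType) (f : V -> int) :
  odd #|[set v | ~~ (2 %| f v)%Z]| = ~~ (2 %| \sum_v f v)%Z.
Proof.
rewrite -big_addb_odd; elim/big_rec2: _ => // v b s _ ->.
by move: (f v) => t; lia.
Qed.

(* [x0] is fixed in advance on edges outside [F]; [Tt] is the set of vertices whose
   total sum has to be odd. *)
Lemma core_extension (V : finType) (adj F : rel V) (Ev C Tt : {set V})
    (al : V -> int) (x0 : V -> V -> int) :
  irreflexive adj -> (forall v, al v = 1 \/ al v = -1) ->
  symmetric F -> (forall u v, F u v -> (u \in Ev) != (v \in Ev)) ->
  (forall u v, F u v -> u \in C) ->
  {in C &, forall u v, connect F u v} -> edge_fun adj x0 ->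
  ~~ odd #|Tt| -> (forall v, v \notin Ev -> v \in Tt) ->
  (forall v, v \notin C -> (v \in Tt) = ~~ (2 %| \sum_u x0 v u)%Z) ->
  (forall v, v \in C -> v \notin Ev ->
     (2 %| \sum_u x0 v u)%Z \/ (4 %| \sum_u x0 v u - al v)%Z) ->
  exists z : V -> V -> int,
    [/\ edge_fun F z, forall v, v \notin C -> \sum_u z v u = 0,
        forall v, v \in C -> v \notin Ev -> (4 %| \sum_u x0 v u + \sum_u z v u - al v)%Z
      & forall v, (v \in Tt) = ~~ (2 %| \sum_u x0 v u + \sum_u z v u)%Z].
Proof.
move=> adji al1 Fs FE FC conn x0e Tte ETt CTt CEv.
pose d v := ~~ (2 %| \sum_u x0 v u)%Z.
pose p v := (v \in Tt) (+) d v.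
(* [Tt] has even size, and so has the set of odd sums of [x0], by the handshake lemma; hence so has
   their symmetric difference. *)
have pE : ~~ odd #|[set v | p v]|.
  rewrite -big_addb_odd big_split /= !big_addb_odd odd_count.
  by rewrite cardsE (negbTE Tte) (edge_fun_even adji x0e).
have pC v : p v -> v \in C by rewrite /p; apply: contraTT => /CTt ->; rewrite addbb.
have [v vE|z [ze z4 z2]] := @core_solution _ F Ev C p
    (fun v => if v \in C then al v - \sum_u x0 v u else 0) Fs FE conn pC pE.
  rewrite /p /d (ETt v vE) /=; case: ifP => vC.
    have := CEv v vC vE; move: (\sum_u _) => s; case: (al1 v) => -> ?; split; lia.
  by have := CTt v; rewrite vC (ETt v vE) => /(_ isT) <-.
have zC v : v \notin C -> \sum_u z v u = 0.
  move=> vC; apply: big1 => u _; apply: edge_fun_off ze _.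
  by apply: contra vC; apply: FC.
exists z; split=> // v => [vC vE|].
  by have := z4 v vE; rewrite vC; move: (\sum_u z v u) (\sum_u x0 v u) => s t; lia.
have := z2 v; rewrite /p /d; move: (\sum_u z v u) (\sum_u x0 v u) => s t.
by case: (v \in Tt); lia.
Qed.

Lemma edge_funD (V : finType) (adj F G : rel V) x y :
  edge_fun F x -> edge_fun G y -> subrel F adj -> subrel G adj ->
  (forall u v, F u v -> G u v = false) -> edge_fun adj (fun u v => x u v + y u v).
Proof.
move=> [xs x1] [ys y1] FA GA FG; split=> u v; first by rewrite xs ys.
have := x1 u v; have := y1 u v; have := FA u v; have := GA u v; have := FG u v.
case: (F u v); case: (G u v); case: (adj u v) => //= h1 h2 h3;
  try (by have := h1 isT); try (by have := h2 isT); try (by have := h3 isT); lia.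
Qed.

Lemma edge_fun_sub (V : finType) (F adj : rel V) x :
  subrel F adj -> edge_fun F x -> edge_fun adj x.
Proof.
move=> FA [xs x1]; split=> // u v; apply: le_trans (x1 u v) _.
by have := FA u v; case: (F u v) => // ->.
Qed.

(* [x0] is a prescribed part, to be completed on the edges of [hrel adj' B]. *)
Record partial_solution (V : finType) (adj adj' : rel V) (Ev B : {set V})
    (al : V -> int) (x0 : V -> V -> int) : Prop := PartialSolution {
  ps_edge : edge_fun adj x0;
  ps_core : forall u v, hrel adj' B u v -> x0 u v = 0;
  ps_odd : forall u v, u \notin Ev -> v \notin Ev -> x0 u v = 0;
  ps_par : forall v, v \notin nbh adj' B -> (v \notin Ev) = ~~ (2 %| \sum_u x0 v u)%Z;
  ps_mod4 : forall v, v \notin Ev ->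
     (v \in nbh adj' B /\ (2 %| \sum_u x0 v u)%Z) \/ (4 %| \sum_u x0 v u - al v)%Z
     \/ (v \notin nbh adj' B /\ forall u, adj v u -> u \in Ev) }.

Lemma hrel_out (V : finType) (adj : rel V) (E : {set V}) u v :
  symmetric adj -> hrel adj E u v -> u \in nbh adj E.
Proof.
move=> adjs; rewrite hrelE => /andP[uv].
case: (boolP (u \in E)) => [uE _|uE]; first exact: nbh_mem.
by case: (boolP (v \in E)) => // vE _; apply: nbh_adj vE _; rewrite adjs.
Qed.

(** The correction [z] uses only residues of the sums of [x0]: parities, and classes modulo 4 at odd
    vertices having an odd neighbour. So [x0] and [z] may be replaced afterwards by [x1] and [z1]
    with the same residues. This allows [x1] to be chosen in view of [z], and the only obligation
    left concerns adjacent even vertices. *)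
Lemma complete_partial_gen (V : finType) (adj adj' : rel V) (Ev B : {set V})
    (al : V -> int) (x0 : V -> V -> int) :
  irreflexive adj -> symmetric adj' -> subrel adj' adj ->
  (forall v, al v = 1 \/ al v = -1) ->
  conn_indep adj' B -> (forall v, v \in nbh adj' B -> (v \in Ev) = (v \in B)) ->
  ~~ odd #|~: Ev| -> partial_solution adj adj' Ev B al x0 ->
  exists z : V -> V -> int, edge_fun (hrel adj' B) z /\
    (forall v, (v \notin Ev) = ~~ (2 %| \sum_u x0 v u + \sum_u z v u)%Z) /\
    forall x1 z1, edge_fun adj x1 -> edge_fun (hrel adj' B) z1 ->
      (forall u v, hrel adj' B u v -> x1 u v = 0) ->
      (forall u v, u \notin Ev -> v \notin Ev -> x1 u v = 0) ->
      (forall v, v \notin Ev -> (exists2 u, adj v u & u \notin Ev) ->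
         (4 %| \sum_u x1 v u - \sum_u x0 v u)%Z /\ (4 %| \sum_u z1 v u - \sum_u z v u)%Z) ->
      (forall v, (2 %| \sum_u x1 v u - \sum_u x0 v u)%Z /\
                 (2 %| \sum_u z1 v u - \sum_u z v u)%Z) ->
      (forall u v, u \in Ev -> v \in Ev -> adj u v ->
         2 * (degree adj u)%:R + (\sum_w x1 u w + \sum_w z1 u w) !=
         2 * (degree adj v)%:R + (\sum_w x1 v w + \sum_w z1 v w)) ->
      exists x, completion adj Ev al x.
Proof.
move=> adji adjs' sub al1 gB EvB Ee [x0e x0c x0o x0p x04].
have Fs := hrel_sym B adjs'.
have FE u v : hrel adj' B u v -> (u \in Ev) != (v \in Ev).
  move=> uv; rewrite !EvB ?(hrel_out _ uv) //; first by case/andP: uv.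
  by apply: (@hrel_out _ _ _ v u) => //; rewrite Fs.
have [||||v vC vE|z [ze zC z4 z2]] := @core_extension _ adj (hrel adj' B) Ev (nbh adj' B)
    (~: Ev) al x0 adji al1 Fs FE _ _ x0e Ee.
- by move=> u v; apply: hrel_out.
- by have [_] := conn_indepP _ _ gB.
- by move=> v; rewrite inE.
- by move=> v /x0p <-; rewrite inE.
- have [[]|[h|[]]] := x04 v vE; [by left|by right|by rewrite vC].
exists z; split=> //; split=> [v|x1 z1 x1e z1e x1c x1o x14 x12 x1n].
  by rewrite -z2 inE.
have sumE v : \sum_w (x1 v w + z1 v w) = \sum_w x1 v w + \sum_w z1 v w by rewrite big_split.
have subF : subrel (hrel adj' B) adj by move=> u v /andP[/sub].
have par v : (v \notin Ev) = ~~ (2 %| \sum_w x1 v w + \sum_w z1 v w)%Z.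
  have := z2 v; have [] := x12 v; rewrite inE => h h' ->.
  move: (\sum_u x1 v u) (\sum_u x0 v u) (\sum_u z v u) (\sum_u z1 v u) h h' => r s t q.
  by lia.
exists (fun u v => x1 u v + z1 u v); split.
- have x1e' : edge_fun [rel u v | adj u v && ~~ hrel adj' B u v] x1.
    have [s1 b1] := x1e; split=> // u v /=; have := b1 u v.
    by case: (boolP (hrel adj' B u v)) => [/x1c ->|_]; rewrite ?andbT // andbF.
  apply: edge_funD x1e' z1e _ subF _ => u v /andP[] //.
  by move=> _ /negbTE.
- move=> u v uE vE; rewrite x1o // add0r; apply: edge_fun_off z1e _.
  by apply: contraNN uE => /FE; rewrite (negbTE vE); case: (u \in Ev).
- move=> u v uE vE uv; rewrite sumE.
  have [] := x14 u uE (ex_intro2 _ _ v uv vE).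
  have [[uC _]|[h|[_ /(_ v uv)]]] := x04 u uE; last by rewrite (negbTE vE).
    have := z4 u uC uE.
    move: (\sum_w x1 u w) (\sum_w x0 u w) (\sum_w z u w) (\sum_w z1 u w) => r s t q.
    by move: (al1 u); clear; lia.
  have [uC|uC] := boolP (u \in nbh adj' B).
    have := z4 u uC uE.
    move: (\sum_w x1 u w) (\sum_w x0 u w) (\sum_w z u w) (\sum_w z1 u w) => r s t q.
    by move: (al1 u); clear; lia.
  rewrite (zC u uC); move: h (al1 u).
  by move: (\sum_w x1 u w) (\sum_w x0 u w) (\sum_w z1 u w); clear; lia.
- move=> u v uE vE _; left; rewrite !sumE; have := par u; have := par v.
  rewrite uE vE; move: (\sum_w _ + _) (\sum_w _ + _) => s t.
  by lia.
by move=> u v uE vE uv; rewrite !sumE; apply: x1n.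
Qed.

Lemma complete_partial (V : finType) (adj adj' : rel V) (Ev B : {set V})
    (al : V -> int) (x0 : V -> V -> int) :
  irreflexive adj -> symmetric adj' -> subrel adj' adj ->
  (forall v, al v = 1 \/ al v = -1) ->
  conn_indep adj' B -> (forall v, v \in nbh adj' B -> (v \in Ev) = (v \in B)) ->
  ~~ odd #|~: Ev| -> partial_solution adj adj' Ev B al x0 ->
  exists z : V -> V -> int, edge_fun (hrel adj' B) z /\
    forall x1, edge_fun adj x1 ->
      (forall u v, hrel adj' B u v -> x1 u v = 0) ->
      (forall u v, u \notin Ev -> v \notin Ev -> x1 u v = 0) ->
      (forall v, v \notin Ev -> (exists2 u, adj v u & u \notin Ev) ->
         (4 %| \sum_u x1 v u - \sum_u x0 v u)%Z) ->
      (forall v, (2 %| \sum_u x1 v u - \sum_u x0 v u)%Z) ->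
      (forall u v, u \in Ev -> v \in Ev -> adj u v ->
         2 * (degree adj u)%:R + (\sum_w x1 u w + \sum_w z u w) !=
         2 * (degree adj v)%:R + (\sum_w x1 v w + \sum_w z v w)) ->
      exists x, completion adj Ev al x.
Proof.
move=> adji adjs' sub al1 gB EvB Ee ps.
have [z [ze [_ zP]]] := complete_partial_gen adji adjs' sub al1 gB EvB Ee ps.
exists z; split=> // x1 x1e x1c x1o x14 x12 x1n.
apply: (zP x1 z) => // [v vE vO|v]; rewrite subrr dvdz0; split=> //.
exact: x14.
Qed.

Lemma solvable_plain (V : finType) (adj : rel V) (E : {set V}) :
  symmetric adj -> irreflexive adj -> conn_indep adj E -> nbh adj E = setT ->
  ~~ odd #|~: E| -> solvable adj E.
Proof.
move=> adjs adji gE nE Ee al al1.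
have S0 : \sum_(u : V) (0 : int) = 0 by rewrite big1.
have z0e : edge_fun adj (fun _ _ => 0) by split=> // u v; case: (adj u v).
have ps : partial_solution adj adj E E al (fun _ _ => 0).
  split=> // v; first by rewrite nE inE.
  by move=> _; left; rewrite nE inE S0.
have [z [ze zP]] := complete_partial adji adjs (fun _ _ h => h) al1 gE (fun _ _ => erefl) Ee ps.
apply: (zP _ z0e) => // [v _ _|v|u v uE vE uv]; rewrite ?subrr //.
by have [/(_ u v uE vE)] := conn_indepP _ _ gE; rewrite uv.
Qed.

(** Giving the leaf [q] an odd sum repairs the parity of the number of odd sums. It stays in [Ev],
    outside the network, and is distinguished from [r] by size instead of parity: the edge [rr']
    adds a further positive weight at [r]. *)
Lemma solvable_leaf (V : finType) (adj : rel V) (E : {set V}) q r r' :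
  symmetric adj -> irreflexive adj -> conn_indep adj E -> nbh adj E = setT ->
  odd #|~: E| -> q \in E -> (forall w, adj q w -> w = r) -> adj r r' -> r' != q ->
  solvable adj E.
Proof.
move=> adjs adji gE nE Eo qE qr rr' r'q al al1.
have S0 : \sum_(u : V) (0 : int) = 0 by rewrite big1.
have z0e : edge_fun adj (fun _ _ => 0) by split=> // u v; case: (adj u v).
have FE u v : hrel adj E u v -> (u \in E) != (v \in E) by case/andP.
have To : ~~ odd #|q |: ~: E| by rewrite cardsU1 inE qE /= oddD Eo.
have [|||||z [ze _ z4 z2]] := @core_extension _ adj _ E (nbh adj E) (q |: ~: E)
   al (fun _ _ => 0) adji al1 (hrel_sym E adjs) FE _ _ z0e To.
- by move=> u v; apply: hrel_out.
- by have [_] := conn_indepP _ _ gE.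
- by move=> v vE; rewrite !inE vE orbT.
- by move=> v; rewrite nE inE.
- by move=> v _ _; left; rewrite S0.
have zE u v : (u \in E) = (v \in E) -> z u v = 0.
  by move=> uv; apply: edge_fun_off ze _; rewrite hrelE uv eqxx andbF.
exists z; split.
- by apply: edge_fun_sub ze => u v /andP[].
- by move=> u v /negbTE uE /negbTE vE; apply: zE; rewrite uE vE.
- by move=> u v uE vE _; have := z4 u; rewrite nE inE uE S0 add0r; apply.
- move=> u v uE vE uv; have [uq|uq] := eqVneq u q.
    right; rewrite uq; split=> [w qw|]; first by rewrite (qr w) // (qr v) // -uq.
    by exists r'; rewrite // (qr v) // -uq.
  left; have := z2 u; have := z2 v; rewrite !inE uE vE (negbTE uq) orbT !S0 !add0r /=.
  by move: (\sum_w z u w) (\sum_w z v w); clear; lia.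
by move=> u v uE vE uv; have [/(_ u v uE vE)] := conn_indepP _ _ gE; rewrite uv.
Qed.

(** * Configurations with an edge between even vertices *)

(** The symmetric edge function with value [f u] on the edge [cu] and 0 on edges avoiding [c]. *)
Definition star (V : finType) (c : V) (f : V -> int) (u v : V) : int :=
  (u == c)%:R * f v + (v == c)%:R * f u.

Lemma sum_delta (V : finType) (c : V) (t : int) : \sum_u (u == c)%:R * t = t.
Proof.
rewrite (bigD1 c) //= eqxx mul1r big1 ?addr0 // => x /negbTE ->.
by rewrite mul0r.
Qed.

Lemma star_sum (V : finType) (c : V) (f : V -> int) u :
  \sum_v star c f u v = (u == c)%:R * \sum_v f v + f u.
Proof. by rewrite big_split /= -mulr_sumr sum_delta. Qed.

Lemma star_edge (V : finType) (adj : rel V) (c : V) (f : V -> int) :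
  symmetric adj -> irreflexive adj -> (forall u, `|f u| <= (adj c u)%:R) ->
  edge_fun adj (star c f).
Proof.
move=> adjs adji f1; have fc : f c = 0 by have := f1 c; rewrite adji; lia.
split=> [u v|u v]; rewrite /star; first by rewrite addrC.
have [->|uc] := eqVneq u c; have [->|vc] := eqVneq v c; rewrite ?fc; try lia.
  by have := f1 v; lia.
by have := f1 u; rewrite adjs; lia.
Qed.

Lemma star0 (V : finType) (c : V) (f : V -> int) u v : u != c -> v != c -> star c f u v = 0.
Proof. by rewrite /star => /negbTE-> /negbTE->; rewrite !mul0r. Qed.

(* If neither constant choice works, some [beta a] is [#|A| - 1] and some [beta b] is
   its opposite: give [a] and [b] opposite signs, and remove both. *)
Lemma choose_signs (V : finType) (A : {set V}) (beta : V -> int) : #|A| != 1%N ->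
  exists eps : V -> int, (forall u, eps u = 1 \/ eps u = -1) /\
    forall a, a \in A -> \sum_(u in A) eps u - eps a != beta a.
Proof.
move: {2}#|A| (leqnn #|A|) => n; elim: n A beta => [|n IH] A beta.
  rewrite leqn0 cards_eq0 => /eqP-> _; exists (fun=> 1).
  by split=> [u|a]; [left|rewrite inE].
move=> An A1; have sumc (c : int) : \sum_(u in A) c = c * #|A|%:R.
  by rewrite sumr_const mulr_natr.
have [/existsP[a /andP[aA /eqP ab]]|] := boolP [exists a, (a \in A) && (beta a == #|A|%:R - 1)]; last first.
  move/existsPn => h; exists (fun=> 1); split=> [u|a aA]; first by left.
  by rewrite sumc mul1r eq_sym; have := h a; rewrite aA.
have [/existsP[b /andP[bA /eqP bb]]|] := boolP [exists b, (b \in A) && (beta b == 1 - #|A|%:R)]; last first.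
  move/existsPn => h; exists (fun=> -1); split=> [u|b bA]; first by right.
  rewrite sumc eq_sym; have := h b; rewrite bA /=; lia.
have ba : b != a by apply/eqP => ba; move: ab; rewrite -ba bb; lia.
have bAa : b \in A :\ a by rewrite !inE ba.
pose A2 := A :\ a :\ b.
have cA : #|A| = (#|A2|).+2 by rewrite (cardsD1 a) aA (cardsD1 b (A :\ a)) bAa.
have sA (e : V -> int) : \sum_(u in A) e u = e a + (e b + \sum_(u in A2) e u).
  by rewrite (big_setD1 a aA) /= (big_setD1 b bAa).
have inA2 u : u \in A2 = [&& u != b, u != a & u \in A] by rewrite !inE.
have small (e : V -> int) : (forall u, e u = 1 \/ e u = -1) -> `|\sum_(u in A2) e u| <= #|A2|%:R.
  move=> e1; apply: le_trans (ler_norm_sum _ _ _) _.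
  rewrite -sum1_card natr_sum; apply: ler_sum => u _.
  by case: (e1 u) => ->.
(* With three elements the induction hypothesis fails on the single remaining [c]. Here [beta a = 2]
   and [beta b = -2], and one minus sign suffices: at [c] if [beta c = 0], at [b] otherwise. *)
have [/eqP/cards1P[c A2c]|A21] := eqVneq #|A2| 1%N.
  have cb : c != b /\ c != a by have := set11 c; rewrite -A2c inA2 => /and3P[].
  have [bc0|bc0] := eqVneq (beta c) 0.
    exists (fun u => if u == c then -1 else 1); split=> [u|u uA].
      by case: ifP => _; [right|left].
    rewrite sA A2c big_set1 eqxx [a == c]eq_sym [b == c]eq_sym.
    rewrite (negbTE cb.1) (negbTE cb.2).
    have [->|uc] := eqVneq u c; first by rewrite bc0.
    have [->|ua] := eqVneq u a; first by rewrite ab cA A2c cards1.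
    have [->|ub] := eqVneq u b; first by rewrite bb cA A2c cards1.
    by have := inA2 u; rewrite A2c inE (negbTE uc) ua ub uA.
  exists (fun u => if u == b then -1 else 1); split=> [u|u uA].
    by case: ifP => _; [right|left].
  rewrite sA A2c big_set1 eqxx [a == b]eq_sym (negbTE ba) (negbTE cb.1).
  have [->|ub] := eqVneq u b; first by rewrite bb cA A2c cards1.
  have [->|ua] := eqVneq u a; first by rewrite ab cA A2c cards1.
  have : u \in A2 by rewrite inA2 ub ua uA.
  by rewrite A2c inE => /eqP->; move: bc0; clear; lia.
have [|//|e [e1 eA]] := IH A2 beta; first by rewrite -ltnS -ltnS -cA ltnW.
pose e' u : int := if u == a then 1 else if u == b then -1 else e u.
have e'1 u : e' u = 1 \/ e' u = -1.
  by rewrite /e'; case: ifP => _; [left|case: ifP => _; [right|]].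
have s2 : \sum_(u in A2) e' u = \sum_(u in A2) e u.
  by apply: eq_bigr => u; rewrite inA2 /e' => /and3P[/negbTE-> /negbTE->].
(* The signs of [a] and [b] cancel for every other element; for [a] and [b] themselves the forbidden
   values are out of reach, since the sum over [A2] is at most [#|A| - 2] in absolute value. *)
exists e'; split=> // u uA; rewrite sA s2 {1 2}/e' eqxx (negbTE ba) eqxx.
have := small _ e1; rewrite /e'.
have [->|ua] := eqVneq u a; first by rewrite ab cA; lia.
have [->|ub] := eqVneq u b; first by rewrite bb cA; lia.
by have := eA u; rewrite inA2 ua ub uA => /(_ isT); lia.
Qed.

(** Put signs on the edges from [v] to [A]. When [v] is compared with [a], the sign of [va] occurs
    on both sides and cancels, so [choose_signs] applies. If [A] is odd, one edge to an odd
    neighbour [y] restores the parity of [v]; its value [al y] settles [y] modulo 4 at once. *)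
Lemma solvable_star (V : finType) (adj : rel V) (B : {set V}) (v : V) :
  symmetric adj -> irreflexive adj -> v \notin B ->
  let adj' := [rel x y | [&& adj x y, x != v & y != v]] in
  let A := [set a in B | adj v a] in
  conn_indep adj' B -> nbh adj' B = ~: [set v] -> (1 < #|A|)%N ->
  ~~ odd #|~: (v |: B)| -> ~~ odd #|A| || [exists y, (y \notin B) && adj v y] ->
  solvable adj (v |: B).
Proof.
move=> adjs adji vB adj' A gB nB A2 Ee Ay al al1.
have adjs' : symmetric adj' by move=> x y /=; rewrite adjs; congr (_ && _); rewrite andbC.
have sub : subrel adj' adj by move=> x y /and3P[].
have EvB w : w \in nbh adj' B -> (w \in v |: B) = (w \in B).
  by rewrite nB !inE => /negbTE->.
have AE a : a \in A = (a \in B) && adj v a by rewrite inE.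
have [g [gA g1 g4 g2]] : exists g : V -> int,
    [/\ forall u, u \in A -> g u = 0, forall u, `|g u| <= (adj v u)%:R,
        forall u, g u = 0 \/ g u = al u & (2 %| \sum_u g u + #|A|%:R)%Z].
  have [Ao|Ao] := boolP (odd #|A|); last first.
    exists (fun=> 0); split=> [u|u|u|] //; first by left.
    by rewrite big1 // add0r; lia.
  move: Ay; rewrite Ao /= => /existsP[y /andP[yB vy]].
  exists (fun u => (u == y)%:R * al y); split=> [u|u|u|].
  - by rewrite AE => /andP[uB _]; case: eqP => [uy|]; [rewrite -uy uB in yB|rewrite mul0r].
  - by case: eqP => [->|_]; [rewrite vy; case: (al1 y) => ->|rewrite mul0r; case: (adj v u)].
  - by case: eqP => [->|_]; [right; rewrite mul1r|left; rewrite mul0r].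
  - by rewrite sum_delta; case: (al1 y) => ->; lia.
pose f (e : V -> int) u : int := (u \in A)%:R * e u + g u.
have fv e : f e v = 0.
  by rewrite /f AE adji andbF; have := g1 v; rewrite adji; lia.
have fe (e : V -> int) : (forall u, e u = 1 \/ e u = -1) -> forall u, `|f e u| <= (adj v u)%:R.
  move=> e1 u; have := g1 u; have := gA u; rewrite /f AE.
  case: (adj v u); last by rewrite andbF; lia.
  by case: (u \in B) => /=; [move=> /(_ isT)|]; case: (e1 u) => ->; lia.
have fS (e : V -> int) : \sum_u f e u = \sum_(u in A) e u + \sum_u g u.
  rewrite big_split /=; congr (_ + _); rewrite [RHS]big_mkcond.
  by apply: eq_bigr => u _; case: (u \in A); rewrite ?mul1r ?mul0r.
have fO (e : V -> int) u : u \notin B -> f e u = g u.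
  by move=> uB; rewrite /f AE (negbTE uB) mul0r add0r.
have one1 (u : V) : (1 : int) = 1 \/ (1 : int) = -1 by left.
have core (e : V -> int) x y : hrel adj' B x y -> star v (f e) x y = 0.
  by rewrite hrelE => /andP[/and3P[_ xv yv] _]; apply: star0.
have Od (e : V -> int) x y : x \notin v |: B -> y \notin v |: B -> star v (f e) x y = 0.
  by rewrite !inE !negb_or => /andP[xv _] /andP[yv _]; apply: star0.
have sum1A : \sum_(u in A) (1 : int) = #|A|%:R by rewrite sumr_const.
have ps : partial_solution adj adj' (v |: B) B al (star v (f (fun=> 1))).
  split.
  - by apply: star_edge => //; apply: fe.
  - exact: core.
  - exact: Od.
  - move=> w; rewrite nB !inE negbK => /eqP->; rewrite eqxx /=.
    by rewrite star_sum eqxx mul1r fv fS sum1A addr0 addrC g2.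
  - move=> w; rewrite nB !inE negb_or => /andP[wv wB].
    rewrite star_sum (negbTE wv) mul0r add0r fO //=.
    by case: (g4 w) => ->; [left|right; left; rewrite subrr].
have [z [ze zP]] := complete_partial adji adjs' sub al1 gB EvB Ee ps.
pose S w := \sum_u z w u.
have A1 : #|A| != 1%N by rewrite neq_ltn A2 orbT.
have [e [e1 eA]] := choose_signs
  (fun a => 2 * (degree adj a)%:R + S a - 2 * (degree adj v)%:R - S v - \sum_u g u) A1.
apply: (zP (star v (f e))).
- by apply: star_edge => //; apply: fe.
- exact: core.
- exact: Od.
- move=> w; rewrite !inE negb_or => /andP[wv wB] _.
  by rewrite !star_sum (negbTE wv) !mul0r !add0r !fO // subrr.
- have ee : (2 %| \sum_(u in A) e u - #|A|%:R)%Z.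
    rewrite -sum1A -sumrB; apply: rpred_sum => u _.
    by case: (e1 u) => ->.
  move=> w; rewrite !star_sum; have [->|wv] := eqVneq w v.
    by rewrite !mul1r !fv !fS sum1A !addr0; move: ee; move: (\sum_(u in A) _) (\sum_u _) => s t; lia.
  rewrite !mul0r !add0r /f; move: (g w); case: (w \in A); case: (e1 w) => ->; clear; lia.
have main a : a \in B -> adj v a -> 2 * (degree adj v)%:R + (\sum_w star v (f e) v w + S v)
    != 2 * (degree adj a)%:R + (\sum_w star v (f e) a w + S a).
  move=> aB va; have aA : a \in A by rewrite AE aB va.
  have av : a != v by apply: contraTneq aB => ->.
  rewrite !star_sum eqxx mul1r fv addr0 fS (negbTE av) mul0r add0r /f aA gA // addr0 mul1r.
  have := eA a aA; move: (\sum_(u in A) e u) (\sum_u g u) (S v) (S a).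
  by clear; lia.
move=> x y; rewrite !inE; have [->|xv] := eqVneq x v; have [->|yv] := eqVneq y v => /= xB yB xy.
- by move: xy; rewrite adji.
- exact: main.
- by rewrite eq_sym; apply: main; rewrite // adjs.
have [/(_ x y xB yB)] := conn_indepP _ _ gB.
by rewrite /= xy xv yv.
Qed.

(* The vertices of [Q] have no neighbour outside [B], hence no constraint modulo 4:
   all edges from [Q] to a vertex [w] may be given a common sign [t w]. *)
Lemma solvable_free (V : finType) (adj : rel V) (B Z Q : {set V}) (v c : V) :
  symmetric adj -> irreflexive adj -> v \notin B ->
  let adj' := [rel x y | [&& adj x y, x != v, y != v,
                             (x \in Z) ==> (y \in Q) & (y \in Z) ==> (x \in Q)]] in
  {in B &, forall x y, ~~ adj x y} -> Z \subset B -> c \in B -> c \notin Z ->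
  (forall x, adj v x = (x == c) || (x \in Z)) ->
  (forall o, o \in Q -> o \notin v |: B) -> (forall o x, o \in Q -> adj o x -> x \in B) ->
  conn_indep adj' B -> nbh adj' B = ~: [set v] -> (1 < #|Z|)%N -> ~~ odd #|Z| ->
  ~~ odd #|~: (v |: B)| -> solvable adj (v |: B).
Proof.
move=> adjs adji vB adj' Bi ZB cB cZ vN QvB QN gB nB Z1 Ze Ee al al1.
have adjs' : symmetric adj'.
  move=> x y /=; rewrite adjs; case: (adj y x) => //=.
  by case: (x != v); case: (y != v); rewrite //= andbC.
have sub : subrel adj' adj by move=> x y /andP[].
have EvB w : w \in nbh adj' B -> (w \in v |: B) = (w \in B).
  by rewrite nB !inE => /negbTE->.
have QB o : o \in Q -> o \notin B by move=> /QvB; rewrite inE negb_or => /andP[].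
have vZ : v \notin Z by apply: contra vB; apply/subsetP.
have ZN u : u \in Z -> u \in B by apply/subsetP.
pose f (eta : int) u : int := (u \in Z)%:R * eta.
have f1 (eta : int) : eta = 1 \/ eta = -1 -> forall u, `|f eta u| <= (adj v u)%:R.
  by move=> e1 u; rewrite /f vN; case: (u \in Z); case: (u == c); case: e1 => ->.
have fS (eta : int) : \sum_u f eta u = #|Z|%:R * eta.
  by rewrite -mulr_suml sum_setb.
have fv eta : f eta v = 0 by rewrite /f (negbTE vZ) mul0r.
have fO (eta : int) u : u \notin B -> f eta u = 0.
  by move=> uB; rewrite /f (negbTE (contra (ZN u) uB)) mul0r.
have core (e : int) x y : hrel adj' B x y -> star v (f e) x y = 0.
  by rewrite hrelE => /andP[/and5P[_ xv yv _ _] _]; apply: star0.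
have Od (e : int) x y : x \notin v |: B -> y \notin v |: B -> star v (f e) x y = 0.
  by rewrite !inE !negb_or => /andP[xv _] /andP[yv _]; apply: star0.
have one1 : (1 : int) = 1 \/ (1 : int) = -1 by left.
have ps : partial_solution adj adj' (v |: B) B al (star v (f 1)).
  split.
  - by apply: star_edge => //; apply: f1.
  - exact: core.
  - exact: Od.
  - move=> w; rewrite nB !inE negbK => /eqP->; rewrite eqxx /=.
    by rewrite star_sum eqxx mul1r fv fS mulr1 addr0; move: Ze; clear; lia.
  - move=> w; rewrite nB !inE negb_or => /andP[wv wB].
    by rewrite star_sum (negbTE wv) mul0r add0r fO //=; left.
have [z [ze [zpar zP]]] := complete_partial_gen adji adjs' sub al1 gB EvB Ee ps.
have z0 x y : ~~ (adj' x y && ((x \in B) != (y \in B))) -> z x y = 0.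
  exact: edge_fun_off ze.
pose n w := \sum_(y in Q) `|z w y|.
pose r w := \sum_(y | y \notin Q) z w y.
have nge w : 0 <= n w by apply: sumr_ge0.
(* The edge [vu] contributes an odd value, so the even vertex [u] needs a nonzero correction, and
   all edges of [adj'] at [u] lead to [Q]. *)
have zZ u : u \in Z -> n u != 0 /\ r u = 0.
  move=> uZ; have ru : r u = 0.
    by apply: big1 => y yQ; apply: z0; rewrite /= uZ (negbTE yQ) !andbF.
  split=> //; apply/negP => /eqP nu.
  have zu y : z u y = 0.
    have [yQ|yQ] := boolP (y \in Q).
      move: nu; rewrite /n (bigD1 y) //=.
      have : 0 <= \sum_(i in Q | i != y) `|z u i| by apply: sumr_ge0.
      by move: (\sum_(i in Q | _) _) (z u y); clear => s t; lia.
    by apply: z0; rewrite /= uZ (negbTE yQ) !andbF.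
  have := zpar u; rewrite star_sum !inE (ZN u uZ) orbT /= {2}/f uZ.
  rewrite (negbTE (_ : u != v)); last by apply: contraNneq vZ => <-.
  have -> : \sum_y z u y = 0 by apply: big1 => y _; apply: zu.
  by rewrite mul0r mul1r.
pose dg w : int := 2 * (degree adj w)%:R.
(* If no correction edge joins [c] to [Q], the sign [t c] has no effect and [eta] has to separate
   [v] from [c]; its two values give different sums at [v] because [Z] is nonempty. *)
have [eta [eta1 etac]] : exists eta : int, (eta = 1 \/ eta = -1) /\
    (n c = 0 -> dg v + #|Z|%:R * eta != dg c + r c).
  have [h|h] := eqVneq (dg v + #|Z|%:R * 1) (dg c + r c); [exists (-1)|exists 1].
    by split; [right|move=> _; move: h Z1; clear; lia].
  by split; [left|].
(* When [n w] is nonzero, the two signs give different sums at [w], and at most one of them equals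
   the sum at [v]. *)
pose t w : int :=
  if dg v + #|Z|%:R * eta == dg w + ((w \in Z)%:R * eta + (n w + r w)) then -1 else 1.
have t1 w : t w = 1 \/ t w = -1 by rewrite /t; case: ifP; [right|left].
have tn w : n w != 0 -> dg v + #|Z|%:R * eta != dg w + ((w \in Z)%:R * eta + (t w * n w + r w)).
  rewrite /t; case: ifP => [/eqP-> |/negbT h _]; last by rewrite mul1r.
  by move: (n w) (r w) (dg w); clear; lia.
(* Changing signs keeps all parities; among odd vertices only those of [Q] may change modulo 4. *)
pose z1 x y := if x \in Q then t y * `|z x y| else if y \in Q then t x * `|z x y| else z x y.
have zQQ x y : x \notin B -> y \notin B -> z x y = 0.
  by move=> /negbTE xB /negbTE yB; apply: z0; rewrite xB yB andbF.
have z1row w : w \notin Q -> \sum_y z1 w y = t w * n w + r w.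
  move=> wQ; rewrite (bigID (mem Q)) /= /n /r mulr_sumr; congr (_ + _).
    by apply: eq_bigr => y yQ; rewrite /z1 (negbTE wQ) yQ.
  by apply: eq_bigr => y yQ; rewrite /z1 (negbTE wQ) (negbTE yQ).
have z1O w y : w \notin B -> w \notin Q -> z1 w y = z w y.
  move=> wB wQ; rewrite /z1 (negbTE wQ); case: ifP => // yQ.
  by rewrite zQQ ?normr0 ?mulr0 // QB.
have z1par x y : (2 %| z1 x y - z x y)%Z.
  rewrite /z1; move: (z x y) => s; case: ifP => _; [|case: ifP => _; last by rewrite subrr].
    by case: (t1 y) => ->; clear; lia.
  by case: (t1 x) => ->; clear; lia.
have z1e : edge_fun (hrel adj' B) z1.
  have [zs zb] := ze; split=> x y.
    rewrite /z1; case: (boolP (x \in Q)) => xQ; case: (boolP (y \in Q)) => yQ; rewrite ?(zs y) //.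
    by rewrite zQQ ?QB // normr0 !mulr0.
  have := zb x y; rewrite /z1; move: (z x y) (hrel _ _ x y) => s b.
  case: ifP => _; [|case: ifP => _ //].
    by case: (t1 y) => ->; clear; lia.
  by case: (t1 x) => ->; clear; lia.
apply: (zP (star v (f eta)) z1) => //.
- by apply: star_edge => //; apply: f1.
- exact: core.
- exact: Od.
- move=> w; rewrite !inE negb_or => /andP[wv wB] [u wu uE].
  rewrite !star_sum (negbTE wv) !mul0r !add0r !fO // subrr; split=> //.
  rewrite (eq_bigr _ (fun y _ => z1O w y wB _)) ?subrr // => y _.
  by apply: contra uE => wQ; rewrite inE (QN w u) ?orbT.
- move=> w; split; last by rewrite -sumrB; apply: rpred_sum => y _; apply: z1par.
  rewrite !star_sum !fS /f; move: Ze; move: (w == v) (w \in Z) #|Z|.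
  by case: eta1 => ->; clear => a b k; case: a; case: b => /=; lia.
have main a : a \in B -> adj v a -> dg v + (\sum_w star v (f eta) v w + \sum_w z1 v w)
    != dg a + (\sum_w star v (f eta) a w + \sum_w z1 a w).
  move=> aB va; have av : a != v by apply: contraTneq aB => ->.
  have vQ : v \notin Q by apply/negP => /QvB; rewrite !inE eqxx.
  have zv : \sum_w z1 v w = 0.
    by apply: big1 => y _; rewrite z1O // z0 //= eqxx !andbF.
  have aQ : a \notin Q by apply/negP => /QB; rewrite aB.
  rewrite zv z1row // !star_sum eqxx (negbTE av) mul1r mul0r fv fS !addr0 add0r.
  move: va; rewrite vN => /orP[/eqP ac|/zZ[na _]]; last exact: tn.
  have [nc|nc] := eqVneq (n a) 0; last exact: tn.
  rewrite nc mulr0 add0r ac /f (negbTE cZ) mul0r add0r; apply: etac.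
  by rewrite -ac.
move=> x y; rewrite !inE; have [->|xv] := eqVneq x v; have [->|yv] := eqVneq y v => /= xB yB xy.
- by move: xy; rewrite adji.
- exact: main.
- by rewrite eq_sym; apply: main; rewrite // adjs.
by have := Bi x y xB yB; rewrite xy.
Qed.

(** An even vertex of [nbh adj E] lies in the independent set [E], and all its neighbours lie in
    [nbh adj E]. So adjacent even vertices are both outside [nbh adj E], where the correction
    vanishes and the sums are those of [x0]. *)
Lemma completion_outside (V : finType) (adj : rel V) (E Ev : {set V})
    (al : V -> int) (x0 : V -> V -> int) :
  symmetric adj -> irreflexive adj -> (forall v, al v = 1 \/ al v = -1) ->
  conn_indep adj E -> (forall w, w \in nbh adj E -> (w \in Ev) = (w \in E)) ->
  ~~ odd #|~: Ev| -> partial_solution adj adj Ev E al x0 ->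
  (forall u v, u \in Ev -> v \in Ev -> u \notin nbh adj E -> v \notin nbh adj E -> adj u v ->
     2 * (degree adj u)%:R + \sum_w x0 u w != 2 * (degree adj v)%:R + \sum_w x0 v w) ->
  exists x, completion adj Ev al x.
Proof.
move=> adjs adji al1 gE EvE Ee ps ineq.
have [z [ze zP]] := complete_partial adji adjs (fun _ _ h => h) al1 gE EvE Ee ps.
have z0 u : u \notin nbh adj E -> \sum_w z u w = 0.
  move=> uN; apply: big1 => w _; apply: edge_fun_off ze _.
  by apply: contra uN; apply: hrel_out.
apply: (zP x0); first exact: ps_edge ps.
- exact: ps_core ps.
- exact: ps_odd ps.
- by move=> v _ _; rewrite subrr.
- by move=> v; rewrite subrr.
move=> u v uE vE uv.
have out a b : a \in Ev -> b \in Ev -> adj a b -> a \notin nbh adj E.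
  move=> aE bE ab; apply/negP => aN; have aE' : a \in E by rewrite -EvE.
  have bE' : b \in E by rewrite -EvE // (nbh_adj aE' ab).
  by have [/(_ a b aE' bE')] := conn_indepP _ _ gE; rewrite ab.
have uN := out u v uE vE uv; have vN : v \notin nbh adj E by apply: (out v u) => //; rewrite adjs.
by rewrite !z0 // !addr0; apply: ineq.
Qed.

(** * A single pair of adjacent even vertices *)

Lemma star2_edge (V : finType) (adj : rel V) (c v : V) (f g : V -> int) :
  symmetric adj -> irreflexive adj -> c != v -> (forall u, `|f u| <= (adj c u)%:R) ->
  (forall u, `|g u| <= (adj v u)%:R) -> g c = 0 ->
  edge_fun adj (fun u w => star c f u w + star v g u w).
Proof.
move=> adjs adji cv f1 g1 gc.
pose F := [rel x y | adj x y && ((x == c) || (y == c))].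
pose G := [rel x y | adj x y && ~~ ((x == c) || (y == c))].
apply: (@edge_funD _ adj F G) => [||x y /andP[]//|x y /andP[]//|x y /=].
- apply: star_edge => [x y|x|u] /=; rewrite ?adji //; first by rewrite adjs orbC.
  by rewrite eqxx /= andbT.
- apply: star_edge => [x y|x|u] /=; rewrite ?adji //; first by rewrite adjs orbC.
  by rewrite [v == c]eq_sym (negbTE cv) /=; case: (u =P c) => [->|_]; rewrite ?gc ?andbT.
by move/andP => [-> ->].
Qed.

Record pair_setting (V : finType) (adj : rel V) (E Ev : {set V}) (c v : V) : Prop :=
  PairSetting {
  pr_gp : conn_indep adj E;
  pr_Ev : forall w, w \in nbh adj E -> (w \in Ev) = (w \in E);
  pr_even : ~~ odd #|~: Ev|;
  pr_c : c \in Ev; pr_v : v \in Ev;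
  pr_cN : c \notin nbh adj E; pr_vN : v \notin nbh adj E;
  pr_cv : c != v;
  pr_only : forall u w, u \in Ev -> w \in Ev -> u \notin nbh adj E -> w \notin nbh adj E ->
    adj u w -> u = c /\ w = v \/ u = v /\ w = c }.

(** The value of the edge [cv] is carried by [f] alone; hence [g c = 0], and [f v] is added to the
    sum at [v]. The last inequality is the only one left by [completion_outside]. *)
Lemma pair_completion (V : finType) (adj : rel V) (E Ev : {set V}) (c v : V)
    (al : V -> int) (f g : V -> int) :
  symmetric adj -> irreflexive adj -> (forall v, al v = 1 \/ al v = -1) ->
  pair_setting adj E Ev c v ->
  (forall u, `|f u| <= (adj c u)%:R) -> (forall u, `|g u| <= (adj v u)%:R) -> g c = 0 ->
  (forall u, u \in Ev -> u != v -> f u = 0) -> (forall u, u \in Ev -> g u = 0) ->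
  (2 %| \sum_u f u)%Z -> (2 %| \sum_u g u + f v)%Z ->
  (forall w, w \notin Ev -> (w \in nbh adj E /\ (2 %| f w + g w)%Z) \/
                            (4 %| f w + g w - al w)%Z) ->
  2 * (degree adj c)%:R + \sum_u f u != 2 * (degree adj v)%:R + (\sum_u g u + f v) ->
  exists x, completion adj Ev al x.
Proof.
move=> adjs adji al1 [gE EvE Ee cE vE cN vN cv only] f1 g1 gc fE g0 f2 g2 fg ineq.
have fc : f c = 0 by apply: fE.
have gv : g v = 0 by apply: g0.
pose x0 u w := star c f u w + star v g u w.
have x0S u : \sum_w x0 u w = (u == c)%:R * \sum_w f w + f u + ((u == v)%:R * \sum_w g w + g u).
  by rewrite big_split /= !star_sum.
have x0c : \sum_w x0 c w = \sum_w f w.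
  by rewrite x0S eqxx (negbTE cv) mul1r mul0r fc gc !addr0.
have x0v : \sum_w x0 v w = \sum_w g w + f v.
  by rewrite x0S eqxx eq_sym (negbTE cv) mul1r mul0r gv addr0 add0r addrC.
have notN (b : V) : b \notin nbh adj E -> forall u w, hrel adj E u w -> u != b /\ w != b.
  move=> bN u w uw; split; apply: contraNneq bN => <-; first exact: hrel_out uw.
  by apply: (@hrel_out _ _ _ w u) => //; rewrite (hrel_sym E adjs).
have ps : partial_solution adj adj Ev E al x0.
  split.
  - exact: star2_edge.
  - move=> u w uw; have [uc wc] := notN c cN u w uw; have [uv wv] := notN v vN u w uw.
    by rewrite /x0 !star0 ?addr0.
  - move=> u w uE wE; have neq (b a : V) : b \in Ev -> a \notin Ev -> a != b.
      by move=> bE; apply: contraNneq => ->.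
    by rewrite /x0 !star0 ?addr0 ?neq.
  - move=> w wN; have [wE|wE] := boolP (w \in Ev).
      have [->|wc] := eqVneq w c; first by rewrite x0c f2.
      have [->|wv] := eqVneq w v; first by rewrite x0v g2.
      by rewrite x0S (negbTE wc) (negbTE wv) !mul0r fE // g0.
    have neq (b : V) : b \in Ev -> (w == b) = false.
      by move=> bE; apply: contraNF wE => /eqP->.
    rewrite x0S !neq // !mul0r !add0r.
    have [[]|] := fg w wE; first by rewrite (negbTE wN).
    by case: (al1 w) => ->; move: (f w + g w); clear; lia.
  - move=> w wE; have neq (b : V) : b \in Ev -> (w == b) = false.
      by move=> bE; apply: contraNF wE => /eqP->.
    rewrite x0S !neq // !mul0r !add0r.
    by have [[]|] := fg w wE; [left|right; left].
apply: (completion_outside adjs adji al1 gE EvE Ee ps) => u w uE wE uN wN uw.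
have [[-> ->]|[-> ->]] := only u w uE wE uN wN uw; rewrite x0c x0v //.
by rewrite eq_sym.
Qed.

Lemma sum_setM (V : finType) (T : {set V}) (al : V -> int) :
  \sum_u (u \in T)%:R * al u = \sum_(u in T) al u.
Proof.
rewrite [RHS]big_mkcond; apply: eq_bigr => u _.
by case: (u \in T); rewrite ?mul1r ?mul0r.
Qed.

Lemma sum_signs (V : finType) (T : {set V}) (al : V -> int) :
  (forall v, al v = 1 \/ al v = -1) -> (2 %| \sum_(u in T) al u - #|T|%:R)%Z.
Proof.
move=> al1; rewrite -sum1_card natr_sum -sumrB; apply: rpred_sum => u _.
by case: (al1 u) => ->.
Qed.

(** Try [al] on the edges from [c] to [T]. If [c] and [v] then agree, move the value [al y] from
    [cy] to [vy] and put 1 on [cv]: the sum at [y] and the parities are kept, while the difference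
    between [c] and [v] changes by [2 * al y]. *)
Lemma pair_exchange (V : finType) (adj : rel V) (E Ev T : {set V}) (c v y : V)
    (al : V -> int) :
  symmetric adj -> irreflexive adj -> (forall v, al v = 1 \/ al v = -1) ->
  pair_setting adj E Ev c v -> adj c v ->
  (forall w, w \in T -> w \notin Ev /\ adj c w) ->
  (forall w, w \notin Ev -> w \notin nbh adj E -> w \in T) ->
  ~~ odd #|T| -> y \in T -> adj v y ->
  exists x, completion adj Ev al x.
Proof.
move=> adjs adji al1 st cv TP OT Te yT vy.
have [yE cy] := TP y yT; have := sum_signs T al1; set s := \sum_(u in T) al u => sT.
have s2 : (2 %| s)%Z by move: Te sT; move: #|T| s ; clear; lia.
have TE u : u \in Ev -> u \in T = false by move=> uE; apply/negP => /TP[]; rewrite uE.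
have vE := pr_v st; have cE := pr_c st.
have yne b : b \in Ev -> (b == y) = false by move=> bE; apply: contraNF yE => /eqP<-.
have [eq0|ne0] := eqVneq (2 * (degree adj c)%:R + s) (2 * (degree adj v)%:R + (0 + 0)); last first.
  have z0 : \sum_(u : V) (0 : int) = 0 by rewrite big1.
  apply: (@pair_completion _ _ _ _ _ _ _ (fun u => (u \in T)%:R * al u) (fun=> 0)
    adjs adji al1 st).
  - move=> u; have := TP u; case: (u \in T); last by rewrite mul0r; case: (adj c u).
    by case=> // _ ->; case: (al1 u) => ->.
  - by move=> u; case: (adj v u).
  - by [].
  - by move=> u uE _; rewrite TE // mul0r.
  - by [].
  - by rewrite sum_setM.
  - by rewrite z0 TE // mul0r.
  - move=> w wE; rewrite addr0; have [wT|wT] := boolP (w \in T).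
      by right; rewrite mul1r subrr.
    by left; rewrite mul0r; split=> //; apply: contraNT wT; apply: OT.
  - by rewrite sum_setM z0 TE // mul0r.
have fS : \sum_u ((u \in T)%:R * al u - (u == y)%:R * al y + (u == v)%:R * 1) = s - al y + 1.
  by rewrite big_split sumrB /= sum_setM !sum_delta.
have gS : \sum_u (u == y)%:R * al y = al y by rewrite sum_delta.
have fv : (v \in T)%:R * al v - (v == y)%:R * al y + (v == v)%:R * 1 = 1.
  by rewrite TE // yne // eqxx; clear; lia.
apply: (@pair_completion _ _ _ _ _ _ _
  (fun u => (u \in T)%:R * al u - (u == y)%:R * al y + (u == v)%:R * 1)
  (fun u => (u == y)%:R * al y) adjs adji al1 st).
- move=> u; have [->|uv] := eqVneq u v; first by rewrite TE // yne // cv; clear; lia.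
  have [->|uy] := eqVneq u y; first by rewrite yT cy; clear; lia.
  have := TP u; case: (u \in T); last by case: (adj c u); clear; lia.
  by case=> // _ ->; case: (al1 u) => ->; clear; lia.
- move=> u; have [->|uy] := eqVneq u y; last by rewrite mul0r; case: (adj v u).
  by rewrite vy; case: (al1 y) => ->.
- by rewrite yne // mul0r.
- by move=> u uE uv; rewrite TE // yne // (negbTE uv); clear; lia.
- by move=> u uE; rewrite yne // mul0r.
- by rewrite fS; move: s2; case: (al1 y) => ->; clear; lia.
- by rewrite fv gS; case: (al1 y) => ->.
- move=> w wE; have -> : (w == v) = false by apply: contraNF wE => /eqP->.
  have [->|wy] := eqVneq w y; first by right; rewrite yT; clear; lia.
  have [wT|wT] := boolP (w \in T); first by right; clear; lia.
  by left; rewrite !mul0r; split=> //; apply: contraNT wT; apply: OT.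
by rewrite fv fS gS; move: eq0; case: (al1 y) => ->; clear; lia.
Qed.

(** If [O] can be completed to an even set containing [y], [pair_exchange] applies. Otherwise [O] is
    even and misses [y], and the triangle is used: values [-k] on [cy] and [k] on [cv] and [vy] keep
    the sums at [c] and [y] and add [2 * k] at [v]. *)
Lemma solvable_pair_common (V : finType) (adj : rel V) (E Ev : {set V}) (c v y : V) :
  symmetric adj -> irreflexive adj -> pair_setting adj E Ev c v -> adj c v ->
  (forall w, w \notin Ev -> w \notin nbh adj E -> adj c w) ->
  (exists2 r, r \in nbh adj E & r \notin Ev /\ adj c r) \/
     ~~ odd #|[set w | (w \notin Ev) && (w \notin nbh adj E)]| ->
  y \notin Ev -> adj v y -> adj c y -> solvable adj Ev.
Proof.
move=> adjs adji st cv Oc r0 yE vy cy al al1.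
set O := [set w | _] in r0; have OP w : w \in O = (w \notin Ev) && (w \notin nbh adj E).
  by rewrite inE.
have exch (T : {set V}) : (forall w, w \in T -> w \notin Ev /\ adj c w) -> O \subset T ->
    ~~ odd #|T| -> y \in T -> exists x, completion adj Ev al x.
  move=> TP OT Te yT; apply: (pair_exchange adjs adji al1 st cv TP _ Te yT vy) => w wE wN.
  by apply: (subsetP OT); rewrite OP wE.
have OOd w : w \in O -> w \notin Ev /\ adj c w.
  by rewrite OP => /andP[wE wN]; split=> //; apply: Oc.
have addO r : r \in nbh adj E -> r \notin Ev -> adj c r ->
    (forall w, w \in r |: O -> w \notin Ev /\ adj c w) /\ odd #|r |: O| = ~~ odd #|O|.
  move=> rN rE cr; split=> [w|]; first by rewrite in_setU1 => /orP[/eqP->|/OOd].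
  by rewrite cardsU1 OP rN rE /= oddD.
have [yO|yO] := boolP (y \in O).
  have [Oo|Oe] := boolP (odd #|O|); last exact: (exch O).
  have [[r rN [rE cr]]|] := r0; last by rewrite Oo.
  have [rP rodd] := addO r rN rE cr.
  by apply: (exch (r |: O)) => //; rewrite ?subsetUr ?rodd ?Oo // in_setU1 yO orbT.
have yN : y \in nbh adj E by move: yO; rewrite OP yE /= negbK.
have [Oo|Oe] := boolP (odd #|O|).
  have [yP yodd] := addO y yN yE cy.
  by apply: (exch (y |: O)) => //; rewrite ?subsetUr ?yodd ?Oo // in_setU1 eqxx.
have := sum_signs O al1; set s := \sum_(u in O) al u => sO.
have s2 : (2 %| s)%Z by move: Oe sO; move: #|O| s ; clear; lia.
have vE := pr_v st; have cE := pr_c st.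
have OE u : u \in Ev -> u \in O = false by move=> uE; rewrite OP uE.
have yne b : b \in Ev -> (b == y) = false by move=> bE; apply: contraNF yE => /eqP<-.
pose f (k : int) u : int := (u \in O)%:R * al u - (u == y)%:R * k + (u == v)%:R * k.
pose g (k : int) u : int := (u == y)%:R * k.
have fS k : \sum_u f k u = s by rewrite big_split sumrB /= sum_setM !sum_delta subrK.
have gS k : \sum_u g k u = k by rewrite sum_delta.
have fv k : f k v = k by rewrite /f OE // yne // eqxx; clear; lia.
have key (k : int) : k = 0 \/ k = 1 -> 
    2 * (degree adj c)%:R + s != 2 * (degree adj v)%:R + (k + k) ->
    exists x, completion adj Ev al x.
  move=> k01 ineq.
  apply: (@pair_completion _ _ _ _ _ _ _ (f k) (g k) adjs adji al1 st).
  - move=> u; have [->|uv] := eqVneq u v; first by rewrite fv cv; case: k01 => ->; clear; lia.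
    rewrite /f (negbTE uv); have [->|uy] := eqVneq u y.
      by rewrite (negbTE yO) cy; case: k01 => ->; clear; lia.
    have := OOd u; case: (u \in O); last by case: (adj c u); clear; lia.
    by case=> // _ ->; case: (al1 u) => ->; clear; lia.
  - move=> u; rewrite /g; have [->|uy] := eqVneq u y; last by rewrite mul0r; case: (adj v u).
    by rewrite vy; case: k01 => ->.
  - by rewrite /g yne // mul0r.
  - by move=> u uE uv; rewrite /f OE // yne // (negbTE uv); clear; lia.
  - by move=> u uE; rewrite /g yne // mul0r.
  - by rewrite fS.
  - by rewrite fv gS; case: k01 => ->.
  - move=> w wE; rewrite /f /g; have -> : (w == v) = false by apply: contraNF wE => /eqP->.
    have [->|wy] := eqVneq w y; first by left; split=> //; rewrite (negbTE yO); clear; lia.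
    have [wO|wO] := boolP (w \in O); first by right; clear; lia.
    by left; split; [move: wO; rewrite OP wE /= negbK|clear; lia].
  by rewrite fS gS fv.
have [eq0|ne0] := eqVneq (2 * (degree adj c)%:R + s) (2 * (degree adj v)%:R + (0 + 0)).
  by apply: (key 1); [right|move: eq0; clear; lia].
by apply: (key 0); [left|].
Qed.

(** The edge [cv] gets [k], the edges [vu1] and [vu2] get [k1] and [k2]. As [k] counts at both ends,
    it only adjusts parities; [k1 + k2] has to separate [v] from [c]. *)
Lemma pair_combination (V : finType) (adj : rel V) (E Ev T : {set V}) (c v u1 u2 : V)
    (al : V -> int) (k k1 k2 : int) :
  symmetric adj -> irreflexive adj -> (forall v, al v = 1 \/ al v = -1) ->
  pair_setting adj E Ev c v -> adj c v ->
  (forall w, w \in T -> w \notin Ev /\ adj c w) ->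
  (forall w, w \notin Ev -> w \notin nbh adj E -> w \in T) -> u1 != u2 ->
  (forall u, u \in [set u1; u2] -> [/\ u \in nbh adj E, u \notin Ev, adj v u & ~~ adj c u]) ->
  `|k| <= 1 -> `|k1| <= 1 -> `|k2| <= 1 ->
  (2 %| #|T|%:R + k)%Z -> (2 %| k1 + k2 + k)%Z ->
  (4 %| k1 - al u1)%Z \/ k1 = 0 -> (4 %| k2 - al u2)%Z \/ k2 = 0 ->
  2 * (degree adj c)%:R + (\sum_(u in T) al u + k) != 2 * (degree adj v)%:R + (k1 + k2 + k) ->
  exists x, completion adj Ev al x.
Proof.
move=> adjs adji al1 st cv TP OT u12 uP.
have vE := pr_v st; have cE := pr_c st.
move=> k_1 k1_1 k2_1 Tk k12 k1P k2P ineq.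
have TE u : u \in Ev -> u \in T = false.
  by move=> uE; apply/negP => /TP[]; rewrite uE.
have [u1N u1E vu1 cu1] := uP u1 (set21 _ _); have [u2N u2E vu2 cu2] := uP u2 (set22 _ _).
have nu b u : b \in Ev -> u \notin Ev -> (b == u) = false.
  by move=> bE uE; apply: contraNF uE => /eqP<-.
have uT u : ~~ adj c u -> u \in T = false.
  by move=> cu; apply/negP => /TP[]; rewrite (negbTE cu).
pose f u : int := (u \in T)%:R * al u + (u == v)%:R * k.
pose g u : int := (u == u1)%:R * k1 + (u == u2)%:R * k2.
have fS : \sum_u f u = \sum_(u in T) al u + k by rewrite big_split /= sum_setM sum_delta.
have gS : \sum_u g u = k1 + k2 by rewrite big_split /= !sum_delta.
have fv : f v = k by rewrite /f TE // eqxx; clear; lia.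
apply: (@pair_completion _ _ _ _ _ _ _ f g adjs adji al1 st).
- move=> u; have [->|uv] := eqVneq u v; first by rewrite fv cv.
  rewrite /f (negbTE uv); have := TP u; case: (u \in T); last by case: (adj c u); clear; lia.
  by case=> // _ ->; case: (al1 u) => ->; clear; lia.
- move=> u; rewrite /g; have [->|uu1] := eqVneq u u1; first by rewrite (negbTE u12) vu1; move: k1_1; clear; lia.
  by have [->|uu2] := eqVneq u u2; [rewrite vu2; move: k2_1; clear; lia|case: (adj v u); clear; lia].
- by rewrite /g !nu //; clear; lia.
- by move=> u uE uv; rewrite /f TE // (negbTE uv); clear; lia.
- by move=> u uE; rewrite /g !nu //; clear; lia.
- by rewrite fS; move: Tk (sum_signs T al1); move: #|T| (\sum_(u in T) _) ; clear; lia.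
- by rewrite fv gS.
- move=> w wE; rewrite /f /g; have -> : (w == v) = false by apply: contraNF wE => /eqP->.
  have [->|wu1] := eqVneq w u1.
    by rewrite uT // (negbTE u12); case: k1P => k1P; [right|left; split=> //]; move: k1P; clear; lia.
  have [->|wu2] := eqVneq w u2.
    by rewrite uT //; case: k2P => k2P; [right|left; split=> //]; move: k2P; clear; lia.
  have [wT|wT] := boolP (w \in T); first by right; clear; lia.
  left; split; last by clear; lia.
  by apply: contraNT wT; apply: OT.
by rewrite fS gS fv.
Qed.

(** With the sum at [c] fixed, [k1 + k2] has two admissible values: 0 and [2 * al u1] if the signs
    of [u1] and [u2] agree, [al u1] and [al u2] if they differ. The second case has an odd total,
    compensated by [k = 1] and a set [T] of odd size; [r] provides both parities of [T]. *)
Lemma solvable_pair_two (V : finType) (adj : rel V) (E Ev : {set V}) (c v r u1 u2 : V) :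
  symmetric adj -> irreflexive adj -> pair_setting adj E Ev c v -> adj c v ->
  (forall w, w \notin Ev -> w \notin nbh adj E -> adj c w) ->
  r \in nbh adj E -> r \notin Ev -> adj c r -> u1 != u2 ->
  (forall u, u \in [set u1; u2] -> [/\ u \in nbh adj E, u \notin Ev, adj v u & ~~ adj c u]) ->
  solvable adj Ev.
Proof.
move=> adjs adji st cv Oc rN rE cr u12 uP al al1.
pose O := [set w | (w \notin Ev) && (w \notin nbh adj E)].
have OP w : w \in O = (w \notin Ev) && (w \notin nbh adj E) by rewrite inE.
have OP' w : reflect (w \notin Ev /\ w \notin nbh adj E) (w \in O).
  by rewrite OP; apply: andP.
have [T0 [T1 [T0e T1o TP]]] : exists T0 T1 : {set V}, [/\ ~~ odd #|T0|, odd #|T1| &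
    forall T w, T = T0 \/ T = T1 -> (w \in T -> w \notin Ev /\ adj c w) /\ (w \in O -> w \in T)].
  have h w : w \in r |: O -> w \notin Ev /\ adj c w.
    by rewrite in_setU1 OP => /orP[/eqP-> //|/andP[wE wN]]; split=> //; apply: Oc.
  have h' w : w \in O -> w \in r |: O by rewrite in_setU1 orbC => ->.
  have rodd : odd #|r |: O| = ~~ odd #|O| by rewrite cardsU1 OP rN rE /= oddD.
  have [Oo|Oe] := boolP (odd #|O|); [exists (r |: O), O|exists O, (r |: O)];
    split; rewrite ?rodd ?Oo ?Oe // => T w [->|->]; split=> //; try exact: h; try exact: h';
    by move/h'/h.
have vE := pr_v st; have cE := pr_c st.
have key T (k k1 k2 : int) (T01 : T = T0 \/ T = T1) :=
  @pair_combination _ adj E Ev T c v u1 u2 al k k1 k2 adjs adji al1 st cv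
    (fun w => (TP T w T01).1) (fun w wE wN => (TP T w T01).2 (introT (OP' w) (conj wE wN))) u12 uP.
have [au|au] := eqVneq (al u1) (al u2).
  have [eq0|ne0] := eqVneq (2 * (degree adj c)%:R + (\sum_(u in T0) al u + 0))
                           (2 * (degree adj v)%:R + (0 + 0 + 0)).
    apply: (key T0 0 (al u1) (al u2)); rewrite ?subrr //; try (by left).
    - by case: (al1 u1) => ->.
    - by case: (al1 u2) => ->.
    - by move: T0e; clear; lia.
    - by rewrite au; case: (al1 u2) => ->.
    by move: eq0; rewrite au; case: (al1 u2) => ->; clear; lia.
  apply: (key T0 0 0 0) => //; try (by left); try (by right).
  by move: T0e; clear; lia.
have T1e : (2 %| (#|T1|%:R : int) + 1)%Z by move: T1o; clear; lia.
have [eq0|ne0] := eqVneq (2 * (degree adj c)%:R + (\sum_(u in T1) al u + 1))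
                         (2 * (degree adj v)%:R + (al u1 + 0 + 1)).
  apply: (key T1 1 0 (al u2)); rewrite ?subrr //; try (by left); try (by right).
  - by case: (al1 u2) => ->.
  - by case: (al1 u2) => ->.
  by move: eq0 au; case: (al1 u1) => ->; case: (al1 u2) => ->; clear; lia.
apply: (key T1 1 (al u1) 0); rewrite ?subrr //; try (by left); try (by right).
- by case: (al1 u1) => ->.
by case: (al1 u1) => ->.
Qed.

(** [E] is grown from [u] in the graph without [v] and [c]. According to whether [w] is in [E] and
    to the parity of the complement, the vertices added to the even set are [v], none, [c], or
    both. *)
Lemma solvable_path4 (V : finType) (adj : rel V) (u v c w : V) :
  symmetric adj -> irreflexive adj -> u != w ->
  (forall x, adj v x = (x == u) || (x == c)) -> (forall x, adj c x = (x == v) || (x == w)) ->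
  u != c -> w != v ->
  (forall x, x \notin [set v; c] ->
     connect [rel x y | [&& adj x y, x \notin [set v; c] & y \notin [set v; c]]] u x) ->
  exists Ev, solvable adj Ev.
Proof.
move=> adjs adji uw vN cN uc wv; set adjX := [rel x y | _] => conn.
have vu : u != v by apply/eqP => uv; have := vN u; rewrite uv adji eqxx.
have cw : w != c by apply/eqP => wc; have := cN w; rewrite wc adji eqxx orbT.
have vc : v != c by apply/eqP => vc; have := vN c; rewrite vc adji eqxx orbT.
have adjXs : symmetric adjX by move=> x y /=; rewrite adjs; congr (_ && _); rewrite andbC.
have adjXi : irreflexive adjX by move=> x /=; rewrite adji.
have sub : subrel adjX adj by move=> x y /andP[].
have XP x : (x \in [set v; c]) = (x == v) || (x == c) by rewrite !inE.
have [||E [uE gE XE]] := @conn_indep_grow _ adjX [set u] (~: [set v; c]) u adjXs adjXi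
  (conn_indep1 u adjXs adjXi); first by rewrite nbh_mem ?set11.
  by move=> x; rewrite in_setC; apply: conn.
have {uE}uE : u \in E by move/subsetP: uE; apply; rewrite set11.
have nE : nbh adjX E = ~: [set v; c].
  apply/eqP; rewrite eqEsubset XE andbT; apply/subsetP => x xN.
  have cl : closed (hrel adjX E) (mem (~: [set v; c])).
    move=> a b /andP[/and3P[_ aX bX] _].
    by change ((a \in ~: [set v; c]) = (b \in ~: [set v; c])); rewrite !in_setC aX bX.
  have : (u \in ~: [set v; c]) = (x \in ~: [set v; c]).
    exact: (closed_connect cl ((conn_indepP _ _ gE).2 u x (nbh_mem _ uE) xN)).
  by move=> <-; rewrite in_setC XP (negbTE vu) (negbTE uc).
have EX x : x \in E -> x \notin [set v; c].
  by move=> xE; rewrite -in_setC -nE; apply: nbh_mem.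
have vE : v \notin E by apply/negP => /EX; rewrite XP eqxx.
have cE : c \notin E by apply/negP => /EX; rewrite XP eqxx orbT.
have Ei : {in E &, forall x y, ~~ adj x y}.
  move=> x y xE yE; have [/(_ x y xE yE)] := conn_indepP _ _ gE.
  by rewrite /= (EX x xE) (EX y yE) !andbT.
have hsub : subrel (hrel adjX E) (hrel adj E) by move=> x y /andP[/sub xy xyE]; rewrite hrelE xy.
have adjiE x y : adj x y -> x != y by apply: contraTneq => ->; rewrite adji.
have vu' : adj v u by rewrite vN eqxx.
have vc' : adj v c by rewrite vN eqxx orbT.
have cw' : adj c w by rewrite cN eqxx orbT.
have vcE : v \notin c |: E by rewrite !inE negb_or vc vE.
have card1 (x : V) (A : {set V}) : x \notin A -> odd #|~: (x |: A)| = ~~ odd #|~: A|.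
  move=> xA; have xA' : x \in ~: A by rewrite inE xA.
  by rewrite (cardsD1 x (~: A)) xA' /= oddD /= negbK setCU setIC -setDE.
have nadjE : nbh adj E = (~: [set v; c]) :|: [set x in [set v; c] | [exists e in E, adj e x]].
  apply/setP => x; rewrite in_setU -nE; apply/idP/idP.
    rewrite {1}/nbh inE => /orP[xE|xE]; first by rewrite nbh_mem.
    have [xX|xX] := boolP (x \in [set v; c]); first by apply/orP; right; rewrite inE xX.
    have /exists_inP[e eE ex] := xE.
    by apply/orP; left; apply: (@nbh_adj _ adjX E e x) => //; apply/and3P; split=> //; apply: EX.
  case/orP; last by rewrite !inE => /andP[_ ->]; rewrite orbT.
  rewrite !inE => /orP[->//|/exists_inP[e eE /sub ex]].
  by apply/orP; right; apply/exists_inP; exists e.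
have gpE : conn_indep adj E.
  apply/conn_indepP; split=> // x y.
  have hs := hrel_sym E adjs; have cs := sym_connect_sym hs.
  have toX z : z \in nbh adj E -> connect (hrel adj E) z u.
    rewrite nadjE in_setU -nE => /orP[zN|].
      have := (conn_indepP _ _ gE).2 z u zN (nbh_mem _ uE).
      by apply: connect_sub => a b /hsub ab; apply: connect1.
    rewrite inE => /andP[zX /exists_inP[e eE ez]].
    apply: (@connect_trans _ _ e); first apply: connect1.
      rewrite hrelE adjs ez eE (negbTE (_ : z \notin E)) //.
      by apply: contraTN zX; apply: EX.
    have := (conn_indepP _ _ gE).2 e u (nbh_mem _ eE) (nbh_mem _ uE).
    by apply: connect_sub => a b /hsub ab; apply: connect1.
  by move=> /toX xu /toX yu; apply: (connect_trans xu); rewrite cs.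
have vNE : v \in nbh adj E by apply: (nbh_adj uE); rewrite adjs.
have full (A : {set V}) : nbh adj E \subset A -> c \in A -> A = setT.
  move=> /subsetP NA cA; apply/setP => x; rewrite inE.
  have [->|xc] := eqVneq x c; first by [].
  have [->|xv] := eqVneq x v; first exact: NA.
  by apply: NA; rewrite nadjE in_setU in_setC XP (negbTE xc) (negbTE xv).
have [wE|wE] := boolP (w \in E); have [Ro|Re] := boolP (odd #|~: E|).
(* Both neighbours of the odd vertex [c] are even, so [c] has no constraint modulo 4 and the edge
   [vc] may carry either sign [eta]. This changes the sum at [v] but not at [u]. *)
- exists (v |: E) => al al1.
  have EvB x : x \in nbh adjX E -> (x \in v |: E) = (x \in E).
    by rewrite nE in_setC XP in_setU1 negb_or => /andP[/negbTE->].
  pose f (eta : int) x : int := (x == u)%:R + (x == c)%:R * eta.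
  have f1 (eta : int) : eta = 1 \/ eta = -1 -> forall x, `|f eta x| <= (adj v x)%:R.
    move=> e1 x; rewrite /f vN; have [->|xu] := eqVneq x u; first by rewrite (negbTE uc); case: e1 => ->.
    by case: (x == c); case: e1 => ->.
  have fS eta : \sum_x f eta x = 1 + eta.
    rewrite big_split /= sum_delta; congr (_ + _).
    by rewrite (eq_bigr (fun x => (x == u)%:R * 1)) ?sum_delta // => x _; rewrite mulr1.
  have fv eta : f eta v = 0 by rewrite /f [v == u]eq_sym (negbTE vu) (negbTE vc) mul0r.
  have fc eta : f eta c = eta by rewrite /f eqxx [c == u]eq_sym (negbTE uc) mul1r add0r.
  have fu eta : f eta u = 1 by rewrite /f eqxx (negbTE uc) mul0r addr0.
  have core eta x y : hrel adjX E x y -> star v (f eta) x y = 0.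
    rewrite hrelE => /andP[/and3P[_ xX yX] _]; move: xX yX; rewrite !XP !negb_or.
    by move=> /andP[xv _] /andP[yv _]; apply: star0.
  have Od eta x y : x \notin v |: E -> y \notin v |: E -> star v (f eta) x y = 0.
    by rewrite !in_setU1 !negb_or => /andP[xv _] /andP[yv _]; apply: star0.
  have row eta x : x \notin v |: E -> x != c -> \sum_y star v (f eta) x y = 0.
    rewrite in_setU1 negb_or => /andP[xv xE] xc.
    rewrite star_sum (negbTE xv) mul0r add0r /f (negbTE xc) mul0r addr0.
    by rewrite (negbTE (_ : x != u)) //; apply: contraNneq xE => ->.
  have one1 : (1 : int) = 1 \/ (1 : int) = -1 by left.
  have ps : partial_solution adj adjX (v |: E) E al (star v (f 1)).
    split.
    - by apply: star_edge => //; apply: f1.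
    - exact: core.
    - exact: Od.
    - move=> x; rewrite nE in_setC negbK XP => /orP[/eqP->|/eqP->].
        by rewrite in_setU1 eqxx star_sum eqxx fS fv.
      by rewrite in_setU1 negb_or cE eq_sym vc star_sum [c == v]eq_sym (negbTE vc) mul0r add0r fc.
    - move=> x xE; have [->|xc] := eqVneq x c.
        right; right; rewrite nE in_setC negbK XP eqxx orbT; split=> // y.
        by rewrite cN in_setU1 => /orP[->//|/eqP->]; rewrite wE orbT.
      left; rewrite row //; split=> //; rewrite nE in_setC XP negb_or xc andbT.
      by move: xE; rewrite in_setU1 negb_or => /andP[].
  have [|z [ze zP]] := complete_partial adji adjXs sub al1 gE EvB _ ps.
    by rewrite card1 ?Ro.
  pose k := 2 * (degree adj u)%:R + 1 + \sum_y z u y - 2 * (degree adj v)%:R - \sum_y z v y - 1.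
  have [eta [eta1 ek]] : exists eta : int, (eta = 1 \/ eta = -1) /\ eta != k.
    by have [k1|k1] := eqVneq (1 : int) k; [exists (-1); split; [right|rewrite -k1]|exists 1; split; [left|]].
  apply: (zP (star v (f eta))).
  - by apply: star_edge => //; apply: f1.
  - exact: core.
  - exact: Od.
  - move=> x xE [y xy yE]; have xc : x != c.
      apply: contraNneq yE => xc; move: xy.
      by rewrite xc cN in_setU1 => /orP[->//|/eqP->]; rewrite wE orbT.
    by rewrite !row.
  - move=> x; rewrite !star_sum !fS /f; move: (x == v) (x == u) (x == c).
    by case: eta1 => ->; clear => a b d; case: a; case: b; case: d.
  have main x : x \in E -> adj v x -> 2 * (degree adj v)%:R +
      (\sum_y star v (f eta) v y + \sum_y z v y) !=
      2 * (degree adj x)%:R + (\sum_y star v (f eta) x y + \sum_y z x y).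
    move=> xE; rewrite vN => /orP[/eqP->|/eqP xc]; last by rewrite -xc xE in cE.
    rewrite !star_sum eqxx (negbTE vu) mul0r mul1r fS fv fu; move: ek; rewrite /k.
    by move: (\sum_y z v y) (\sum_y z u y); clear; lia.
  move=> x y; rewrite !in_setU1; have [->|xv] := eqVneq x v; have [->|yv] := eqVneq y v => /= xE yE xy.
  + by move: xy; rewrite adji.
  + exact: main.
  + by rewrite eq_sym; apply: main; rewrite // adjs.
  by have := Ei x y xE yE; rewrite xy.
- exists E; apply: solvable_plain => //; apply: full => //.
  by apply: (nbh_adj wE); rewrite adjs.
- have cN' : c \notin nbh adj E.
    rewrite inE negb_or cE /=; apply/exists_inPn => e eE; rewrite adjs cN negb_or.
    by apply/andP; split; [apply: contraNneq vE => <-|apply: contraNneq wE => <-].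
  exists (E :|: [set c]); apply: solvable_plain => //.
  + apply: conn_indep_ext => // [x y /set1P-> /set1P->|x /set1P-> //|x /set1P->].
      by rewrite adji.
    by exists v; rewrite // adjs.
  + apply: full; first by rewrite nbhU subsetUl.
    by apply: nbh_mem; rewrite in_setU set11 orbT.
  by rewrite setUC card1 ?Ro.
(* The values are [- al w] on [vu], [eta] on [vc] and [al w] on [cw]. The sums at [v] and [c] differ
   by [2 * al w] and their degrees are equal; [eta] remains free to separate [v] from [u]. *)
exists (v |: (c |: E)) => al al1.
have EvE x : (x \in v |: (c |: E)) = [|| x == v, x == c | x \in E] by rewrite !in_setU1.
have EvB x : x \in nbh adjX E -> (x \in v |: (c |: E)) = (x \in E).
  by rewrite nE in_setC XP EvE negb_or => /andP[/negbTE-> /negbTE->].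
pose f (eta : int) x : int := (x == u)%:R * (- al w) + (x == c)%:R * eta.
pose g x : int := (x == w)%:R * al w.
have g1 x : `|g x| <= (adj c x)%:R.
  rewrite /g cN; have [->|xw] := eqVneq x w; last by rewrite mul0r; case: (_ || _).
  by rewrite orbT; case: (al1 w) => ->.
have f1 (eta : int) : eta = 1 \/ eta = -1 -> forall x, `|f eta x| <= (adj v x)%:R.
  move=> e1 x; rewrite /f vN; have [->|xu] := eqVneq x u.
    by rewrite (negbTE uc) mul0r addr0 mul1r normrN; case: (al1 w) => ->.
  by rewrite mul0r add0r; case: (x == c); case: e1 => ->.
have fS eta : \sum_x f eta x = eta - al w.
  by rewrite big_split /= !sum_delta addrC.
have gS : \sum_x g x = al w by rewrite sum_delta.
have fv eta : f eta v = 0 by rewrite /f [v == u]eq_sym (negbTE vu) (negbTE vc) !mul0r.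
have fc eta : f eta c = eta by rewrite /f eqxx [c == u]eq_sym (negbTE uc) mul1r mul0r add0r.
have fu eta : f eta u = - al w by rewrite /f eqxx (negbTE uc) mul0r addr0 mul1r.
have gv : g v = 0 by rewrite /g [v == w]eq_sym (negbTE wv) mul0r.
have gc : g c = 0 by rewrite /g (negbTE (adjiE _ _ cw')) mul0r.
have gu : g u = 0 by rewrite /g (negbTE uw) mul0r.
pose x0 eta x y := star v (f eta) x y + star c g x y.
have x0S eta x : \sum_y x0 eta x y =
    (x == v)%:R * (eta - al w) + f eta x + ((x == c)%:R * al w + g x).
  by rewrite big_split /= !star_sum fS gS.
have x0e (eta : int) : eta = 1 \/ eta = -1 -> edge_fun adj (x0 eta).
  by move=> e1; apply: star2_edge => //; apply: f1.
have core eta x y : hrel adjX E x y -> x0 eta x y = 0.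
  rewrite hrelE => /andP[/and3P[_ xX yX] _]; move: xX yX; rewrite !XP !negb_or.
  by move=> /andP[xv xc] /andP[yv yc]; rewrite /x0 !star0.
have Od eta x y : x \notin v |: (c |: E) -> y \notin v |: (c |: E) -> x0 eta x y = 0.
  rewrite !EvE !negb_or => /and3P[xv xc _] /and3P[yv yc _].
  by rewrite /x0 !star0.
have row eta x : x \notin v |: (c |: E) -> \sum_y x0 eta x y = (x == w)%:R * al w.
  rewrite EvE !negb_or => /and3P[xv xc xE].
  rewrite x0S /f /g (negbTE xv) (negbTE xc) !mul0r !add0r addr0.
  by rewrite (negbTE (_ : x != u)) ?mul0r ?add0r //; apply: contraNneq xE => ->.
have one1 : (1 : int) = 1 \/ (1 : int) = -1 by left.
have ps : partial_solution adj adjX (v |: (c |: E)) E al (x0 1).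
  split.
  - exact: x0e.
  - exact: core.
  - exact: Od.
  - move=> x; rewrite nE in_setC negbK XP EvE x0S => /orP[/eqP->|/eqP->].
      by rewrite eqxx (negbTE vc) fv gv; case: (al1 w) => ->.
    by rewrite eqxx orbT [c == v]eq_sym (negbTE vc) fc gc; case: (al1 w) => ->.
  - move=> x xE; rewrite row //; have [->|xw] := eqVneq x w.
      by right; left; rewrite mul1r subrr.
    left; rewrite mul0r; split=> //; rewrite nE in_setC XP negb_or.
    by move: xE; rewrite EvE !negb_or => /and3P[-> ->].
have [|z [ze zP]] := complete_partial adji adjXs sub al1 gE EvB _ ps.
  by rewrite card1 // card1 // negbK.
have z0 x : x \in [set v; c] -> \sum_y z x y = 0.
  move=> xX; apply: big1 => y _; apply: edge_fun_off ze _.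
  by rewrite hrelE /= xX !andbF.
pose k := 2 * (degree adj u)%:R - al w + \sum_y z u y - 2 * (degree adj v)%:R + al w.
have [eta [eta1 ek]] : exists eta : int, (eta = 1 \/ eta = -1) /\ eta != k.
  by have [k1|k1] := eqVneq (1 : int) k; [exists (-1); split; [right|rewrite -k1]|exists 1; split; [left|]].
have dvc : degree adj v = degree adj c.
  rewrite /degree (_ : [set _ | _] = [set u; c]); last by apply/setP => x; rewrite !inE vN.
  rewrite (_ : [set y | adj c y] = [set v; w]); last by apply/setP => x; rewrite !inE cN.
  by rewrite !cards2 uc eq_sym wv.
apply: (zP (x0 eta)).
- exact: x0e.
- exact: core.
- exact: Od.
- by move=> x xE _; rewrite !row ?subrr.
- move=> x; rewrite !x0S /f /g; move: (x == v) (x == u) (x == c) (x == w).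
  by case: eta1 => ->; case: (al1 w) => ->; clear => a b d e; case: a; case: b; case: d; case: e.
have main x : x \in E -> adj v x -> 2 * (degree adj v)%:R +
    (\sum_y x0 eta v y + \sum_y z v y) !=
    2 * (degree adj x)%:R + (\sum_y x0 eta x y + \sum_y z x y).
  move=> xE; rewrite vN => /orP[/eqP->|/eqP xc]; last by rewrite -xc xE in cE.
  rewrite !x0S eqxx (negbTE vu) (negbTE uc) (negbTE vc) !mul0r mul1r fv gv fu gu.
  rewrite (z0 v) ?XP ?eqxx //; move: ek; rewrite /k.
  by move: (\sum_y z u y); clear; lia.
have main2 : 2 * (degree adj v)%:R + (\sum_y x0 eta v y + \sum_y z v y) !=
    2 * (degree adj c)%:R + (\sum_y x0 eta c y + \sum_y z c y).
  rewrite !x0S !eqxx (negbTE vc) [c == v]eq_sym (negbTE vc) !mul0r !mul1r fv gv fc gc.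
  by rewrite !z0 ?XP ?eqxx ?orbT // dvc; case: (al1 w) => ->; clear; lia.
have cNE x : x \in E -> ~~ adj c x.
  move=> xE; rewrite cN; apply/norP.
  by split; [apply: contraNneq vE => <-|apply: contraNneq wE => <-].
move=> x y; rewrite !EvE => /or3P[/eqP->|/eqP->|xE] /or3P[/eqP->|/eqP->|yE] xy //.
- by move: xy; rewrite adji.
- exact: main.
- by rewrite eq_sym.
- by move: xy; rewrite adji.
- by have := cNE y yE; rewrite xy.
- by rewrite eq_sym; apply: main; rewrite // adjs.
- by have := cNE x xE; rewrite adjs xy.
by have := Ei x y xE yE; rewrite xy.
Qed.

(** * Spiders: a centre joined to an independent set of legs *)

Lemma spider_completion (V : finType) (adj : rel V) (E L : {set V}) (v : V)
    (al : V -> int) (h : V -> V -> int) :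
  symmetric adj -> irreflexive adj -> (forall v, al v = 1 \/ al v = -1) ->
  conn_indep adj E -> ~: nbh adj E = v |: L -> v \notin L ->
  (forall x, adj v x = (x \in L)) -> {in L &, forall x y, ~~ adj x y} ->
  ~~ odd #|nbh adj E :\: E| ->
  (forall l b, l \in L -> `|h l b| <= (adj l b)%:R) ->
  (forall l, l \in L -> (2 %| \sum_b h l b)%Z) -> (2 %| \sum_(l in L) h l v)%Z ->
  (forall s, s \in nbh adj E -> s \notin E ->
     (2 %| \sum_(l in L) h l s)%Z \/ (4 %| \sum_(l in L) h l s - al s)%Z) ->
  (forall l, l \in L -> 2 * (#|L|)%:R + \sum_(l' in L) h l' v !=
     2 * (degree adj l)%:R + \sum_b h l b) ->
  exists x, completion adj (E :|: (v |: L)) al x.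
Proof.
move=> adjs adji al1 gE DE vL vN Li Re h1 hl hv hs ineq.
have NE w : (w \in nbh adj E) = (w != v) && (w \notin L).
  by rewrite -[nbh adj E]setCK DE in_setC in_setU1 negb_or.
have EN w : w \in E -> (w != v) && (w \notin L) by rewrite -NE; apply: nbh_mem.
pose Ev := E :|: (v |: L).
have EvP w : (w \in Ev) = [|| w \in E, w == v | w \in L] by rewrite in_setU in_setU1.
have EvE w : w \in nbh adj E -> (w \in Ev) = (w \in E).
  by rewrite NE EvP => /andP[/negbTE-> /negbTE->]; rewrite !orbF.
have EvC : ~: Ev = nbh adj E :\: E.
  by apply/setP => w; rewrite in_setC EvP in_setD NE !negb_or.
pose x0 a b : int := (a \in L)%:R * h a b + (b \in L)%:R * h b a.
have hLL a b : a \in L -> b \in L -> h a b = 0.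
  by move=> aL bL; have := h1 a b aL; rewrite (negbTE (Li a b aL bL)); clear; lia.
have x0l l : l \in L -> \sum_b x0 l b = \sum_b h l b.
  move=> lL; apply: eq_bigr => b _; rewrite /x0 lL mul1r.
  by case: (boolP (b \in L)) => bL; [rewrite !hLL // mulr0|rewrite mul0r addr0].
have x0r a : a \notin L -> \sum_b x0 a b = \sum_(l in L) h l a.
  move=> /negbTE aL; rewrite [RHS]big_mkcond; apply: eq_bigr => b _.
  by rewrite /x0 aL mul0r add0r; case: (b \in L); rewrite ?mul1r ?mul0r.
have hE l e : l \in L -> e \in E -> h l e = 0.
  move=> lL eE; have := h1 l e lL; rewrite adjs.
  have := NE l; rewrite lL andbF => lN; have -> : adj e l = false; last by clear; lia.
  by apply/negP => /(nbh_adj eE); rewrite lN.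
have ps : partial_solution adj adj Ev E al x0.
  split.
  - split=> [a b|a b]; first by rewrite /x0 addrC.
    have := h1 a b; have := h1 b a; have := hLL a b; have := hLL b a; rewrite /x0 [adj b a]adjs.
    case: (a \in L); case: (b \in L) => h2 h3 h4 h5.
    + by rewrite h2 // h3 // !mulr0; case: (adj a b).
    + by rewrite mul1r mul0r addr0 h5.
    + by rewrite mul1r mul0r add0r h4.
    by rewrite !mul0r; case: (adj a b).
  - move=> a b ab; have aN := hrel_out adjs ab.
    have bN : b \in nbh adj E by apply: (@hrel_out _ _ _ b a); rewrite // (hrel_sym E adjs).
    move: aN bN; rewrite !NE /x0 => /andP[_ /negbTE->] /andP[_ /negbTE->].
    by rewrite !mul0r.
  - move=> a b; rewrite !EvP !negb_or /x0 => /and3P[_ _ /negbTE->] /and3P[_ _ /negbTE->].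
    by rewrite !mul0r.
  - move=> w; rewrite NE EvP negb_and !negbK => /orP[/eqP->|wL].
      by rewrite eqxx orbT x0r // hv.
    by rewrite wL !orbT x0l // hl.
  - move=> w; rewrite EvP !negb_or NE => /and3P[wE wv wL].
    rewrite x0r // wv wL /=; have [||h2|h2] := hs w; rewrite ?NE ?wv ?wL //.
      by left.
    by right; left.
rewrite -/Ev; apply: (completion_outside adjs adji al1 gE EvE _ ps); first by rewrite EvC.
have dv : degree adj v = #|L| by apply: eq_card => w; rewrite inE vN.
move=> a b _ _; rewrite !NE !negb_and !negbK => /orP[/eqP->|aL] /orP[/eqP->|bL] ab.
- by move: ab; rewrite adji.
- by rewrite dv x0r // x0l //; apply: ineq.
- by rewrite eq_sym dv x0r // x0l //; apply: ineq.
by have := Li a b aL bL; rewrite ab.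
Qed.

(** With value 0 on all edges at the legs, the centre and the legs have twice their degrees as sums,
    so only a leg [l0] of degree [#|L|] conflicts with [v]. If [#|L|] exceeds 3, the other legs are
    made odd and the pair [v], [l0] is treated; otherwise the values at the three legs are given
    explicitly. *)
Lemma solvable_spider (V : finType) (adj : rel V) (E L : {set V}) (v : V) :
  symmetric adj -> irreflexive adj ->
  conn_indep adj E -> ~: nbh adj E = v |: L -> v \notin L ->
  (forall x, adj v x = (x \in L)) -> {in L &, forall x y, ~~ adj x y} ->
  ~~ odd #|nbh adj E :\: E| -> odd #|L| -> (2 < #|L|)%N ->
  (forall l, l \in L -> exists2 s, s \in nbh adj E & adj l s) ->
  exists Ev, solvable adj Ev.
Proof.
move=> adjs adji gE DE vL vN Li Re Lo L3 LS.
have NE w : (w \in nbh adj E) = (w != v) && (w \notin L).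
  by rewrite -[nbh adj E]setCK DE in_setC in_setU1 negb_or.
have nE l : l \in L -> l \notin nbh adj E by move=> lL; rewrite NE lL andbF.
have LE l s : l \in L -> adj l s -> s \notin E.
  move=> lL ls; apply/negP => sE; have := nE l lL.
  by rewrite (nbh_adj sE) // adjs.
pose S l := [set s in nbh adj E | adj l s].
have SP l s : (s \in S l) = (s \in nbh adj E) && adj l s by rewrite inE.
have degl l : l \in L -> degree adj l = #|S l|.+1.
  move=> lL; rewrite /degree (cardsD1 v) inE adjs vN lL; congr _.+1.
  apply: eq_card => s; rewrite SP NE in_setD1 inE.
  case: (boolP (adj l s)) => ls; rewrite ?andbF // !andbT.
  by case: (boolP (s \in L)) => sL; rewrite ?andbT //; have := Li l s lL sL; rewrite ls.
have [/existsP[l0 /andP[l0L /eqP d0]]|nk] :=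
    boolP [exists l, (l \in L) && (degree adj l == #|L|)]; last first.
  exists (E :|: (v |: L)) => al al1.
  have s0 (A : {pred V}) : \sum_(u in A) (0 : int) = 0 by rewrite big1.
  have s0' : \sum_(u : V) (0 : int) = 0 by rewrite big1.
  apply: (@spider_completion _ adj E L v al (fun _ _ => 0) adjs adji al1 gE DE vL vN Li Re).
  - by move=> l b _; case: (adj l b).
  - by move=> l _; rewrite s0'.
  - by rewrite s0.
  - by move=> s _ _; left; rewrite s0.
  move=> l lL; rewrite s0 s0' !addr0; move/existsPn: nk => /(_ l).
  by rewrite lL /=; move: (degree adj l) #|L|; clear; lia.
have S0 := degl l0 l0L; have vl0 : v != l0 by apply: contraNneq vL => ->.
have [k4|k3] := ltnP 3 #|L|.
  have [u1 [u2 [u3 [uS u12 u13 u23]]]] : exists u1 u2 u3,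
      [/\ forall u, u \in [:: u1; u2; u3] -> u \in S l0, u1 != u2, u1 != u3 & u2 != u3].
    have : (2 < #|S l0|)%N by move: k4; rewrite -d0 S0.
    case/card_gt2P => u1 [u2 [u3 [[h1 h2 h3] [h4 h5 h6]]]]; exists u1, u2, u3; split=> //.
      by move=> u; rewrite !in_cons in_nil orbF => /or3P[/eqP->|/eqP->|/eqP->].
    by rewrite eq_sym.
  pose Ev := E :|: [set v; l0].
  have EvP w : (w \in Ev) = [|| w \in E, w == v | w == l0] by rewrite !inE.
  have nEv w : w \notin Ev -> w \notin nbh adj E -> w \in L :\ l0.
    rewrite EvP NE !negb_or negb_and !negbK => /and3P[_ /negbTE-> wl] /= wL.
    by rewrite in_setD1 wl.
  have LEv w : w \in L :\ l0 -> w \notin Ev /\ adj v w.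
    rewrite in_setD1 => /andP[wl wL]; rewrite EvP vN wL (negbTE wl) orbF; split=> //.
    apply/norP; split; last by apply: contraTneq wL => ->.
    by apply: contra (nE w wL); apply: nbh_mem.
  have vnE : v \notin nbh adj E by rewrite NE eqxx.
  have st : pair_setting adj E Ev v l0.
    split=> //.
    - by move=> w; rewrite NE EvP => /andP[/negbTE-> wL]; rewrite (negbTE (_ : w != l0)) ?orbF //;
        apply: contraNneq wL => ->.
    - have -> : ~: Ev = (nbh adj E :\: E) :|: (L :\ l0).
        apply/setP => w; rewrite in_setU in_setC in_setD; apply/idP/orP.
          move=> wE; have [wN|wN] := boolP (w \in nbh adj E); last by right; apply: nEv.
          by left; move: wE; rewrite EvP !negb_or => /andP[->].
        case=> [/andP[wE wN]|/LEv[] //]; rewrite EvP !negb_or wE /=.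
        by apply/andP; split; apply: contraTneq wN => ->; rewrite ?vnE ?nE.
      rewrite cardsU (_ : _ :&: _ = set0); last first.
        apply/setP => w; rewrite in_setI in_setD in_set0 in_setD1; apply/negP => /andP[/andP[_ wN]].
        by case/andP => _ /nE; rewrite wN.
      rewrite cards0 subn0 oddD (negbTE Re) /=.
      by move: Lo; rewrite (cardsD1 l0) l0L /=.
    - by rewrite EvP eqxx orbT.
    - by rewrite EvP eqxx !orbT.
    - exact: nE.
    move=> a b; rewrite !EvP => aE bE aN bN ab; have nE' w : w \notin nbh adj E -> w \in E = false.
      by move=> wN; apply: contraNF wN; apply: nbh_mem.
    move: aE bE; rewrite !nE' //= => /orP[/eqP av|/eqP al] /orP[/eqP bv|/eqP bl]; subst.
    + by move: ab; rewrite adji.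
    + by left.
    + by right.
    by move: ab; rewrite adji.
  exists Ev => al al1.
  (* Using both or neither of the edges to [u] and [u'] changes the sum at [l0] by [2 * al u]; among
     three neighbours two have equal signs. *)
  have main u u' : u \in [:: u1; u2; u3] -> u' \in [:: u1; u2; u3] -> u != u' -> al u = al u' ->
      exists x, completion adj Ev al x.
    move=> uS1 uS2 uu' au.
    have uP w : w \in [set u; u'] -> [/\ w \in nbh adj E, w \notin Ev, adj l0 w & ~~ adj v w].
      move=> wu; have : w \in S l0 by move: wu; rewrite in_set2 => /orP[/eqP->|/eqP->]; apply: uS.
      rewrite SP => /andP[wN lw]; split=> //; last by rewrite vN; apply: contraL wN; apply: nE.
      rewrite EvP !negb_or (LE l0 w l0L lw) /=.
      by apply/andP; split; apply: contraTneq wN => ->; rewrite ?vnE ?nE.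
    have key := @pair_combination _ adj E Ev (L :\ l0) v l0 u u' al 0.
    have Te : (2 %| (#|L :\ l0|%:R : int) + 0)%Z.
      by move: Lo; rewrite (cardsD1 l0) l0L; clear; lia.
    have vl : adj v l0 by rewrite vN.
    have [eq0|ne0] := eqVneq (2 * (degree adj v)%:R + (\sum_(w in L :\ l0) al w + 0))
                             (2 * (degree adj l0)%:R + (0 + 0 + 0)).
      apply: (key (al u) (al u')) => //; rewrite ?subrr; try (by left).
      - by case: (al1 u) => ->.
      - by case: (al1 u') => ->.
      - by rewrite au; case: (al1 u') => ->.
      by move: eq0; rewrite au; case: (al1 u') => ->; clear; lia.
    by apply: (key 0 0) => //; right.
  have [a12|a12] := eqVneq (al u1) (al u2); first by apply: (main u1 u2); rewrite // !inE eqxx ?orbT.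
  have [a13|a13] := eqVneq (al u1) (al u3); first by apply: (main u1 u3); rewrite // !inE eqxx ?orbT.
  apply: (main u2 u3); rewrite // ?inE ?eqxx ?orbT //.
  by move: a12 a13; case: (al1 u1) => ->; case: (al1 u2) => ->; case: (al1 u3) => ->.
exists (E :|: (v |: L)) => al al1.
have L3' : #|L| = 3 by apply/eqP; rewrite eqn_leq k3 L3.
have [l1 [l2 [l12 Ll]]] : exists l1 l2, l1 != l2 /\ L :\ l0 = [set l1; l2].
  by apply/cards2P; have := cardsD1 l0 L; rewrite l0L L3'; clear; lia.
have [y [y' [yy' Sy]]] : exists y y', y != y' /\ S l0 = [set y; y'].
  by apply/cards2P; move: S0; rewrite d0 L3'; clear; lia.
have l1L : l1 \in L :\ l0 by rewrite Ll set21.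
have l2L : l2 \in L :\ l0 by rewrite Ll set22.
move: l1L l2L; rewrite !in_setD1 => /andP[l10 l1L] /andP[l20 l2L].
have [w1 w1N lw1] := LS l1 l1L; have [w2 w2N lw2] := LS l2 l2L.
have : y \in S l0 by rewrite Sy set21.
have : y' \in S l0 by rewrite Sy set22.
rewrite !SP => /andP[y'N ly'] /andP[yN ly].
have nv s : s \in nbh adj E -> (v == s) = false.
  by rewrite NE eq_sym => /andP[/negbTE].
have sumL (F : V -> int) : \sum_(l in L) F l = F l0 + (F l1 + F l2).
  by rewrite (big_setD1 l0 l0L) /= Ll big_setU1 ?inE // big_set1.
have lvE l : l \in L -> adj l v by move=> lL; rewrite adjs vN.
(* [e0], [e1], [e2] are the values on the edges from [v] to [l0], [l1], [l2]; [c1], [c2] those on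
   [l0y], [l0y']; [b1], [b2] those on [l1w1], [l2w2]. *)
have key (e0 e1 e2 c1 c2 b1 b2 : int) :
    `|e0| <= 1 -> `|e1| <= 1 -> `|e2| <= 1 -> `|c1| <= 1 -> `|c2| <= 1 -> `|b1| <= 1 -> `|b2| <= 1 ->
    (2 %| e0 + c1 + c2)%Z -> (2 %| e1 + b1)%Z -> (2 %| e2 + b2)%Z -> (2 %| e0 + (e1 + e2))%Z ->
    (forall s, let r := (s == y)%:R * c1 + (s == y')%:R * c2 + ((s == w1)%:R * b1 + (s == w2)%:R * b2) in
      (2 %| r)%Z \/ (4 %| r - al s)%Z) ->
    e1 + e2 != c1 + c2 -> 2 * 3 + e0 + e2 != 2 * (degree adj l1)%:R + b1 ->
    2 * 3 + e0 + e1 != 2 * (degree adj l2)%:R + b2 ->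
    exists x, completion adj (E :|: (v |: L)) al x.
  move=> e0b e1b e2b c1b c2b b1b b2b p0 p1 p2 pv rs i0 i1 i2.
  pose h l b : int := if l == l0 then (b == v)%:R * e0 + ((b == y)%:R * c1 + (b == y')%:R * c2)
    else if l == l1 then (b == v)%:R * e1 + (b == w1)%:R * b1
    else (b == v)%:R * e2 + (b == w2)%:R * b2.
  have h0 b : h l0 b = (b == v)%:R * e0 + ((b == y)%:R * c1 + (b == y')%:R * c2).
    by rewrite /h eqxx.
  have hl1 b : h l1 b = (b == v)%:R * e1 + (b == w1)%:R * b1.
    by rewrite /h (negbTE l10) eqxx.
  have hl2 b : h l2 b = (b == v)%:R * e2 + (b == w2)%:R * b2.
    by rewrite /h (negbTE l20) [l2 == l1]eq_sym (negbTE l12).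
  have hS0 : \sum_b h l0 b = e0 + (c1 + c2).
    by under eq_bigr => b _ do rewrite h0; rewrite !big_split /= !sum_delta.
  have hS1 : \sum_b h l1 b = e1 + b1.
    by under eq_bigr => b _ do rewrite hl1; rewrite !big_split /= !sum_delta.
  have hS2 : \sum_b h l2 b = e2 + b2.
    by under eq_bigr => b _ do rewrite hl2; rewrite !big_split /= !sum_delta.
  have Lcase (P : V -> Prop) : P l0 -> P l1 -> P l2 -> forall l, l \in L -> P l.
    move=> P0 P1 P2 l lL; have [->//|ll0] := eqVneq l l0.
    have : l \in L :\ l0 by rewrite in_setD1 ll0.
    by rewrite Ll in_set2 => /orP[/eqP->|/eqP->].
  have hv : \sum_(l in L) h l v = e0 + (e1 + e2).
    by rewrite sumL h0 hl1 hl2 eqxx !nv //; clear; lia.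
  apply: (@spider_completion _ adj E L v al h adjs adji al1 gE DE vL vN Li Re).
  - move=> l b lL; move: l lL b; apply: Lcase => b.
    + rewrite h0; have [->|bv] := eqVneq b v; first by rewrite lvE // !nv //; move: e0b; clear; lia.
      have [->|by1] := eqVneq b y; first by rewrite ly (negbTE yy'); move: c1b; clear; lia.
      have [->|by2] := eqVneq b y'; first by rewrite ly'; move: c2b; clear; lia.
      by case: (adj _ _); clear; lia.
    + rewrite hl1; have [->|bv] := eqVneq b v; first by rewrite lvE // !nv //; move: e1b; clear; lia.
      have [->|bw] := eqVneq b w1; first by rewrite lw1; move: b1b; clear; lia.
      by case: (adj _ _); clear; lia.
    rewrite hl2; have [->|bv] := eqVneq b v; first by rewrite lvE // !nv //; move: e2b; clear; lia.
    have [->|bw] := eqVneq b w2; first by rewrite lw2; move: b2b; clear; lia.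
    by case: (adj _ _); clear; lia.
  - by apply: Lcase; rewrite ?hS0 ?hS1 ?hS2 // addrA.
  - by rewrite hv.
  - move=> s sN _; rewrite sumL h0 hl1 hl2 [s == v]eq_sym nv // !mul0r !add0r.
    exact: rs.
  rewrite hv L3'; apply: Lcase; rewrite ?hS0 ?hS1 ?hS2 ?d0 ?L3'.
  - by move: i0; clear; lia.
  - by move: i1; clear; lia.
  by move: i2; clear; lia.
have al1b s : `|al s| <= 1 by case: (al1 s) => ->.
have pm (k : int) : exists e : int, (e = 1 \/ e = -1) /\ e != k.
  by have [k1|k1] := eqVneq (1 : int) k; [exists (-1); split; [right|rewrite -k1]|exists 1; split; [left|]].
have b0 : `|0 : int| <= 1 by [].
have pm1 e : e = 1 \/ e = -1 -> `|e : int| <= 1 by case=> ->.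
have pq s (p q : int) : p = 0 \/ p = al s -> q = 0 \/ q = al s ->
    (2 %| p + q)%Z \/ (4 %| p + q - al s)%Z.
  by case=> ->; case=> ->; case: (al1 s) => ->; (by left) || (by right).
have [ay|ay] := eqVneq (al y) (al y').
  (* If [w1 = w2], opposite signs cancel there. Since [e1] counts at both [v] and [l1], it is [e2]
     that separates these two; likewise [e1] separates [v] from [l2], and [c] separates [v] from
     [l0]. *)
  have [b1 [b2 [b11 b21 bs]]] : exists b1 b2, [/\ b1 = 1 \/ b1 = -1, b2 = 1 \/ b2 = -1 &
      forall s, let r := (s == w1)%:R * b1 + (s == w2)%:R * b2 in
        r = 0 \/ r = al s].
    have [ww|ww] := eqVneq w1 w2.
      exists 1, (-1); split; [by left|by right|move=> s /=; left].
      by rewrite ww; case: (s == w2).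
    exists (al w1), (al w2); split=> // s /=.
    have [->|s1] := eqVneq s w1; first by right; rewrite (negbTE ww) mul1r mul0r addr0.
    by have [->|s2] := eqVneq s w2; [right|left]; rewrite ?mul1r !mul0r ?add0r.
  have [e2 [e21 e2n]] := pm (2 * (degree adj l1)%:R + b1 - 2 * 3).
  have [e1 [e11 e1n]] := pm (2 * (degree adj l2)%:R + b2 - 2 * 3).
  have [c [c0 cn]] : exists c, (c = 0 \/ c = al y) /\ e1 + e2 != c + c.
    have [h|h] := eqVneq (e1 + e2) (0 + 0); last by exists 0; split; [left|].
    by exists (al y); split; [right|rewrite h; case: (al1 y) => ->].
  have cb : `|c| <= 1 by case: c0 => ->.
  apply: (key 0 e1 e2 c c b1 b2 b0 (pm1 _ e11) (pm1 _ e21) cb cb (pm1 _ b11) (pm1 _ b21)).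
  - by case: c0 => ->; rewrite add0r //; case: (al1 y) => ->.
  - by case: e11 => ->; case: b11 => ->.
  - by case: e21 => ->; case: b21 => ->.
  - by case: e11 => ->; case: e21 => ->.
  - move=> s /=; apply: pq; last exact: bs.
    have [->|sy] := eqVneq s y.
      by rewrite (negbTE yy') mul1r mul0r addr0.
    have [->|sy'] := eqVneq s y'; last by left; rewrite !mul0r.
    by rewrite mul1r mul0r add0r -ay.
  - exact: cn.
  - by move: e2n; clear; lia.
  by move: e1n; clear; lia.
(* With different signs at [y] and [y'], exactly one of the two edges from [l0] to them is used: the
   two options give [l0] different sums. Here [e2 = 0], so [e0] separates [v] from [l1], then [e1]
   separates [v] from [l2]. *)
have [e0 [e01 e0n]] := pm (2 * (degree adj l1)%:R + al w1 - 2 * 3).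
have [e1 [e11 e1n]] := pm (2 * (degree adj l2)%:R - 2 * 3 - e0).
have [c1 [c2 [cb1 cb2 cs cn]]] : exists c1 c2 : int,
    [/\ c1 = al y /\ c2 = 0 \/ c1 = 0 /\ c2 = al y', True,
        (2 %| e0 + c1 + c2)%Z & e1 + 0 != c1 + c2].
  have [h|h] := eqVneq e1 (al y).
    exists 0, (al y'); split=> //; first by right.
      by case: e01 => ->; case: (al1 y') => ->.
    by rewrite h add0r addr0.
  exists (al y), 0; split=> //; first by left.
    by case: e01 => ->; case: (al1 y) => ->.
  by rewrite !addr0.
have c1b : `|c1| <= 1 by case: cb1 => [] [-> _].
have c2b : `|c2| <= 1 by case: cb1 => [] [_ ->].
apply: (key e0 e1 0 c1 c2 (al w1) 0 (pm1 _ e01) (pm1 _ e11) b0 c1b c2b (al1b w1) b0).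
- exact: cs.
- by case: e11 => ->; case: (al1 w1) => ->.
- by [].
- by case: e01 => ->; case: e11 => ->.
- move=> s /=; apply: pq.
    case: cb1 => [] [-> ->]; rewrite mulr0 ?addr0 ?add0r.
      by have [->|sy] := eqVneq s y; [right; rewrite mul1r|left; rewrite mul0r].
    by have [->|sy] := eqVneq s y'; [right; rewrite mul1r|left; rewrite mul0r].
  rewrite mulr0 addr0.
  by have [->|sy] := eqVneq s w1; [right; rewrite mul1r|left; rewrite mul0r].
- exact: cn.
- by move: e0n; clear; lia.
by move: e1n; clear; lia.
Qed.

(** * Finite graphs *)

(** [adj'] omits the edges whose values are prescribed or unwanted in corrections. It keeps all
    edges at [E], so the neighbourhood and the connections of [E] are unchanged; [c] and then [Z]
    are added by [conn_indep_ext]. *)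
Lemma conn_indep_add_set (V : finType) (adj adj' : rel V) (E Z : {set V}) (c : V) :
  symmetric adj -> irreflexive adj -> symmetric adj' -> subrel adj' adj ->
  conn_indep adj E -> c \notin nbh adj E ->
  E = set0 \/ (exists2 w, w \in nbh adj E & adj' c w) ->
  (forall e x, e \in E -> adj e x -> adj' e x) ->
  {in Z &, forall x y, ~~ adj x y} ->
  (forall z, z \in Z -> [/\ z \notin nbh adj E, z != c & ~~ adj c z]) ->
  (forall z, z \in Z -> exists2 y, adj' z y & y \in nbh adj E \/ adj' c y) ->
  conn_indep adj' (E :|: [set c] :|: Z) /\
  forall x, [|| x \in nbh adj E, x == c, adj' c x | x \in Z] ->
    x \in nbh adj' (E :|: [set c] :|: Z).
Proof.
move=> adjs adji adjs' sub gE cN cw Esub Zi ZN Zw.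
have adji' : irreflexive adj' by move=> x; apply/negP => /sub; rewrite adji.
have hE u v : hrel adj' E u v = hrel adj E u v.
  rewrite !hrelE; case: (boolP (adj' u v)) => [/sub -> //|uv] /=.
  apply/esym/negbTE/negP => /andP[uv' uvE]; case/negP: uv.
  move: uvE; case: (boolP (u \in E)) => uE; first by move=> _; apply: Esub.
  by case: (boolP (v \in E)) => // vE _; rewrite adjs'; apply: Esub; rewrite // adjs.
have nE : nbh adj' E = nbh adj E.
  apply/setP => x; rewrite !inE; congr (_ || _); apply/exists_inP/exists_inP => [] [e eE ex];
    by exists e; auto.
have gE' : conn_indep adj' E.
  have [Ei Ec] := conn_indepP _ _ gE; apply/conn_indepP; split=> [u v uE vE|u v].
    by apply: contra (Ei u v uE vE); apply: sub.
  by rewrite nE (eq_connect hE); apply: Ec.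
have gEc : conn_indep adj' (E :|: [set c]).
  have [E0|[w wN cw']] := cw; first by rewrite E0 set0U; apply: conn_indep1.
  apply: conn_indep_ext => // [x y /set1P-> /set1P->|x /set1P->|x /set1P->]; rewrite ?adji' ?nE //.
  by exists w.
have nEc x : (x \in nbh adj' (E :|: [set c])) = [|| x \in nbh adj E, x == c | adj' c x].
  by rewrite nbhU in_setU nE nbh1.
split.
  apply: conn_indep_ext => // [x y xZ yZ|z zZ|z zZ].
  - by apply: contra (Zi x y xZ yZ); apply: sub.
  - rewrite nEc; have [/negbTE-> /negbTE-> cz] := ZN z zZ.
    by apply: contra cz => /= /sub.
  have [y zy yP] := Zw z zZ; exists y => //; rewrite nEc.
  by case: yP => ->; rewrite ?orbT.
move=> x; rewrite nbhU in_setU nEc; case/or4P => [->|->|->|xZ]; rewrite ?orbT //.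
by apply/orP; right; apply: nbh_mem.
Qed.

Lemma closed_connected (V : finType) (adj : rel V) (A : {set V}) :
  symmetric adj -> (forall u v, connect adj u v) -> A != set0 ->
  (forall u v, u \in A -> adj u v -> v \in A) -> A = setT.
Proof.
move=> adjs conn /set0Pn[a aA] Acl; apply/setP => v; rewrite inE.
have cl : closed adj (mem A).
  apply: intro_closed; first exact: sym_connect_sym.
  by move=> u w uw uA; apply: Acl uw.
have : (a \in A) = (v \in A) by exact: (closed_connect cl (conn a v)).
by rewrite aA => <-.
Qed.

Lemma nbh_full (V : finType) (adj : rel V) (q : V) :
  symmetric adj -> irreflexive adj -> (forall u v, connect adj u v) ->
  exists E : {set V}, [/\ q \in E, conn_indep adj E & nbh adj E = setT].
Proof.
move=> adjs adji conn.
have [||E [qE gE TE]] := @conn_indep_grow _ adj [set q] setT q adjs adji (conn_indep1 q adjs adji).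
- by rewrite nbh_mem ?set11.
- by [].
exists E; split=> //; first by move/subsetP: qE; apply; rewrite set11.
by apply/eqP; rewrite eqEsubset TE subsetT.
Qed.

Lemma leaf_config (V : finType) (adj : rel V) (q r : V) :
  symmetric adj -> irreflexive adj -> (forall u v, connect adj u v) -> (2 < #|V|)%N ->
  adj q r -> (forall w, adj q w -> w = r) -> exists Ev, solvable adj Ev.
Proof.
move=> adjs adji conn V3 qr' qr.
have [E [qE gE nE]] := nbh_full q adjs adji conn.
exists E; have [Eo|Ee] := boolP (odd #|~: E|); last exact: solvable_plain.
have [/existsP[r' /andP[rr' r'q]]|/existsPn h] := boolP [exists x, adj r x && (x != q)].
  exact: (solvable_leaf adjs adji gE nE Eo qE qr rr' r'q).
have : [set q; r] = setT.
  apply: (closed_connected adjs conn); first by apply/set0Pn; exists q; rewrite set21.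
  move=> u v; rewrite !in_set2 => /orP[/eqP->|/eqP->]; first by move/qr->; rewrite eqxx orbT.
  by move=> rv; have := h v; rewrite rv negbK => /= ->.
by move/(congr1 (fun A : {set V} => #|A|)); rewrite cardsT => h2; move: V3;
  rewrite -h2 cards2; case: (_ != _).
Qed.

(* If no independent [E] works directly, take [E] maximal among those with an edge
   outside [nbh adj E]; then only a star-like graph, plus an independent set, is left
   around every vertex [c] that could be added to [E]. *)
Lemma connected_config (V : finType) (adj : rel V) :
  symmetric adj -> irreflexive adj -> (forall u v, connect adj u v) -> (2 < #|V|)%N ->
  exists Ev, solvable adj Ev.
Proof.
move=> adjs adji conn V3.
have [/existsP[q /existsP[r /andP[qr' /forallP qr]]]|] :=
    boolP [exists q, exists r, adj q r && [forall w, adj q w ==> (w == r)]].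
  by apply: (leaf_config adjs adji conn V3 qr') => w qw; apply/eqP; apply: (implyP (qr w)).
move/existsPn => noleaf.
have deg2 v x : exists2 y, adj v y & y != x.
  have [/existsP[y /andP[vy yx]]|/existsPn h] := boolP [exists y, adj v y && (y != x)].
    by exists y.
  have hx y : adj v y -> y = x.
    by move=> vy; have := h y; rewrite vy negbK => /eqP.
  have [vx|vx] := boolP (adj v x).
    have /existsPn /(_ x) := noleaf v; rewrite vx /= => /forallP[] y.
    by apply/implyP => /hx ->.
  have : [set v] = setT.
    apply: (closed_connected adjs conn); first by apply/set0Pn; exists v; rewrite set11.
    by move=> a b /set1P-> vb; move: vx; rewrite -(hx b vb) vb.
  by move/(congr1 (fun A : {set V} => #|A|)); rewrite cardsT cards1 => h2; move: V3; rewrite -h2.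
have [/existsP[E /and3P[gE /eqP nE Ee]]|/existsPn NP] :=
    boolP [exists E : {set V}, [&& conn_indep adj E, nbh adj E == setT & ~~ odd #|~: E|]].
  by exists E; apply: solvable_plain.
pose hasedge (E : {set V}) :=
  [exists a, exists b, [&& a \notin nbh adj E, b \notin nbh adj E & adj a b]].
have P0 : conn_indep adj set0 && hasedge set0.
  rewrite conn_indep0 /=; have /card_gt0P[v _] : (0 < #|V|)%N by apply: leq_trans V3.
  have [y vy _] := deg2 v v; apply/existsP; exists v; apply/existsP; exists y.
  by rewrite !nbh0 !inE vy.
have [E [/andP[gE eE] Emax]] : exists E : {set V}, conn_indep adj E && hasedge E /\
    forall E' : {set V}, conn_indep adj E' && hasedge E' -> (#|E'| <= #|E|)%N.
  exists [arg max_(E > set0 | conn_indep adj E && hasedge E) #|E|]%N.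
  by case: arg_maxnP => // E PE Emax; split.
pose X := nbh adj E.
pose cand c := (c \notin X) && ((E == set0) || [exists w in X, adj c w]).
have candP c : cand c -> c \notin X /\ (E = set0 \/ exists2 w, w \in X & adj c w).
  by case/andP => cX /orP[/eqP->|/exists_inP]; [split=> //; left|split=> //; right].
have EX e x : e \in E -> adj e x -> x \in X by apply: nbh_adj.
have EsubX e : e \in E -> e \in X by apply: nbh_mem.
have nXE x : x \notin X -> x \notin E by apply: contra; apply: EsubX.
have candX c w : c \notin X -> w \in X -> adj c w -> cand c.
  by move=> cX wX cw; rewrite /cand cX; apply/orP; right; apply/exists_inP; exists w.
have gpc c : cand c -> conn_indep adj (E :|: [set c]).
  move=> /candP[cX cw]; rewrite -[_ :|: _]setU0.
  have h0 (P : Prop) x : x \in (set0 : {set V}) -> P by rewrite inE.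
  exact: (conn_indep_add_set adjs adji adjs (fun _ _ h => h) gE cX cw (fun _ _ _ h => h)
    (fun x y xZ _ => h0 _ x xZ) (fun z => h0 _ z) (fun z => h0 _ z)).1.
(* Otherwise [E] with [c] added would still miss the edge [ab], against maximality. *)
have F1 c a b : cand c -> a \notin X -> b \notin X -> a != c -> b != c ->
    ~~ adj c a -> ~~ adj c b -> ~~ adj a b.
  move=> cc aX bX ac bc ca cb; apply/negP => ab; have [cX _] := candP c cc.
  have := Emax (E :|: [set c]); rewrite gpc //= setUC cardsU1 (nXE c cX) add1n ltnn.
  move=> h; suff : false by []; apply: h.
  apply/existsP; exists a; apply/existsP; exists b.
  by rewrite setUC nbhU !in_setU !nbh1 !negb_or aX bX ac bc ca cb ab.
have [a0 [b0 [a0X b0X ab0]]] : exists a b, [/\ a \notin X, b \notin X & adj a b].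
  by case/existsP: eE => a /existsP[b /and3P[aX bX ab]]; exists a, b.
(* If all neighbours of [d] were in [X], adding [d] to [E] would leave the edge between [a0] and
   [b0] missed, against [F1]. *)
have F2 d : d \notin X -> exists2 y, y \notin X & adj d y.
  move=> dX; have [/existsP[y /andP[yX dy]]|/existsPn h] := boolP [exists y, (y \notin X) && adj d y].
    by exists y.
  have dN y : y \notin X -> ~~ adj d y by move=> yX; have := h y; rewrite yX.
  have [y dy _] := deg2 d d.
  have yX : y \in X by apply: contraT => /dN; rewrite dy.
  have dc := candX d y dX yX dy.
  have := F1 d a0 b0 dc a0X b0X; rewrite ab0 /=; move=> h'; exfalso.
  suff : false by []; apply: h'; rewrite ?dN //.
    by apply: contraTneq ab0 => ->; apply: dN.
  by apply: contraTneq ab0 => ->; rewrite adjs; apply: dN.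
have [c0 cc0] : exists c, cand c.
  have [E0|En] := eqVneq E set0; first by exists a0; rewrite /cand a0X E0 eqxx.
  have [/existsP[c /existsP[w /and3P[cX wX cw]]]|/existsPn h] :=
      boolP [exists c, exists w, [&& c \notin X, w \in X & adj c w]].
    by exists c; apply: (candX c w).
  have : X = setT.
    apply: (closed_connected adjs conn).
      by case/set0Pn: En => e eE'; apply/set0Pn; exists e; apply: EsubX.
    move=> u w uX uw; apply: contraT => wX; have /existsPn /(_ u) := h w.
    by rewrite wX uX adjs uw.
  by move=> XT; move: a0X; rewrite XT inE.
pose Zs c := [set z | [&& z \notin X, z != c & ~~ adj c z]].
have ZP c z : (z \in Zs c) = [&& z \notin X, z != c & ~~ adj c z] by rewrite inE.
have Zi c : cand c -> {in Zs c &, forall x y, ~~ adj x y}.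
  move=> cc x y; rewrite !ZP => /and3P[xX xc cx] /and3P[yX yc cy].
  exact: (F1 c x y).
have ZN c z : z \in Zs c -> [/\ z \notin nbh adj E, z != c & ~~ adj c z].
  by rewrite ZP => /and3P.
have ZQ c z : cand c -> z \in Zs c -> exists2 y, adj z y & [/\ adj c y, y \notin X & y \notin Zs c].
  move=> cc zZ; have [zX zc cz] := ZN c z zZ; have [y yX zy] := F2 z zX.
  have yZ : y \notin Zs c by apply/negP => yZ; have := Zi c cc z y zZ yZ; rewrite zy.
  exists y => //; split=> //; move: yZ; rewrite ZP yX /=.
  by rewrite negb_and !negbK => /orP[/eqP yc|//]; move: cz; rewrite -yc adjs zy.
pose B c := E :|: [set c] :|: Zs c.
have BP c x : (x \in B c) = [|| x \in E, x == c | x \in Zs c] by rewrite !in_setU in_set1 orbA.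
have QB c x : cand c -> adj c x -> x \notin B c.
  move=> /candP[cX _] cx; rewrite BP ZP cx !andbF orbF negb_or.
  apply/andP; split; last by apply: contraTneq cx => ->; rewrite adji.
  by apply/negP => xE; move: cX; rewrite (EX x c xE) // adjs.
(* [B c] is independent with full closed neighbourhood, so an even complement would contradict [NP].
   Making one more vertex even therefore yields the right parity. *)
have odd_B c : cand c -> odd #|~: B c|.
  move=> cc; have [cX cw] := candP c cc.
  have Zw z : z \in Zs c -> exists2 y, adj z y & y \in X \/ adj c y.
    by move=> zZ; have [y zy [cy _ _]] := ZQ c z cc zZ; exists y => //; right.
  have [gB nB] := conn_indep_add_set adjs adji adjs (fun _ _ h => h) gE cX cw
    (fun _ _ _ h => h) (Zi c cc) (ZN c) Zw.
  have := NP (B c); rewrite gB /= negb_and negbK => /orP[/eqP nT|//].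
  case: nT; apply/setP => x; rewrite [RHS]inE; apply: nB; rewrite ZP -/X.
  by case: (x \in X) => //=; case: (x == c) => //=; case: (adj c x).
have even_B c v : cand c -> adj c v -> ~~ odd #|~: (v |: B c)|.
  move=> cc cv; have vB := QB c v cc cv.
  have := odd_B c cc; rewrite (cardsD1 v) in_setC vB oddD /=.
  by rewrite setCU setIC setDE.
pose A c v := [set a in B c | adj v a].
have AP c v a : (a \in A c v) = (a \in B c) && adj v a by rewrite inE.
have cA c v : adj c v -> c \in A c v by move=> cv; rewrite AP BP eqxx orbT adjs.
have S1 c v : cand c -> v \notin X -> adj c v -> (1 < #|A c v|)%N ->
    ~~ odd #|A c v| || [exists y, (y \notin B c) && adj v y] -> exists Ev, solvable adj Ev.
  move=> cc vX cv A2 Ao; have [cX cw] := candP c cc; have vB := QB c v cc cv.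
  exists (v |: B c).
  pose adj' := [rel x y | [&& adj x y, x != v & y != v]].
  have adjs' : symmetric adj' by move=> x y /=; rewrite adjs; congr (_ && _); rewrite andbC.
  have sub : subrel adj' adj by move=> x y /and3P[].
  have cv' : c != v by apply: contraTneq cv => ->; rewrite adji.
  have Zv z : z \in Zs c -> z != v by rewrite ZP => /and3P[_ _ cz]; apply: contraNneq cz => ->.
  have Xv x : x \in X -> x != v by move=> xX; apply: contraNneq vX => <-.
  have cw' : E = set0 \/ exists2 w, w \in nbh adj E & adj' c w.
    case: cw => [|[w wX cw]]; [by left|right; exists w => //].
    by rewrite /= cw cv' Xv.
  have Es e x : e \in E -> adj e x -> adj' e x.
    by move=> eE1 ex; rewrite /= ex (Xv e (EsubX e eE1)) (Xv x (EX e x eE1 ex)).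
  (* After the deletion of [v], every [z] must still be attached; this is where the absence of
     leaves provides a second neighbour. *)
  have Zw z : z \in Zs c -> exists2 y, adj' z y & y \in X \/ adj' c y.
    move=> zZ; have [y zy [cy yX yZ]] := ZQ c z cc zZ.
    have [yv|yv] := eqVneq y v; last first.
      by exists y; [rewrite /= zy yv Zv|right; rewrite /= cy cv' yv].
    have [y' zy' y'v] := deg2 z v; exists y'; first by rewrite /= zy' y'v Zv.
    have [y'X|y'X] := boolP (y' \in X); [by left|right].
    rewrite /= cv' y'v !andbT; have := Zi c cc z y' zZ; rewrite zy' ZP y'X /=.
    move=> h; apply: contraT => cy'; suff : false by []; apply: h; rewrite cy' andbT.
    by apply: contraTneq zy' => ->; rewrite adjs; have [] := ZN c z zZ.
  have [gB nB] := conn_indep_add_set adjs adji adjs' sub gE cX cw' Es (Zi c cc) (ZN c) Zw.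
  apply: (@solvable_star _ adj (B c) v adjs adji vB gB) => //; last exact: even_B.
  apply/setP => x; rewrite in_setC in_set1; have [->|xv] := eqVneq x v.
    apply/negbTE; rewrite inE negb_or vB /=; apply/exists_inPn => e _.
    by rewrite /= eqxx !andbF.
  apply: nB; rewrite ZP -/X /= cv' xv !andbT.
  by case: (x \in X) => //=; case: (x == c) => //=; case: (adj c x).
have X0 : E = set0 -> X = set0 by move=> E0; rewrite /X E0 nbh0.
(* Here [c] and [v] are the only adjacent even vertices. Either they have a common neighbour, or [v]
   has two further neighbours not adjacent to [c], or [v] has degree 2. *)
have S2 c v : cand c -> v \notin X -> adj c v -> (forall a, a \in B c -> adj v a -> a = c) ->
    (exists Ev, solvable adj Ev) \/
    exists u, [/\ u \in X, adj v u, ~~ adj c u & forall x, adj v x -> x = c \/ x = u].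
  move=> cc vX cv onlyc; have [cX cw] := candP c cc; have vB := QB c v cc cv.
  have cv' : c != v by apply: contraTneq cv => ->; rewrite adji.
  have EvP x : (x \in v |: B c) = (x == v) || (x \in B c) by rewrite in_setU1.
  have XB x : x \in X -> (x \in B c) = (x \in E).
    move=> xX; rewrite BP ZP xX orbF (negbTE (_ : x != c)) ?orbF //.
    by apply: contraNneq cX => <-.
  have st : pair_setting adj E (v |: B c) c v.
    split=> //.
    - move=> x xX; rewrite EvP XB // (negbTE (_ : x != v)) //.
      by apply: contraNneq vX => <-.
    - exact: even_B.
    - by rewrite EvP BP eqxx !orbT.
    - by rewrite EvP eqxx.
    move=> a b; rewrite !EvP => aE bE aX bX ab.
    have Bcase x : x \in B c -> x \notin nbh adj E -> x = c \/ x \in Zs c.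
      by rewrite BP => /or3P[xE xX|/eqP->|]; [by have := nXE x xX; rewrite xE|left|right].
    have nb x y : x \in B c -> x \notin nbh adj E -> y \in B c -> y \notin nbh adj E -> ~~ adj x y.
      move=> xB xX yB yX; have [->|xZ] := Bcase x xB xX; have [->|yZ] := Bcase y yB yX.
      - by rewrite adji.
      - by have [] := ZN c y yZ.
      - by rewrite adjs; have [] := ZN c x xZ.
      exact: Zi cc x y xZ yZ.
    move: aE bE => /orP[/eqP av|aB] /orP[/eqP bv|bB].
    - by move: ab; rewrite av bv adji.
    - by right; rewrite av; split=> //; apply: onlyc => //; rewrite -av.
    - by left; rewrite bv; split=> //; apply: onlyc; rewrite // -bv adjs.
    by have := nb a b aB aX bB bX; rewrite ab.
  have Oc w : w \notin v |: B c -> w \notin nbh adj E -> adj c w.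
    rewrite EvP BP ZP -/X !negb_or => /and4P[_ _ wc]; rewrite wc /= => h wX.
    by move: h; rewrite wX /= negbK.
  have rP : E = set0 \/ exists2 r, r \in nbh adj E & r \notin v |: B c /\ adj c r.
    case: cw => [|[r rX cr]]; [by left|right; exists r => //].
    rewrite EvP negb_or QB //; split=> //; rewrite andbT.
    by apply: contraNneq vX => <-.
  have [/existsP[y /and3P[yB vy cy]]|/existsPn nc] := boolP [exists y, [&& y \notin B c, adj v y & adj c y]].
    left; exists (v |: B c); apply: (solvable_pair_common adjs adji st cv Oc _ _ vy cy).
      case: rP => [E0|]; [right|by left].
      rewrite (_ : [set w | _] = ~: (v |: B c)); first exact: even_B.
      by apply/setP => w; rewrite inE in_setC -/X (X0 E0) in_set0 andbT.
    by rewrite EvP negb_or yB andbT; apply: contraTneq vy => ->; rewrite adji.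
  have nbr x : adj v x -> x != c -> [/\ x \in X, x \notin B c & ~~ adj c x].
    move=> vx xc; have xB : x \notin B c by apply/negP => /onlyc /(_ vx) /eqP; rewrite (negbTE xc).
    have cx : ~~ adj c x by have := nc x; rewrite xB vx.
    split=> //; apply: contraT => xX; case/negP: xB; rewrite BP ZP xX xc cx.
    by rewrite !orbT.
  have [u vu uc] := deg2 v c; have [uX uB cu] := nbr u vu uc.
  have [/existsP[u' /and3P[vu' u'c u'u]]|/existsPn nu] :=
      boolP [exists x, [&& adj v x, x != c & x != u]]; last first.
    right; exists u; split=> // x vx; have := nu x; rewrite vx /= negb_and !negbK.
    by case/orP => /eqP; [left|right].
  left; exists (v |: B c); case: rP => [/X0 E0|[r rX [rE cr]]]; first by move: uX; rewrite E0 inE.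
  rewrite eq_sym in u'u; apply: (solvable_pair_two adjs adji st cv Oc rX rE cr u'u) => x.
  rewrite in_set2 => /orP[/eqP->|/eqP->]; last have [] := nbr u' vu' u'c.
    split=> //; rewrite EvP negb_or uB andbT; apply: contraTneq vu => ->.
    by rewrite adji.
  move=> h1 h2 h3; split=> //; rewrite EvP negb_or h2 andbT; apply: contraTneq vu' => ->.
  by rewrite adji.
have A1 c v : cand c -> v \notin X -> adj c v -> (#|A c v| <= 1)%N ->
    forall a, a \in B c -> adj v a -> a = c.
  move=> cc vX cv Ale a aB va; have aA : a \in A c v by rewrite AP aB.
  have /card_le1P h := Ale; have := h c (cA c v cv) a; rewrite aA inE.
  by move=> /esym/eqP.
(* If [v] has degree 2, it has a neighbour in [X] and is itself a candidate, so the argument applies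
   with [c] and [v] exchanged. If [c] has degree 2 as well, [v] and [c] are the only vertices
   outside [X] and the graph has the form of [solvable_path4]. *)
have S12 c v : cand c -> v \notin X -> adj c v -> (#|A c v| <= 1)%N ->
    exists Ev, solvable adj Ev.
  move=> cc vX cv Ale; have [cX cw] := candP c cc.
  have [//|[u [uX vu cu vN]]] := S2 c v cc vX cv (A1 c v cc vX cv Ale).
  have cv' : c != v by apply: contraTneq cv => ->; rewrite adji.
  have vc : adj v c by rewrite adjs.
  have cvd : cand v by apply: (candX v u).
  have vNX x : adj v x -> x \notin X -> x = c.
    by move=> /vN[//|->]; rewrite uX.
  have E0 : E <> set0 by move/X0 => E0; move: uX; rewrite E0 inE.
  have [r rX cr] : exists2 r, r \in X & adj c r by case: cw.
  have [A2|A2] := ltnP 1 #|A v c|.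
    apply: (S1 v c) => //; apply/orP; right; apply/existsP; exists r; rewrite cr andbT.
    have rv : r != v by apply: contraNneq vX => <-.
    rewrite BP ZP rX (negbTE rv) !orbF; apply: contra cX => rE.
    by apply: (EX r); rewrite // adjs.
  have onlyv := A1 v c cvd cX vc A2.
  have [//|[w [wX cw' vw cN]]] := S2 v c cvd cX vc onlyv.
  have far x : x \notin X -> x != v -> x != c -> ~~ adj v x /\ ~~ adj c x.
    move=> xX xv xc; have vx : ~~ adj v x.
      by apply/negP => vx; move/eqP: (xc) => []; apply: vNX.
    split=> //; apply/negP => cx; move/eqP: (xv) => []; apply: onlyv => //.
    by rewrite BP ZP xX xv vx !orbT.
  have D2 x : x \notin X -> x = v \/ x = c.
    move=> xX; have [->|xv] := eqVneq x v; first by left.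
    have [->|xc] := eqVneq x c; first by right.
    have [y yX xy] := F2 x xX; have [vx cx] := far x xX xv xc.
    have yv : y != v by apply: contraNneq vx => <-; rewrite adjs.
    have yc : y != c by apply: contraNneq cx => <-; rewrite adjs.
    have [vy cy] := far y yX yv yc.
    by have := F1 c x y cc xX yX xc yc cx cy; rewrite xy.
  apply: (@solvable_path4 V adj u v c w adjs adji) => //.
  - by apply: contraNneq vw => <-.
  - by move=> x; apply/idP/orP => [/vN[->|->]|[/eqP->|/eqP->]]; rewrite ?eqxx; auto.
  - by move=> x; apply/idP/orP => [/cN[->|->]|[/eqP->|/eqP->]]; rewrite ?eqxx; auto.
  - by apply: contraNneq cX => <-.
  - by apply: contraNneq vX => <-.
  move=> x xvc; have xX : x \in X.
    by apply: contraNT xvc => /D2[->|->]; rewrite ?set21 ?set22.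
  have := (conn_indepP _ _ gE).2 u x uX xX; apply: connect_sub => a b ab; apply: connect1.
  have aX := hrel_out adjs ab; have bX : b \in X.
    by apply: (@hrel_out _ _ _ b a); rewrite // (hrel_sym E adjs).
  have nvc y : y \in X -> y \notin [set v; c].
    by move=> yX; rewrite in_set2; apply/norP; split; apply: contraTneq yX => ->.
  by move: ab; rewrite hrelE => /andP[/= -> _]; rewrite !nvc.
have [/existsP[c /existsP[v /and4P[cc vX cv]]]|/existsPn nS] := boolP [exists c, exists v,
    [&& cand c, v \notin X, adj c v & (#|A c v| <= 1)%N ||
      (~~ odd #|A c v| || [exists y, (y \notin B c) && adj v y])]].
  have [A2|A1'] := ltnP 1 #|A c v|; last by move=> _; apply: (S12 c v).
  exact: S1.
have S3 c v : cand c -> v \notin X -> adj c v ->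
    [/\ (1 < #|A c v|)%N, odd #|A c v| & forall y, adj v y -> y \in B c].
  move=> cc vX cv; have /existsPn /(_ v) := nS c.
  rewrite cc vX cv /= !negb_or negbK -ltnNge => /and3P[A2 Ao /existsPn nB]; split=> // y vy.
  by have := nB y; rewrite vy andbT negbK.
have NvB c v y : cand c -> v \notin X -> adj c v -> adj v y -> y = c \/ y \in Zs c.
  move=> cc vX cv vy; have [_ _ /(_ y vy)] := S3 c v cc vX cv.
  rewrite BP => /or3P[yE|/eqP|]; [|by left|by right].
  by case/negP: vX; apply: (EX y); rewrite // adjs.
pose Qs c := [set v | (v \notin X) && adj c v].
have QP c x : (x \in Qs c) = (x \notin X) && adj c x by rewrite inE.
(* If [v] is the only neighbour of some candidate [c] outside [X], then the complement of [X] is a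
   spider with centre [v] and legs [c |: Zs c]. *)
have [/existsP[c /andP[cc /cards1P[v Qv]]]|/existsPn nQ] :=
    boolP [exists c, cand c && (#|Qs c| == 1%N)].
  have [cX cw] := candP c cc.
  have /andP[vX cv] : (v \notin X) && adj c v by rewrite -QP Qv set11.
  have vB := QB c v cc cv; have [A2 Ao _] := S3 c v cc vX cv.
  have LP x : (x \in c |: Zs c) = (x == c) || (x \in Zs c) by rewrite in_setU1.
  have vN x : adj v x = (x \in c |: Zs c).
    rewrite LP; apply/idP/orP => [vx|[/eqP->|xZ]]; last 2 first.
    - by rewrite adjs.
    - have [y xy [cy yX _]] := ZQ c x cc xZ; have : y \in Qs c by rewrite QP yX.
      by rewrite Qv => /set1P yv; rewrite adjs -yv.
    by have [->|] := NvB c v x cc vX cv vx; [left|right].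
  have Ali : A c v = c |: Zs c.
    by apply/setP => x; rewrite AP vN LP BP; case: (x == c); case: (x \in Zs c);
      rewrite ?orbT ?andbF.
  have LX x : x \in c |: Zs c -> x \notin X.
    by rewrite LP => /orP[/eqP->|/ZN[]].
  have Li : {in c |: Zs c &, forall x y, ~~ adj x y}.
    move=> x y; rewrite !LP => /orP[/eqP->|xZ] /orP[/eqP->|yZ]; first by rewrite adji.
    - by have [] := ZN c y yZ.
    - by rewrite adjs; have [] := ZN c x xZ.
    exact: Zi cc x y xZ yZ.
  have DE : ~: X = v |: (c |: Zs c).
    apply/setP => x; rewrite in_setC in_setU1; apply/idP/orP => [xX|[/eqP->|/LX]] //.
    rewrite LP ZP xX /=; have [->|xc] := eqVneq x c; first by right.
    have [cx|cx] := boolP (adj c x); last by right.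
    by left; have : x \in Qs c; [rewrite QP xX|rewrite Qv => /set1P->].
  have vL : v \notin c |: Zs c by rewrite -vN adji.
  have Re : ~~ odd #|X :\: E|.
    have := odd_B c cc; rewrite (cardsD1 v) in_setC vB oddD /=.
    rewrite (_ : (~: B c) :\ v = X :\: E) //.
    have XD x : (x \in X) = ~~ ((x == v) || (x \in c |: Zs c)).
      by rewrite -in_setU1 -DE in_setC negbK.
    apply/setP => x; rewrite in_setD1 in_setC in_setD XD BP LP !negb_or.
    by case: (x == v); case: (x \in E).
  apply: (@solvable_spider _ adj E (c |: Zs c) v adjs adji gE DE vL vN Li Re).
  - by rewrite -Ali.
  - by rewrite -Ali; move: A2 Ao; case: #|A c v| => [|[|[]]].
  move=> l lL; have [y ly yv] := deg2 l v; exists y => //.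
  rewrite -[nbh adj E]/X; apply: contraT; rewrite -in_setC DE in_setU1 (negbTE yv) /=.
  by move=> yL; have := Li l y lL yL; rewrite ly.
have [v vX cv] : exists2 v, v \notin X & adj c0 v by apply: F2; case: (candP c0 cc0).
have [c0X c0w] := candP c0 cc0.
have [A2 Ao vNB] := S3 c0 v cc0 vX cv.
pose Zv := [set z in Zs c0 | adj v z].
have ZvP z : (z \in Zv) = (z \in Zs c0) && adj v z by rewrite inE.
have ZvZ z : z \in Zv -> z \in Zs c0 by rewrite ZvP => /andP[].
pose Q := [set o | [&& o \notin X, adj c0 o & o != v]].
have QP' o : (o \in Q) = [&& o \notin X, adj c0 o & o != v] by rewrite inE.
have c0Z : c0 \notin Zs c0 by rewrite ZP eqxx andbF.
have c0Zv : c0 \notin Zv by apply: contra c0Z; apply: ZvZ.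
have vN x : adj v x = (x == c0) || (x \in Zv).
  apply/idP/orP => [vx|[/eqP->|]]; last by rewrite ZvP => /andP[].
    have [->|xZ] := NvB c0 v x cc0 vX cv vx; first by left.
    by right; rewrite ZvP xZ.
  by rewrite adjs.
have Acard : #|A c0 v| = #|Zv|.+1.
  rewrite (cardsD1 c0) cA //; congr _.+1; apply: eq_card => x.
  rewrite in_setD1 AP vN BP; have [->|xc] := eqVneq x c0; first by rewrite (negbTE c0Zv).
  rewrite /= ; case: (boolP (x \in Zv)) => [/ZvZ -> |_]; rewrite ?orbT // andbF.
  by [].
(* Corrections at [Zv] are confined to edges towards [Q]. By [S3] the vertices of [Q] have only even
   neighbours, so [solvable_free] can choose the signs of these edges. *)
pose adj' := [rel x y | [&& adj x y, x != v, y != v,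
                            (x \in Zv) ==> (y \in Q) & (y \in Zv) ==> (x \in Q)]].
have adjs' : symmetric adj'.
  move=> x y /=; rewrite adjs; case: (adj y x) => //=.
  by case: (x != v); case: (y != v); rewrite //= andbC.
have sub : subrel adj' adj by move=> x y /andP[].
have XZv x : x \in X -> x \in Zv = false.
  by move=> xX; apply/negP => /ZvZ /ZN[]; rewrite -/X xX.
have Xv x : x \in X -> x != v by move=> xX; apply: contraNneq vX => <-.
have c0v : c0 != v by apply: contraTneq cv => ->; rewrite adji.
have vB := QB c0 v cc0 cv.
have cw' : E = set0 \/ exists2 w, w \in nbh adj E & adj' c0 w.
  case: c0w => [|[w wX cw]]; [by left|right; exists w => //].
  by rewrite /= cw c0v Xv // (negbTE c0Zv) XZv.
have Es e x : e \in E -> adj e x -> adj' e x.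
  move=> eE1 ex; have xX := EX e x eE1 ex; have eX := EsubX e eE1.
  by rewrite /= ex !Xv // !XZv.
have QZv o : o \in Q -> o \notin Zv.
  by rewrite QP' => /and3P[_ co _]; apply/negP => /ZvZ /ZN[_ _]; rewrite co.
have cQ o : o \in Q -> adj' c0 o.
  move=> oQ; have := QZv o oQ; move: (oQ); rewrite QP' => /and3P[_ co ov] oZ.
  by rewrite /= co c0v ov (negbTE c0Zv) (negbTE oZ).
have Zv' z : z \in Zs c0 -> z != v by rewrite ZP => /and3P[_ _ cz]; apply: contraNneq cz => ->.
(* If [v] were the only neighbour of [z] outside [X], a second neighbour would lie in [X] and make
   [z] a candidate with [Qs z = [set v]], the spider case excluded above. *)
have Zw z : z \in Zs c0 -> exists2 y, adj' z y & y \in X \/ adj' c0 y.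
  move=> zZ; suff [y zy yQ] : exists2 y, adj z y & y \in Q.
    exists y; last by right; apply: cQ.
    have := QZv y yQ => /negbTE yZ; move: (yQ); rewrite QP' => /and3P[_ _ yv].
    by rewrite /= zy yv Zv' // yQ yZ implybT.
  have [zX zc cz] := ZN c0 z zZ; have [y zy [cy yX yZ]] := ZQ c0 z cc0 zZ.
  have [yv|yv] := eqVneq y v; last by exists y; rewrite // QP' yX cy.
  have zv : adj z v by rewrite -yv.
  have [/existsP[y' /and3P[zy' y'X y'v]]|/existsPn nz] :=
      boolP [exists y', [&& adj z y', y' \notin X & y' != v]].
    exists y' => //; rewrite QP' y'X y'v andbT; have := Zi c0 cc0 z y' zZ.
    rewrite zy' ZP y'X /= => h; apply: contraT => cy'; suff : false by []; apply: h.
    by rewrite cy' andbT; apply: contraTneq zy' => ->; rewrite adjs.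
  have [x zx xv] := deg2 z v; have xX : x \in X.
    by apply: contraT => xX; have := nz x; rewrite zx xX xv.
  have zcand : cand z by apply: (candX z x).
  case/negP: (nQ z); rewrite zcand; apply/cards1P; exists v; apply/setP => o.
  rewrite QP in_set1; apply/idP/eqP => [/andP[oX zo]|->]; last by rewrite vX.
  by apply/eqP; apply: contraT => ov; have := nz o; rewrite zo oX ov.
have [gB nB] := conn_indep_add_set adjs adji adjs' sub gE c0X cw' Es (Zi c0 cc0) (ZN c0) Zw.
exists (v |: B c0).
apply: (@solvable_free _ adj (B c0) Zv Q v c0 adjs adji vB) => //.
- have Bi x : x \in B c0 -> x \in E \/ x = c0 \/ x \in Zs c0.
    by rewrite BP => /or3P[|/eqP|]; auto.
  have EZ x y : x \in E -> y \notin X -> ~~ adj x y.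
    by move=> xE; apply: contra; apply: EX.
  have [Ei _] := conn_indepP _ _ gE.
  move=> x y /Bi xB /Bi yB; case: xB => [xE|[->|xZ]]; case: yB => [yE|[->|yZ]].
  + exact: Ei.
  + exact: EZ.
  + by have [yX _ _] := ZN c0 y yZ; apply: EZ.
  + by rewrite adjs; apply: EZ.
  + by rewrite adji.
  + by have [] := ZN c0 y yZ.
  + by have [xX _ _] := ZN c0 x xZ; rewrite adjs; apply: EZ.
  + by rewrite adjs; have [] := ZN c0 x xZ.
  exact: Zi cc0 x y xZ yZ.
- by apply/subsetP => z /ZvZ zZ; rewrite BP zZ !orbT.
- by rewrite BP eqxx orbT.
- by move=> o; rewrite QP' in_setU1 negb_or => /and3P[_ co ->]; apply: QB.
- by move=> o x; rewrite QP' => /and3P[oX co _] ox; have [_ _] := S3 c0 o cc0 oX co; apply.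
- apply/setP => x; rewrite in_setC in_set1; have [->|xv] := eqVneq x v.
    apply/negbTE; rewrite inE negb_or vB /=; apply/exists_inPn => e _.
    by rewrite /= eqxx !andbF.
  apply: nB; apply/or4P; have [xX|xX] := boolP (x \in X); first exact: Or41.
  have [->|xc] := eqVneq x c0; first exact: Or42.
  have [cx|cx] := boolP (adj c0 x); last by apply: Or44; rewrite ZP xX xc.
  by apply: Or43; apply: cQ; rewrite QP' xX cx.
- by move: A2 Ao; rewrite Acard; case: #|Zv| => [|[]].
- by move: Ao; rewrite Acard.
exact: even_B.
Qed.

(** The further neighbour [x] certifies that the component has more than two vertices; in a smaller
    one the condition is empty and constant weights do. *)
Lemma component_weighting (V : finType) (adj : rel V) (r : V) :
  symmetric adj -> irreflexive adj ->
  exists W : V -> V -> nat, [/\ forall u v, W u v = W v u, forall u v, (0 < W u v <= 3)%N &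
    forall u v x, connect adj r u -> adj u v -> adj u x -> x != v ->
      nbr_sum adj W u != nbr_sum adj W v].
Proof.
move=> adjs adji; have cs := sym_connect_sym adjs.
pose C := [set x | connect adj r x].
have CP x : (x \in C) = connect adj r x by rewrite inE.
have Cadj u v : u \in C -> adj u v -> v \in C.
  by rewrite !CP => ru uv; apply: connect_trans ru (connect1 uv).
have [C3|C3] := ltnP 2 #|C|; last first.
  exists (fun _ _ => 1%N); split=> // u v x ru uv ux xv; exfalso.
  have uC : u \in C by rewrite CP.
  have : [set u; v; x] \subset C.
    apply/subsetP => y; rewrite !inE -CP => /orP[/orP[/eqP->|/eqP->]|/eqP->] //.
      exact: Cadj uv.
    exact: Cadj ux.
  have uv' : u != v by apply: contraTneq uv => <-; rewrite adji.
  have ux' : u != x by apply: contraTneq ux => <-; rewrite adji.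
  move/subset_leq_card; rewrite -setUA cardsU1 cards2 in_set2 [v == x]eq_sym xv.
  by rewrite (negbTE uv') (negbTE ux') => h; have := leq_trans h C3.
pose T := {x : V | x \in C}.
pose adjT : rel T := [rel a b | adj (val a) (val b)].
have connT (a b : T) : connect adjT a b.
  have key p : forall a : T, path adj (val a) p ->
      exists2 c : T, connect adjT a c & val c = last (val a) p.
    elim: p => [|y p IH] a' /=; first by exists a'.
    case/andP => ay yp; have yC : y \in C by apply: Cadj ay; apply: valP.
    have [c c1 c2] := IH (Sub y yC) yp; exists c => //.
    by apply: connect_trans c1; apply: connect1.
  have : connect adj (val a) (val b).
    have := valP a; have := valP b; rewrite !CP => rb; rewrite cs => ar.
    exact: connect_trans ar rb.
  by case/connectP => p /key[c ac cE] bE; rewrite (_ : b = c) //; apply: val_inj; rewrite cE.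
have [Ev sol] : exists Ev, solvable adjT Ev.
  apply: connected_config => // [a b|a|]; [exact: adjs|exact: adji|].
  by rewrite card_sig; apply: leq_trans C3 _; rewrite (eq_leq (eq_card _)).
have adjTs : symmetric adjT by move=> a b; apply: adjs.
have adjTi : irreflexive adjT by move=> a; apply: adji.
have [w [ws w13 wne]] := solvable_weighting adjTs adjTi sol.
pose W u v := if ((insub u : option T), (insub v : option T)) is (Some a, Some b) then w a b else 1%N.
have WT (a b : T) : W (val a) (val b) = w a b by rewrite /W !valK.
have WS (a : T) : nbr_sum adj W (val a) = nbr_sum adjT w a.
  rewrite /nbr_sum; transitivity (\sum_(u in C | adj (val a) u) W (val a) u)%N.
    apply: eq_bigl => u; case: (boolP (adj (val a) u)) => au; rewrite ?andbF // andbT.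
    by rewrite (Cadj (val a)) //; apply: valP.
  by rewrite big_sub_cond; apply: eq_bigr => b _; rewrite WT.
exists W; split=> [u v|u v|u v x ru uv ux xv].
- by rewrite /W; case: (insub u : option T) => [a|]; case: (insub v : option T) => [b|].
- by rewrite /W; case: (insub u : option T) => [a|]; case: (insub v : option T) => [b|].
have uC : u \in C by rewrite CP.
have vC := Cadj u v uC uv.
have := wne (Sub u uC : T) (Sub v vC : T) uv.
by rewrite -!WS /=.
Qed.

(** Finite pieces of an infinite graph may contain isolated edges, so the inequality is asked only
    for edges with a further neighbour at one end. *)
Lemma finite_weighting (V : finType) (adj : rel V) :
  symmetric adj -> irreflexive adj ->
  exists w : V -> V -> nat, [/\ forall u v, w u v = w v u, forall u v, (0 < w u v <= 3)%N &
    forall u v x, adj u v -> (adj u x && (x != v)) || (adj v x && (x != u)) ->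
      nbr_sum adj w u != nbr_sum adj w v].
Proof.
move=> adjs adji; have cs := sym_connect_sym adjs.
have [W WP] : exists W : V -> V -> V -> nat, forall r,
    [/\ forall u v, W r u v = W r v u, forall u v, (0 < W r u v <= 3)%N &
    forall u v x, connect adj r u -> adj u v -> adj u x -> x != v ->
      nbr_sum adj (W r) u != nbr_sum adj (W r) v].
  apply: (@fin_all_exists _ (fun=> V -> V -> nat) (fun r W =>
    [/\ forall u v, W u v = W v u, forall u v, (0 < W u v <= 3)%N &
    forall u v x, connect adj r u -> adj u v -> adj u x -> x != v ->
      nbr_sum adj W u != nbr_sum adj W v])) => r.
  exact: component_weighting.
pose w u v := if adj u v then W (fingraph.root adj u) u v else 1%N.
have rootE u v : adj u v -> fingraph.root adj u = fingraph.root adj v.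
  by move=> uv; apply/fingraph.rootP => //; apply: connect1.
have wS u r : r = fingraph.root adj u -> nbr_sum adj w u = nbr_sum adj (W r) u.
  by move=> ->; apply: eq_bigr => v uv; rewrite /w uv.
have main u v x : adj u v -> adj u x -> x != v -> nbr_sum adj w u != nbr_sum adj w v.
  move=> uv ux xv; rewrite (wS u (fingraph.root adj u)) // (wS v (fingraph.root adj u)) ?(rootE u v) //.
  have [_ _] := WP (fingraph.root adj v); apply; [|exact: uv|exact: ux|exact: xv].
  by rewrite -(rootE u v) // cs connect_root.
exists w; split=> [u v|u v|u v x uv].
- rewrite /w adjs; case: ifP => // vu; rewrite (rootE v u) //.
  by case: (WP (fingraph.root adj u)).
- by rewrite /w; case: ifP => // _; case: (WP (fingraph.root adj u)).
case/orP => /andP[]; first exact: main.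
by move=> vx xu; rewrite eq_sym; apply: main xu => //; rewrite adjs.
Qed.

(** * Infinite degrees and compactness *)

From mathcomp Require Import boolp classical_sets cardinality filter.

Lemma finite_list (T : choiceType) (A : T -> Prop) :
  Defs.finite_set A <-> exists l : seq T, forall x, A x -> x \in l.
Proof.
have inP l (x : T) : List.In x l <-> x \in l.
  elim: l => //= y l IH; rewrite in_cons; split=> [[->|/IH->]|/orP[/eqP->|/IH]]; auto.
    by rewrite eqxx.
  by rewrite orbT.
by split=> -[l lA]; exists l => x /lA /inP.
Qed.

Lemma finite_enum (T : choiceType) (A : T -> Prop) :
  Defs.finite_set A -> exists2 l : seq T, uniq l & forall x, A x <-> x \in l.
Proof.
move=> /finite_list[l lA]; exists (undup [seq x <- l | `[<A x>]]); first exact: undup_uniq.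
move=> x; rewrite mem_undup mem_filter; split=> [Ax|/andP[/asboolP]//].
by rewrite lA ?andbT //; apply/asboolP.
Qed.

Lemma infinite_injection (T : choiceType) (A : T -> Prop) :
  Defs.infinite_set A -> exists h : nat -> T, (forall n, A (h n)) /\ injective h.
Proof.
move=> Ainf; have ex (l : seq T) : exists x, A x /\ x \notin l.
  apply: contrapT => nex; apply: Ainf; apply/finite_list; exists l => x Ax.
  by apply: contrapT => /negP xl; apply: nex; exists x.
have [next nextP] := choice ex.
pose l := fix l n := if n is m.+1 then next (l m) :: l m else [::].
have lsub i j : (i < j)%N -> next (l i) \in l j.
  elim: j => // j IH; rewrite ltnS leq_eqVlt in_cons => /orP[/eqP->|/IH->].
    by rewrite eqxx.
  by rewrite orbT.
exists (fun n => next (l n)); split=> [n|i j eij]; first by case: (nextP (l n)).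
have [ij|ji|//] := ltngtP i j.
  by have := lsub i j ij; rewrite eij; have [_ /negbTE->] := nextP (l j).
by have := lsub j i ji; rewrite -eij; have [_ /negbTE->] := nextP (l i).
Qed.

(* By Zorn's lemma, [A] is the disjoint union of countable sets and a finite set. *)
Lemma infinite_tripling (T : choiceType) (A : T -> Prop) :
  Defs.infinite_set A -> exists phi : T -> nat -> T,
    (forall x k, A x -> A (phi x k)) /\
    forall x y k k', A x -> A y -> (k < 3)%N -> (k' < 3)%N ->
      phi x k = phi y k' -> x = y /\ k = k'.
Proof.
move=> Ainf.
(* The second condition says both that the sequences are injective and that their ranges are
   pairwise disjoint. *)
pose P (H : set (nat -> T)) := (forall h n, H h -> A (h n)) /\
  forall h h' n n', H h -> H h' -> h n = h' n' -> h = h' /\ n = n'.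
have [|H [[HA Hinj] Hmax]] := @Zorn_bigcup _ P.
  move=> F FP Ftot; split=> [h n [X FX Xh]|h h' n n' [X FX Xh] [Y FY Yh']].
    by have [+ _] := FP X FX; apply.
  have [XY|YX] := Ftot X Y FX FY.
    by have [_] := FP Y FY; apply=> //; apply: XY.
  by have [_] := FP X FX; apply=> //; apply: YX.
pose R x := A x /\ forall h n, H h -> h n <> x.
have Rfin : Defs.finite_set R.
  apply: contrapT => /infinite_injection[g [gR ginj]].
  apply: (Hmax (fun h => H h \/ h = g)).
    split=> [h Hh|sub]; first by left.
    by have [_ /(_ g 0%N (sub g (or_intror erefl)))] := gR 0%N; apply.
  split=> [h n [Hh|->]|h h' n n' [Hh|->] [Hh'|->]].
  - exact: HA.
  - by case: (gR n).
  - exact: Hinj.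
  - by move=> hg; have [_ /(_ h n Hh)] := gR n'.
  - by move=> gh; have [_ /(_ h' n' Hh')] := gR n; rewrite gh.
  by move=> /ginj->.
have [l lu lR] := finite_enum Rfin.
have [h0 Hh0] : exists h, H h.
  apply: contrapT => nH; apply: Ainf; apply/finite_list; exists l => x Ax.
  by apply/lR; split=> // h n Hh; case: nH; exists h.
(* Shifting all indices by [size l] frees the first places of [h0] for the finite remainder; each
   place is then split in three by [3 * n + k]. *)
have code x : exists c : (nat -> T) * nat, A x -> H c.1 /\
    ((exists n, c.1 n = x /\ c.2 = (n + size l)%N) \/ (c = (h0, index x l) /\ x \in l)).
  have [Ax|nA] := pselect (A x); last by exists (h0, 0%N).
  have [[h [n [Hh hn]]]|nR] := pselect (exists h n, H h /\ h n = x).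
    by exists (h, (n + size l)%N) => _; split=> //; left; exists n.
  exists (h0, index x l) => _; split=> //; right; split=> //.
  by apply/lR; split=> // h n Hh hn; apply: nR; exists h, n.
have [c cP] := choice code.
have cinj x y : A x -> A y -> c x = c y -> x = y.
  move=> /cP[_ cx] /cP[_ cy] e; case: cx => [[n [cn c2]]|[cx xl]]; case: cy => [[n' [cn' c2']]|[cy yl]].
  - have : n = n' by apply/eqP; rewrite -(eqn_add2r (size l)) -c2 -c2' e.
    by rewrite -cn -cn' e => ->.
  - have := index_mem y l; rewrite yl; move: c2; rewrite e cy /= => ->.
    by rewrite ltnNge leq_addl.
  - have := index_mem x l; rewrite xl; move: c2'; rewrite -e cx /= => ->.
    by rewrite ltnNge leq_addl.
  have [ixy] : (h0, index x l) = (h0, index y l) by rewrite -cx -cy.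
  by rewrite -(nth_index x xl) ixy nth_index.
exists (fun x k => (c x).1 (3 * (c x).2 + k)%N); split=> [x k Ax|x y k k' Ax Ay k3 k3' e].
  by apply: HA; case: (cP x Ax).
have [Hx _] := cP x Ax; have [Hy _] := cP y Ay; have [e1 e2] := Hinj _ _ _ _ Hx Hy e.
have kk : k = k' by move: k3 k3' e2; clear; lia.
split=> //; apply: cinj => //; rewrite [LHS]surjective_pairing [RHS]surjective_pairing e1.
by congr pair; move: k3 k3' e2; clear; lia.
Qed.

Lemma equinumerous_trans (A B C : Type) (P : A -> Prop) (Q : B -> Prop) (R : C -> Prop) :
  equinumerous P Q -> equinumerous Q R -> equinumerous P R.
Proof.
move=> [f [fi fs]] [g [gi gs]]; exists (fun x => g (f x)); split=> [a b /gi/fi//|c].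
by have [b <-] := gs c; have [a <-] := fs b; exists a.
Qed.

Lemma card_equinumerous (A B : Type) (P : set A) (Q : set B) :
  (P #= Q)%card -> equinumerous P Q.
Proof.
case/card_bijP=> f [g fK gK].
exists (fun x : {x | P x} => let y := f (SigSub (mem_set (proj2_sig x))) in
   exist Q (val y) (set_mem (valP y))).
split=> [[a Pa] [b Pb]|[b Qb]] /=.
  move=> [] /val_inj /(can_inj fK) [] ab; subst.
  by congr exist; apply: Prop_irrelevance.
pose a := g (SigSub (mem_set Qb)).
exists (exist P (val a) (set_mem (valP a))); apply: eq_exist => /=.
rewrite (_ : SigSub _ = a) ?gK //; exact: val_inj.
Qed.

Lemma card_le_inj (A B : Type) (P : set A) (Q : set B) (f : A -> B) :
  (forall x, P x -> Q (f x)) -> (forall x y, P x -> P y -> f x = f y -> x = y) ->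
  (P #<= Q)%card.
Proof.
move=> PQ fi; have e : (f @` P #= P)%card.
  by apply: inj_card_eq => x y /set_mem Px /set_mem Py; apply: fi.
apply: card_le_trans (subset_card_le (A := (f @` P)%classic) _).
  by move: e; rewrite card_eq_le => /andP[].
by move=> _ [x Px <-]; apply: PQ.
Qed.

(** Weights at least 1 give one inequality, weights at most 3 and the tripling injection give the
    other. *)
Lemma infinite_wdeg (T : choiceType) (adj : T -> T -> Prop) (w : T -> T -> nat) (v : T) :
  Defs.infinite_set (adj v) -> (forall u, adj v u -> (0 < w v u <= 3)%N) ->
  (adj v #= wdeg_set adj w v)%card.
Proof.
move=> inf w13; have [phi [phiA phiI]] := infinite_tripling inf.
apply: Cantor_Bernstein.
  apply: (@card_le_inj _ _ _ _ (fun x => (x, 0%N))) => [x vx|x y _ _ [->] //].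
  by split=> //=; have /andP[w0 _] := w13 x vx; apply/ssrnat.ltP.
apply: (@card_le_inj _ _ _ _ (fun p => phi p.1 p.2)) => [[x k] [vx kx]|].
  exact: phiA.
move=> [x k] [y k'] [/= vx kx] [/= vy ky] e.
have [_ wx] := andP (w13 x vx); have [_ wy] := andP (w13 y vy).
have k3 : (k < 3)%N by apply: leq_trans wx; apply/ssrnat.ltP.
have k'3 : (k' < 3)%N by apply: leq_trans wy; apply/ssrnat.ltP.
by have [-> ->] := phiI x y k k' vx vy k3 k'3 e.
Qed.

Lemma equinumerous_choice (A B : Type) (P : A -> Prop) (Q : B -> Prop) (b0 : B) :
  equinumerous P Q -> exists g : A -> B,
    [/\ forall x, P x -> Q (g x), forall x y, P x -> P y -> g x = g y -> x = y &
        forall y, Q y -> exists2 x, P x & g x = y].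
Proof.
move=> [f [fi fs]].
have ex x : exists y, forall h : P x, y = sval (f (exist P x h)).
  have [Px|nP] := pselect (P x); last by exists b0 => h; case: nP.
  by exists (sval (f (exist P x Px))) => h; rewrite (Prop_irrelevance h Px).
have [g gP] := choice ex; exists g; split=> [x Px|x y Px Py|y Qy].
- by rewrite (gP x Px); apply: proj2_sig.
- rewrite (gP x Px) (gP y Py) => e.
  have /fi[//] : f (exist P x Px) = f (exist P y Py) by apply: eq_sig_hprop e => ? ? ?; apply: Prop_irrelevance.
have [[x Px] fx] := fs (exist Q y Qy); exists x => //.
by rewrite (gP x Px) fx.
Qed.

Lemma equinumerous_size (T T' : eqType) (P : T -> Prop) (Q : T' -> Prop) (l : seq T) (l' : seq T') :
  uniq l -> (forall x, P x <-> x \in l) -> uniq l' -> (forall x, Q x <-> x \in l') ->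
  equinumerous P Q -> size l = size l'.
Proof.
move=> lu lP lu' lQ PQ.
have [b0|nb] := pselect (exists b0 : T', True); last first.
  have l'0 : l' = [::] by case: (l') nb => // b s []; exists b.
  case: PQ => f _; rewrite l'0; case: l {lu} lP => // x s lP.
  have Px : P x by apply/lP; rewrite mem_head.
  by case: nb; exists (sval (f (exist P x Px))).
case: b0 => b0 _; have [g [gQ gi gs]] := equinumerous_choice b0 PQ.
have mu : uniq (map g l).
  by rewrite map_inj_in_uniq // => x y xl yl; apply: gi; apply/lP.
rewrite -(size_map g); apply/eqP; rewrite eqn_leq; apply/andP; split; apply: uniq_leq_size => // y.
  by case/mapP => x /lP /gQ Qx ->; apply/lQ.
by move/lQ/gs => [x /lP xl <-]; apply: map_f.
Qed.

Lemma equinumerous_sym (A B : Type) (P : A -> Prop) (Q : B -> Prop) :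
  equinumerous P Q -> equinumerous Q P.
Proof.
move=> [f [fi fs]]; have [g fg] := choice fs; exists g; split=> [a b e|a].
  by rewrite -(fg a) e fg.
by exists (f a); apply: fi; rewrite fg.
Qed.

Lemma equinumerous_finite (T T' : choiceType) (P : T -> Prop) (Q : T' -> Prop) :
  equinumerous P Q -> Defs.finite_set P -> Defs.finite_set Q.
Proof.
move=> PQ /finite_enum[l _ lP]; apply/finite_list.
have [[b0 _]|nb] := pselect (exists b0 : T', True); last first.
  by exists [::] => y; case: nb; exists y.
have [g [_ _ gs]] := equinumerous_choice b0 PQ.
by exists (map g l) => y /gs[x /lP xl <-]; apply: map_f.
Qed.

Lemma wdeg_finite (T : choiceType) (adj : T -> T -> Prop) (w : T -> T -> nat) (v : T)
    (l : seq T) :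
  uniq l -> (forall x, adj v x <-> x \in l) ->
  exists l' : seq (T * nat), [/\ uniq l', forall p, wdeg_set adj w v p <-> p \in l' &
    size l' = (\sum_(x <- l) w v x)%N].
Proof.
move=> lu lP; exists [seq (x, k) | x <- l, k <- iota 0 (w v x)]; split.
- apply: allpairs_uniq_dep => //; first by move=> x _; apply: iota_uniq.
  by move=> [x k] [y k'] _ _ /= [-> ->].
- move=> [x k]; split=> [[/= /lP xl kw]|/allpairsPdep[y [k' [yl kw [-> ->]]]]].
    by apply/allpairsPdep; exists x, k; split=> //; rewrite mem_iota; lia.
  by split; [apply/lP|move: kw; rewrite mem_iota /=; lia].
rewrite size_allpairs_dep sumnE big_map.
by apply: eq_bigr => x _; rewrite size_iota.
Qed.

Lemma same_wdeg_infinite (T : choiceType) (adj : T -> T -> Prop) (w : T -> T -> nat) (u v : T) :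
  (forall u v, adj u v -> (0 < w u v <= 3)%N) ->
  same_wdeg adj w u v -> Defs.infinite_set (adj u) -> same_infinite_degree adj u v.
Proof.
move=> w13 uv uinf; have eu := infinite_wdeg uinf (w13 u); split=> //.
have vinf : Defs.infinite_set (adj v).
  move=> vfin; apply: uinf.
  have [l lu lP] := finite_enum vfin; have [l' [_ lP' _]] := wdeg_finite w lu lP.
  apply: (equinumerous_finite (P := wdeg_set adj w v)).
    apply: equinumerous_sym; apply: equinumerous_trans uv.
    exact: card_equinumerous.
  by apply/finite_list; exists l' => p /lP'.
apply: (equinumerous_trans (card_equinumerous eu)); apply: (equinumerous_trans uv).
by apply: card_equinumerous; rewrite card_eq_sym; apply: infinite_wdeg vinf (w13 v).
Qed.

(** [W _ x] takes finitely many values, so one of them is taken on a set of the ultrafilter; this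
    value is [w x]. Finitely many such sets and the set of lists containing [l0] have a common
    element. *)
Lemma compact_choice (T I : choiceType) (n : nat) (W : seq I -> T -> nat) :
  (forall l x, (W l x < n)%N) ->
  exists w : T -> nat, forall (s : seq T) (l0 : seq I), exists l,
    (forall i, i \in l0 -> i \in l) /\ forall x, x \in s -> w x = W l x.
Proof.
move=> Wn.
pose F : set_system (seq I) := fun A => exists l0 : seq I, forall l : seq I, {subset l0 <= l} -> A l.
have FP : ProperFilter F.
  split; first by move=> [l0 /(_ l0)]; apply.
  split; first by exists [::].
    move=> A B [a aA] [b bB]; exists (a ++ b) => l abl; split.
      by apply: aA => x xa; apply: abl; rewrite mem_cat xa.
    by apply: bB => x xb; apply: abl; rewrite mem_cat xb orbT.
  by move=> A B AB [a aA]; exists a => l /aA /AB.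
have [U [Uultra FU]] := ultraFilterLemma FP.
have ex x : exists k, U [set l | W l x = k]%classic.
  suff : forall m, U [set l | (m <= W l x)%N]%classic \/ exists k, U [set l | W l x = k]%classic.
    case/(_ n) => // Un; have /filter_ex[l /=] := Un.
    by rewrite leqNgt Wn.
  elim=> [|m [IH|//]]; last by right.
    by left; apply: filterS filterT.
  have [Um|Um] := in_ultra_setVsetC [set l | W l x = m]%classic Uultra.
    by right; exists m.
  left; apply: filterS (filterI IH Um) => l [/= h1 h2].
  by rewrite ltn_neqAle h1 andbT; apply/eqP => h3; apply: h2.
have [w wP] := choice ex; exists w => s l0.
have : U [set l | (forall i, i \in l0 -> i \in l) /\ forall x, x \in s -> w x = W l x]%classic.
  elim: s => [|x s IH].
    by apply: FU; exists l0 => l sub; split.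
  apply: filterS (filterI IH (wP x)) => l [/= [h1 h2] h3]; split=> // y.
  by rewrite in_cons => /orP[/eqP->|/h2].
by move/filter_ex => [l lP]; exists l.
Qed.

Lemma local_weighting (T : choiceType) (adj : T -> T -> Prop) (nb : T -> seq T) (l : seq T) :
  (forall u v, adj u v -> adj v u) -> (forall v, ~ adj v v) ->
  (forall u v, ~ isolated_edge adj u v) ->
  (forall v, Defs.finite_set (adj v) -> uniq (nb v) /\ forall x, adj v x <-> x \in nb v) ->
  exists w : T -> T -> nat, [/\ forall u v, w u v = w v u, forall u v, (0 < w u v <= 3)%N &
    forall u v, u \in l -> v \in l -> Defs.finite_set (adj u) -> Defs.finite_set (adj v) ->
      adj u v -> (\sum_(x <- nb u) w u x)%N != (\sum_(x <- nb v) w v x)%N].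
Proof.
move=> adjs adji noiso nbP.
pose L := [seq v <- l | `[<Defs.finite_set (adj v)>]].
have LP v : v \in L <-> v \in l /\ Defs.finite_set (adj v).
  by rewrite mem_filter; split=> [/andP[/asboolP]|[vl vf]] //; apply/andP; split=> //; apply/asboolP.
pose s := L ++ flatten (map nb L).
have Ls v : v \in L -> v \in s by move=> vL; rewrite mem_cat vL.
have nbs v x : v \in L -> adj v x -> x \in s.
  move=> vL vx; have [_ vf] := (LP v).1 vL; have [_ nbv] := nbP v vf.
  rewrite mem_cat; apply/orP; right; apply/flattenP; exists (nb v); first exact: map_f.
  exact/nbv.
pose H := seq_sub s.
(* Vertices of [L] keep all their edges, so their sums in the finite graph are the true ones; the
   other vertices may lose edges, as no inequality is asked there. *)
pose adjH : rel H := [rel a b | `[<adj (val a) (val b)>] && ((val a \in L) || (val b \in L))].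
have adjHs : symmetric adjH.
  move=> a b; rewrite /adjH /= [X in _ && X]orbC; congr (_ && _).
  by apply/asboolP/asboolP; apply: adjs.
have adjHi : irreflexive adjH.
  by move=> a /=; apply/negbTE; rewrite negb_and; apply/orP; left; apply/asboolPn; apply: adji.
have [w [ws w13 wne]] := finite_weighting adjHs adjHi.
pose W u v := if ((insub u : option H), (insub v : option H)) is (Some a, Some b) then w a b else 1%N.
have WT (a b : H) : W (val a) (val b) = w a b by rewrite /W !valK.
have WS (a : H) : val a \in L -> (\sum_(x <- nb (val a)) W (val a) x)%N = nbr_sum adjH w a.
  move=> aL; have [_ af] := (LP _).1 aL; have [nbu nba] := nbP _ af.
  have perm : perm_eq (nb (val a)) [seq val b | b <- enum [pred b | adjH a b]].
    apply: uniq_perm => //; first by rewrite map_inj_uniq ?enum_uniq //; apply: val_inj.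
    move=> x; apply/idP/mapP => [/nba ax|[b]].
      exists (Sub x (nbs _ x aL ax) : H) => //; rewrite mem_enum.
      by apply/andP; split; [apply/asboolP|apply/orP; left].
    by rewrite mem_enum => /andP[/asboolP ab _] ->; apply/nba.
  rewrite (perm_big _ perm) big_map big_enum /=.
  by apply: eq_bigr => b _; rewrite WT.
exists W; split=> [u v|u v|u v ul vl uf vf uv].
- by rewrite /W; case: (insub u : option H) => [a|]; case: (insub v : option H) => [b|].
- by rewrite /W; case: (insub u : option H) => [a|]; case: (insub v : option H) => [b|].
have uL : u \in L by apply/LP.
have vL : v \in L by apply/LP.
pose a : H := Sub u (Ls u uL); pose b : H := Sub v (Ls v vL).
have ab : adjH a b by apply/andP; split; [apply/asboolP|apply/orP; left].
rewrite -[u]/(val a) -[v]/(val b) !WS //.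
(* As [uv] is not isolated in the whole graph, it has a further neighbour, which belongs to [s]
   because both ends are in [L]. *)
have [x xP] : exists x, adj u x /\ x <> v \/ adj v x /\ x <> u.
  apply: contrapT => nx; apply: (noiso u v); split=> //.
  by split=> x ax; apply: contrapT => ne; apply: nx; exists x; tauto.
have xs : x \in s by case: xP => [[ux _]|[vx _]]; [apply: nbs ux|apply: nbs vx].
apply: (wne a b (Sub x xs : H) ab); apply/orP.
case: xP => [[ux xv]|[vx xu]]; [left|right]; apply/andP; split.
- by apply/andP; split; [apply/asboolP|apply/orP; left].
- by apply/eqP => /(congr1 val).
- by apply/andP; split; [apply/asboolP|apply/orP; left].
by apply/eqP => /(congr1 val).
Qed.

Theorem theorem2 (V : Type) (adj : V -> V -> Prop) :
  simple_graph adj ->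
  (forall u v, ~ isolated_edge adj u v) ->
  exists w : V -> V -> nat,
    weighting123 adj w /\
    forall u v, adj u v ->
      ~ same_wdeg adj w u v \/ same_infinite_degree adj u v.
Proof.
case=> adjs adji noiso; pose T : choiceType := {classic V}.
have ex (v : T) : exists l : seq T, @Defs.finite_set T (adj v) ->
    uniq l /\ forall x : T, adj v x <-> x \in l.
  have [vf|vi] := pselect (@Defs.finite_set T (adj v)); last by exists [::].
  by have [l lu lP] := finite_enum vf; exists l.
have [nb nbP] := choice ex.
have [W WP] := choice (fun l => @local_weighting T adj nb l adjs adji noiso nbP).
have [|w wP] := @compact_choice (T * T)%type T 4 (fun l p => W l p.1 p.2).
  by move=> l [u v] /=; have [_ w13 _] := WP l; have := w13 u v; lia.
pose w' (u v : T) := w (u, v).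
have w13 u v : (0 < w' u v <= 3)%N.
  by have [l [_ lw]] := wP [:: (u, v)] [::]; rewrite /w' lw ?mem_head //; case: (WP l).
have w's u v : w' u v = w' v u.
  have [l [_ lw]] := wP [:: (u, v); (v, u)] [::].
  by rewrite /w' !lw ?inE ?eqxx ?orbT //; case: (WP l).
exists w'; split=> [u v uv|u v uv].
  by split; [exact: w's|have := w13 u v; lia].
have [same|] := pselect (same_wdeg adj w' u v); last by left.
have [uf|ui] := pselect (@Defs.finite_set T (adj u)); last first.
  by right; apply: (@same_wdeg_infinite T) same ui => x y _; apply: w13.
have [vf|vi] := pselect (@Defs.finite_set T (adj v)); last first.
  have [_ e] := @same_wdeg_infinite T adj w' v u (fun x y _ => w13 x y) (equinumerous_sym same) vi.
  by case: vi; apply: (@equinumerous_finite T T) uf; apply: equinumerous_sym.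
left=> _; have [nu uP] := nbP u uf; have [nv vP] := nbP v vf.
have [lu [luu luP lus]] := wdeg_finite w' nu uP.
have [lv [lvu lvP lvs]] := wdeg_finite w' nv vP.
have := equinumerous_size luu luP lvu lvP same; rewrite lus lvs.
(* The two sums involve finitely many pairs, on which [w] agrees with a local weighting that
   distinguishes [u] from [v]. *)
have [l [lsub lw]] := wP ([seq (u, x) | x <- nb u] ++ [seq (v, x) | x <- nb v]) [:: u; v].
have [_ _ ne] := WP l; move/eqP; apply/negP.
rewrite (eq_big_seq (fun x => W l u x)); last first.
  by move=> x xu; rewrite /w' lw // mem_cat map_f.
rewrite [X in _ != X](eq_big_seq (fun x => W l v x)); last first.
  by move=> x xv; rewrite /w' lw // mem_cat [X in _ || X]map_f ?orbT.
by apply: ne => //; apply: lsub; rewrite !inE eqxx ?orbT.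
Qed.
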